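(* Let $\lambda\in(0,\infty)$, let $\alpha$ be a random variable with values in $(0,1)$, let $(X_k)_{k\in\mathbb Z_+}$ be the associated randomized INAR(1) process with Poisson innovations, and let $\widetilde S^{(N)}$ be the conditionally centered aggregated process (both defined in the context). If $\mathbb E\bigl(\frac{1}{1-\alpha}\bigr)<\infty$, then, in the sense of weak convergence of finite dimensional distributions, $$N^{-\frac12}\widetilde S^{(N)}\longrightarrow\widetilde{\mathcal Y}\qquad\text{as }N\to\infty,$$ where $\widetilde{\mathcal Y}=(\widetilde{\mathcal Y}_k)_{k\in\mathbb Z_+}$ is a stationary Gaussian process with zero mean and covariances $$\mathbb E(\widetilde{\mathcal Y}_0\widetilde{\mathcal Y}_k)=\operatorname{Cov}\left(X_0-\frac{\lambda}{1-\alpha},\,X_k-\frac{\lambda}{1-\alpha}\right)=\lambda\,\mathbb E\Bigl(\frac{\alpha^k}{1-\alpha}\Bigr),\qquad k\in\mathbb Z_+.$$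
   Context: Randomized INAR(1) process: let $\lambda\in(0,\infty)$ and let $\alpha$ be a random variable with values in $(0,1)$. Let $X_0$, $\xi_{k,j}$, $\varepsilon_k$ ($k,j\in\mathbb N=\{1,2,\dots\}$) be random variables which are conditionally independent given $\alpha$ and such that, conditionally on $\alpha$, each $\xi_{k,j}$ is Bernoulli with $\mathbb P(\xi_{k,j}=1\mid\alpha)=\alpha=1-\mathbb P(\xi_{k,j}=0\mid\alpha)$, each $\varepsilon_k$ is Poisson with parameter $\lambda$, and $X_0$ is Poisson with parameter $\lambda/(1-\alpha)$. Define $X_k=\sum_{j=1}^{X_{k-1}}\xi_{k,j}+\varepsilon_k$, $k\in\mathbb N$ (with $\sum_{j=1}^0:=0$). Let $(\alpha^{(j)},(X^{(j)}_k)_{k\in\mathbb Z_+})$, $j\in\mathbb N$, be independent copies of $(\alpha,(X_k)_{k\in\mathbb Z_+})$, where $\mathbb Z_+=\{0,1,2,\dots\}$. Conditional expectations are in the generalized sense, and $\mathbb E(X_k\mid\alpha)=\lambda/(1-\alpha)$. For $N\in\mathbb N$ set $\widetilde S^{(N)}_k:=\sum_{j=1}^N\bigl(X^{(j)}_k-\mathbb E(X^{(j)}_k\mid\alpha^{(j)})\bigr)=\sum_{j=1}^N\bigl(X^{(j)}_k-\frac{\lambda}{1-\alpha^{(j)}}\bigr)$, $k\in\mathbb Z_+$. *)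

(* Defs.v *)
From HB Require Import structures.
From mathcomp Require Import all_boot all_order all_algebra.
From mathcomp Require Import all_classical all_reals all_analysis.

Set Implicit Arguments.
Unset Strict Implicit.
Unset Printing Implicit Defensive.

Import Order.TTheory GRing.Theory Num.Theory.
Import numFieldNormedType.Exports.

Local Open Scope classical_set_scope.
Local Open Scope ring_scope.
Local Open Scope ereal_scope.

(* [Y] is a version of E(Z | alpha). The integrals are extended-real valued and
   [Z] is not required to be integrable, so for [Z >= 0] this is the generalized
   conditional expectation; it is only meant for such [Z]. *)
Definition is_cond_exp d (T : measurableType d) (R : realType)
    (P : probability T R) (alpha Z Y : T -> R) : Prop :=
  measurable_fun [set: g_sigma_algebra_preimageType alpha]
    (Y : g_sigma_algebra_preimageType alpha -> R) /\
  forall A, g_sigma_algebra_preimage alpha A ->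
    \int[P]_(w in A) (Z w)%:E = \int[P]_(w in A) (Y w)%:E.

Definition is_cond_prob d (T : measurableType d) (R : realType)
    (P : probability T R) (alpha : T -> R) (A : set T) (p : T -> R) : Prop :=
  is_cond_exp P alpha (\1_A) p.

(* The product rule over finite subfamilies, for arbitrary versions of the
   conditional probabilities involved (they are almost surely unique). *)
Definition cond_independent d (T : measurableType d) (R : realType)
    (P : probability T R) (alpha : T -> R) (I : choiceType)
    d' (T' : measurableType d') (U : I -> T -> T') : Prop :=
  forall (s : seq I) (B : I -> set T') (p : I -> T -> R),
    uniq s ->
    (forall i, i \in s ->
       measurable (B i) /\ is_cond_prob P alpha (U i @^-1` B i) (p i)) ->
    is_cond_prob P alpha (\big[setI/setT]_(i <- s) (U i @^-1` B i))
      (fun w => \prod_(i <- s) p i w)%R.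

(* Indices of [xi] and [eps] start at 0: [xi k j] is xi_{k+1,j+1} and [eps k] is
   eps_{k+1} of the usual notation, where k, j range over {1, 2, ...}. *)
Fixpoint INAR1 (T : Type) (X0 : T -> nat) (xi : nat -> nat -> T -> nat)
    (eps : nat -> T -> nat) (k : nat) (w : T) : nat :=
  if k is k'.+1 then
    (\sum_(j < INAR1 X0 xi eps k' w) xi k' j w + eps k' w)%N
  else X0 w.

Definition inputs (T : Type) (X0 : T -> nat) (xi : nat -> nat -> T -> nat)
    (eps : nat -> T -> nat) (i : unit + nat * nat + nat) : T -> nat :=
  match i with
  | inl (inl _) => X0
  | inl (inr kj) => xi kj.1 kj.2
  | inr k => eps k
  end.

Record randomized_INAR1_inputs d (T : measurableType d) (R : realType)
    (P : probability T R) (lambda : R) (alpha : {RV P >-> R})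
    (X0 : {RV P >-> nat}) (xi : nat -> nat -> {RV P >-> nat})
    (eps : nat -> {RV P >-> nat}) : Prop := {
  alpha_in01 : forall w, (0 < alpha w < 1)%R ;
  inputs_independent :
    cond_independent P alpha (inputs X0 (fun k j => xi k j) (fun k => eps k)) ;
  xi_bernoulli1 : forall k j,
    is_cond_prob P alpha (xi k j @^-1` [set 1%N]) alpha ;
  xi_bernoulli0 : forall k j,
    is_cond_prob P alpha (xi k j @^-1` [set 0%N]) (fun w => 1 - alpha w)%R ;
  eps_poisson : forall k n,
    is_cond_prob P alpha (eps k @^-1` [set n]) (fun=> poisson_pmf lambda n) ;
  X0_poisson : forall n,
    is_cond_prob P alpha (X0 @^-1` [set n])
      (fun w => poisson_pmf (lambda / (1 - alpha w))%R n) }.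

(* The product sigma-algebra on R x nat^nat, in which (alpha, (X_k)_k) lives. *)
Definition path_events (R : realType) : set (set (R * (nat -> nat))) :=
  <<s [set E | exists2 B : set R, measurable B & E = [set p | B p.1]] `|`
      [set E | exists k, exists B : set nat, E = [set p | B (p.2 k)]] >>.

Definition random_path (T : Type) (R : realType) (alpha : T -> R)
    (X : nat -> T -> nat) (w : T) : R * (nat -> nat) := (alpha w, X ^~ w).

(* The random elements [Z' j], j : nat, of R x nat^nat are mutually independent
   and each has the law of [Z]; the two probability spaces may differ. *)
Definition independent_copies (R : realType)
    d (T : measurableType d) (P : probability T R)
    d' (T' : measurableType d') (P' : probability T' R)
    (Z : T -> R * (nat -> nat)) (Z' : nat -> T' -> R * (nat -> nat)) : Prop :=
  (forall j E, path_events E -> P' (Z' j @^-1` E) = P (Z @^-1` E)) /\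
  (forall (s : seq nat) (E : nat -> set (R * (nat -> nat))),
     uniq s -> (forall j, j \in s -> path_events (E j)) ->
     P' (\big[setI/setT]_(j <- s) (Z' j @^-1` E j)) =
     \prod_(j <- s) P' (Z' j @^-1` E j)).

(* [M j k] stands for E(X^(j)_k | alpha^(j)). *)
Definition centered_aggregate (T : Type) (R : realType)
    (X : nat -> nat -> T -> nat) (M : nat -> nat -> T -> R)
    (N k : nat) (w : T) : R :=
  (\sum_(j < N) ((X j k w)%:R - M j k w))%R.

Definition fdd_converges (R : realType)
    d (T : measurableType d) (P : probability T R)
    d' (T' : measurableType d') (Q : probability T' R)
    (Z : nat -> nat -> T -> R) (Y : nat -> T' -> R) : Prop :=
  forall (n : nat) (ks : 'I_n -> nat) (f : 'rV[R]_n -> R),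
    continuous f -> bounded_fun f ->
    'E_P[fun w => f (\row_i Z N (ks i) w)] @[N --> \oo]
      --> 'E_Q[fun w => f (\row_i Y (ks i) w)].

(* [normal_prob m 0] is not the degenerate law at [m], hence the case split. *)
Definition gaussian_law (R : realType) (m s : R) (B : set R) : \bar R :=
  if s == 0%R then \d_m B else normal_prob m s B.

Definition gaussian_process (R : realType) d (T : measurableType d)
    (P : probability T R) (Y : nat -> {RV P >-> R}) : Prop :=
  forall (n : nat) (ks : 'I_n -> nat) (c : 'I_n -> R),
    exists m s : R, forall B : set R, measurable B ->
      P [set w | B (\sum_(i < n) c i * Y (ks i) w)%R] = gaussian_law m s B.

Definition stationary_process (R : realType) d (T : measurableType d)
    (P : probability T R) (Y : nat -> {RV P >-> R}) : Prop :=
  forall (n : nat) (ks : n.-tuple nat) (h : nat) (B : set (n.-tuple R)),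
    measurable B ->
    P [set w | B [tuple Y (tnth ks i + h)%N w | i < n]] =
    P [set w | B [tuple Y (tnth ks i) w | i < n]].

(* Main.v *)
Require Import Defs.
From HB Require Import structures.
From mathcomp Require Import all_boot all_order all_algebra.
From mathcomp Require Import all_classical all_reals all_analysis.
From mathcomp Require Import measurable_realfun.
From mathcomp Require Import ring lra.
Import Order.TTheory GRing.Theory Num.Theory.
Import numFieldNormedType.Exports.
Local Open Scope classical_set_scope.
Local Open Scope ring_scope.
Set Implicit Arguments.
Unset Strict Implicit.
Unset Printing Implicit Defensive.

(** Let m = lambda / (1 - alpha) be the conditional mean of the process given alpha
    and D k = X k - m.  The sums over N of the N-th aggregate are sums of independent
    copies of the sequence D.  If D has mean zero and finite second moments, the
    central limit theorem for random vectors gives a Gaussian limit of the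
    finite-dimensional distributions of the normalized aggregates, with the
    covariances of D; these are lambda E (alpha^|k - l| / (1 - alpha)) and depend on
    |k - l| only, so the limit is stationary.

    The second-order structure of D comes from the recursion.  Given alpha, the next
    value is a binomial thinning of the present one plus an independent Poisson
    variable, so that E (g X_{k+1}) = E (g (alpha X_k + lambda)) for every nonnegative
    function g of alpha, and similarly for squares (integral_INAR1S,
    integral_INAR1S_sqr).  The conditional moments m and m + m^2 of a Poisson variable
    of mean m are the fixed points of these recursions, and repeated thinning gives
    E (g X_l X_{l+j}) = E (g (alpha^j m + m^2)) (mean_INAR1_mul).  Here m^2 need not be
    integrable, although m is: the terms m^2 cancel in the moments of D, and the
    cancellation is carried out on events where m is bounded (centered_INAR1_sqr).

    The central limit theorem is proved with characteristic functions, whose real and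
    imaginary parts are means of cosines and sines.  The addition formulas and
    independence give a recursion on N (mean_cos_partial_sumS), a second-order
    expansion at 0 replaces each factor by that of a normal variable
    (trig_product_approx, characteristic_expansion), and Levy's continuity theorem
    concludes (cvg_mean_of_cos).  The latter is elementary here: the characteristic
    functions are uniformly quadratic at 0, which bounds second moments, and bounded
    continuous functions are approximated on large boxes by trigonometric polynomials
    (trigpoly_approx), namely Bernstein polynomials in the sines of the coordinates.

    The limit process lives on the unit interval with the uniform law.  Separating the
    binary digits of even and of odd rank turns one uniform variable into two
    independent ones (mean_even_odd), hence into an infinite sequence; the quantile
    function makes it a sequence of independent normal variables
    (mean_cos_gaussian_seq), and the Cholesky factor of the covariance makes that a
    Gaussian process (choleskyE, mean_cos_gaussian).

    Finally, any version of the conditional expectation of a copy given its parameter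
    is almost surely lambda / (1 - alpha') (cond_exp_version), so that the choice of
    versions does not change the law of the aggregates. *)

(** * Inequalities for the sine and the cosine *)

Section trig_inequalities.
Context {R : realType}.
Implicit Types x y h : R.

Lemma is_derive_continuous (f df : R -> R) :
  (forall x, is_derive x 1 f (df x)) -> continuous f.
Proof.
by move=> fd x; apply: differentiable_continuous; apply/derivable1_diffP.
Qed.

Lemma MVT_anywhere (f df : R -> R) x y :
  (forall x, is_derive x 1 f (df x)) ->
  exists c, [/\ f y - f x = df c * (y - x), Num.min x y <= c & c <= Num.max x y].
Proof.
move=> fd.
have cf : continuous f := is_derive_continuous fd.
have [xy|yx] := leP x y.
  have [c /[!in_itv]/= /andP[xc cy] e] :=
    MVT_segment xy (fun x _ => fd x) (continuous_subspaceT cf).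
  by exists c.
have [c /[!in_itv]/= /andP[xc cy] e] :=
  MVT_segment (ltW yx) (fun x _ => fd x) (continuous_subspaceT cf).
exists c; split => //.
by rewrite -opprB e; ring.
Qed.

Lemma MVT_from0 (f df : R -> R) x : f 0 = 0 ->
  (forall x, is_derive x 1 f (df x)) ->
  exists2 c, `|c| <= `|x| & f x = df c * x.
Proof.
move=> f0 fd; have [c []] := MVT_anywhere 0 x fd.
rewrite f0 !subr0 => e c0 c1; exists c => //.
have [x0|x0] := leP 0 x.
  by move: c0 c1; rewrite (min_l x0) (max_r x0) => c0 c1; rewrite !ger0_norm.
move: c0 c1; rewrite (min_r (ltW x0)) (max_l (ltW x0)) => c0 c1.
by rewrite !ler0_norm ?lerN2// ltW.
Qed.

Lemma sin_le_abs x : `|sin x| <= `|x|.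
Proof.
have [c _ ->] := MVT_from0 x (sin0 R) (@is_derive_sin R).
by rewrite normrM ler_piMl// cos_max.
Qed.

Lemma cosB1E x : 1 - cos x = 2 * sin (x / 2) ^+ 2.
Proof.
have -> : cos x = cos ((x / 2) *+ 2) by congr cos; field.
by rewrite cos_mulr2n cos2sin2; ring.
Qed.

Lemma cosB1_ge0 x : 0 <= 1 - cos x.
Proof. by rewrite subr_ge0 cos_le1. Qed.

Lemma cosB1_le_sqr x : 1 - cos x <= x ^+ 2 / 2.
Proof.
rewrite cosB1E; have := sin_le_abs (x / 2).
rewrite -(@ler_pXn2r _ 2) ?nnegrE// !real_normK ?num_real//; nra.
Qed.

Lemma cosB1_le_abs x : 1 - cos x <= `|x|.
Proof.
have := cosB1_le_sqr x; have := cos_geN1 x => h1 h2.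
have [|] := leP `|x| 2 => x2; last lra.
by move: h2; rewrite -(real_normK (num_real x)); have := normr_ge0 x; nra.
Qed.

Lemma sinB_sub_le x : `|x - sin x| <= Num.min (x ^+ 2) (`|x| ^+ 3).
Proof.
have d y : is_derive y 1 (fun y => y - sin y) (1 - cos y).
  by apply: is_deriveB.
have f0 : 0 - sin 0 = 0 :> R by rewrite sin0 subrr.
have [c cx /= ->] := @MVT_from0 (fun y => y - sin y) _ x f0 d.
rewrite normrM (ger0_norm (cosB1_ge0 c)) le_min; apply/andP; split.
  rewrite -(real_normK (num_real x)) expr2 ler_wpM2r//.
  exact: le_trans (cosB1_le_abs c) cx.
rewrite exprSr ler_wpM2r// (le_trans (cosB1_le_sqr c))//.
rewrite -(real_normK (num_real c)).
by have := normr_ge0 c; have := normr_ge0 x; nra.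
Qed.

Lemma cosB1B_le x : `|x ^+ 2 / 2 - (1 - cos x)| <= `|x| ^+ 3.
Proof.
have d y : is_derive y 1 (fun y => y ^+ 2 / 2 - (1 - cos y)) (y - sin y).
  have -> : y - sin y = 2^-1 *: (2%:R *: y ^+ 1 *: 1) - (0 - (- sin y)).
    by rewrite !scaler1 expr1 opprK add0r /GRing.scale/=; field.
  apply: is_deriveB.
  have -> : (fun y : R => y ^+ 2 / 2) = 2^-1 \*: (fun y => y ^+ 2).
    by apply/funext => z; rewrite /GRing.scale/= mulrC.
  apply: is_deriveZ.
  have -> : (fun y : R => y ^+ 2) = id ^+ 2 by [].
  exact: is_deriveX.
have f0 : 0 ^+ 2 / 2 - (1 - cos 0) = 0 :> R by rewrite cos0; field.
have [c cx /= ->] := @MVT_from0 (fun y => y ^+ 2 / 2 - (1 - cos y)) _ x f0 d.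
rewrite normrM exprSr ler_wpM2r// (le_trans (sinB_sub_le c))// ge_min.
by rewrite -(real_normK (num_real c)) lerXn2r.
Qed.

(** On [-1, 1] the derivative of the sine is at least cos 1. *)
Lemma sin_expands x y : `|x| <= 1 -> `|y| <= 1 ->
  cos 1 * `|x - y| <= `|sin x - sin y|.
Proof.
move=> x1 y1; have [c [-> c0 c1]] := MVT_anywhere y x (@is_derive_sin R).
have {}c1 : `|c| <= 1.
  move: x1 y1; rewrite !ler_norml => /andP[? ?] /andP[? ?].
  rewrite (le_trans _ c0) ?le_min ?(le_trans c1) ?ge_max//; lra.
rewrite normrM ler_wpM2r// -(cos_norm c).
have cle : 1 <= pi :> R by have := pi_ge2 R; lra.
have : cos 1 <= cos `|c|; last by move/le_trans; apply; exact: ler_norm.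
have [->//|/eqP cn1] := eqVneq `|c| 1.
rewrite ltW// ltr_cos ?in_itv/= ?ler01 ?normr_ge0 ?(le_trans c1)//.
by rewrite lt_neqAle c1 andbT; apply/eqP.
Qed.

Lemma cos_lipschitz x y : `|cos x - cos y| <= `|x - y|.
Proof.
have [c [-> _ _]] := MVT_anywhere y x (@is_derive_cos R).
by rewrite normrM ler_piMl// normrN sin_max.
Qed.

Lemma cosM x y : cos x * cos y = (cos (x + y) + cos (x - y)) / 2.
Proof. by rewrite cosD cosB; field. Qed.

End trig_inequalities.

(** * Integrals of bounded functions against a probability *)

Section bounded_measurable.
Context d (T : measurableType d) (R : realType) (P : probability T R).
Implicit Types f g : T -> R.

Definition bounded_measurable f :=
  measurable_fun setT f /\ exists K, forall x, `|f x| <= K.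

Lemma bounded_measurable_cst c : bounded_measurable (fun=> c).
Proof. by split => //; exists `|c|. Qed.

Lemma bounded_measurableD f g : bounded_measurable f -> bounded_measurable g ->
  bounded_measurable (fun x => f x + g x).
Proof.
move=> [mf [K fK]] [mg [L gL]]; split; first exact: measurable_funD.
by exists (K + L) => x; rewrite (le_trans (ler_normD _ _))// lerD.
Qed.

Lemma bounded_measurableM f g : bounded_measurable f -> bounded_measurable g ->
  bounded_measurable (fun x => f x * g x).
Proof.
move=> [mf [K fK]] [mg [L gL]]; split; first exact: measurable_funM.
by exists (K * L) => x; rewrite normrM ler_pM.
Qed.

Lemma bounded_measurableZ c f : bounded_measurable f ->
  bounded_measurable (fun x => c * f x).
Proof. exact/bounded_measurableM/bounded_measurable_cst. Qed.

Lemma bounded_measurableB f g : bounded_measurable f -> bounded_measurable g ->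
  bounded_measurable (fun x => f x - g x).
Proof.
move=> bf bg; under eq_fun do rewrite -mulN1r.
by apply: bounded_measurableD => //; exact: bounded_measurableZ.
Qed.

Lemma measurable_cos f : measurable_fun setT f ->
  measurable_fun setT (fun x => cos (f x)).
Proof.
move=> mf; apply: (measurableT_comp _ mf).
by apply: continuous_measurable_fun; exact: continuous_cos.
Qed.

Lemma measurable_sin f : measurable_fun setT f ->
  measurable_fun setT (fun x => sin (f x)).
Proof.
move=> mf; apply: (measurableT_comp _ mf).
by apply: continuous_measurable_fun; exact: continuous_sin.
Qed.

Lemma bounded_measurable_cos f : measurable_fun setT f ->
  bounded_measurable (fun x => cos (f x)).
Proof.
by move=> mf; split; [exact: measurable_cos|exists 1 => x; exact: cos_max].
Qed.

Lemma bounded_measurable_sin f : measurable_fun setT f ->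
  bounded_measurable (fun x => sin (f x)).
Proof.
by move=> mf; split; [exact: measurable_sin|exists 1 => x; exact: sin_max].
Qed.

Lemma bounded_measurable_integrable f : bounded_measurable f ->
  P.-integrable setT (EFin \o f).
Proof.
move=> [mf [K fK]]; apply: measurable_bounded_integrable => //.
  by rewrite (le_lt_trans (probability_le1 _ _))// ltry.
by exists K; split; [exact: num_real|move=> M KM x _; exact: le_trans (fK x) (ltW KM)].
Qed.

Lemma EFin_Rintegral f : P.-integrable setT (EFin \o f) ->
  (\int[P]_x (f x)%:E)%E = (\int[P]_x f x)%:E.
Proof. by move=> fi; rewrite /Rintegral fineK//; exact: integrable_fin_num. Qed.

Lemma Rintegral_probability_cst c : \int[P]_x c = c.
Proof.
rewrite Rintegral_cst//; have -> : fine (P setT) = 1 by rewrite probability_setT.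
by rewrite mulr1.
Qed.

Lemma norm_Rintegral_le f g : measurable_fun setT f ->
  P.-integrable setT (EFin \o g) -> (forall x, `|f x| <= g x) ->
  `|\int[P]_x f x| <= \int[P]_x g x.
Proof.
move=> mf ig fg; have fi : P.-integrable setT (EFin \o f).
  apply: le_integrable ig => //; first exact/measurable_EFinP.
  by move=> x _ /=; rewrite lee_fin (le_trans (fg x))// ler_norm.
rewrite (le_trans (le_normr_Rintegral _ fi))// le_Rintegral//.
exact: integrable_norm.
Qed.

Lemma norm_Rintegral_bound f K : measurable_fun setT f ->
  (forall x, `|f x| <= K) -> `|\int[P]_x f x| <= K.
Proof.
move=> mf fK; rewrite -[leRHS]Rintegral_probability_cst norm_Rintegral_le//.
exact/bounded_measurable_integrable/bounded_measurable_cst.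
Qed.

(** On a probability space 1 + f^2, which dominates |f|, is integrable. *)
Lemma integrable_of_sqr f : measurable_fun setT f ->
  P.-integrable setT (EFin \o (fun x => f x ^+ 2)) -> P.-integrable setT (EFin \o f).
Proof.
move=> mf if2.
have i1 := bounded_measurable_integrable (bounded_measurable_cst 1).
apply: (le_integrable measurableT _ _ (integrableD measurableT i1 if2)).
  exact/measurable_EFinP.
move=> x _; rewrite /= lee_fin [leRHS]ger0_norm ?addr_ge0 ?sqr_ge0//.
by rewrite -(real_normK (num_real (f x))); have := normr_ge0 (f x); nra.
Qed.

Lemma Rdominated_cvg (f_ : nat -> T -> R) f g :
  (forall n, measurable_fun setT (f_ n)) ->
  (forall x, f_ ^~ x @ \oo --> f x) ->
  P.-integrable setT (EFin \o g) -> (forall n x, `|f_ n x| <= g x) ->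
  \int[P]_x f_ n x @[n --> \oo] --> \int[P]_x f x.
Proof.
move=> mf ff gi fg; apply: fine_cvg.
have mf' : measurable_fun setT f by apply: measurable_fun_cvg mf _ => x _; exact: ff.
have fgx x : `|f x| <= g x.
  rewrite ler_norml; apply/andP; split.
    apply: (ler_cvg_to (cvg_cst (- g x)) (ff x)); apply: nearW => n.
    by have := fg n x; rewrite ler_norml => /andP[].
  apply: (ler_cvg_to (ff x) (cvg_cst (g x))); apply: nearW => n.
  by have := fg n x; rewrite ler_norml => /andP[].
have fi : P.-integrable setT (EFin \o f).
  apply: le_integrable gi => //; first exact/measurable_EFinP.
  by move=> x _ /=; rewrite lee_fin (le_trans (fgx x))// ler_norm.
rewrite -EFin_Rintegral//.
apply: (@dominated_cvg _ _ _ P setT measurableT (fun n x => (f_ n x)%:E)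
  (fun x => (f x)%:E) (fun x => (g x)%:E)) => //.
- by move=> n; exact/measurable_EFinP.
- by move=> x _; apply: cvg_EFin; [exact: nearW|exact: ff].
- by move=> n x _; rewrite lee_fin.
Qed.

End bounded_measurable.

(** * Second moments from the characteristic function *)

Section second_moment.
Context d (T : measurableType d) (R : realType) (P : probability T R).
Local Open Scope ereal_scope.

(** (1 - cos (h x)) / h^2 tends to x^2 / 2 as h tends to 0, so that Fatou's
    lemma turns a quadratic bound at 0 on the real part of the characteristic
    function into a second moment. *)
Lemma second_moment_le (X : T -> R) (C : R) : measurable_fun setT X ->
  (forall h : R, 1 - \int[P]_w cos (h * X w) <= C * h ^+ 2)%R ->
  \int[P]_w ((X w) ^+ 2)%:E <= (2 * C)%:E.
Proof.
move=> mX hX.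
pose f (n : nat) w : R := (2 * n.+1%:R ^+ 2 * (1 - cos (n.+1%:R^-1 * X w)))%R.
have mf n : measurable_fun setT (fun w => (f n w)%:E).
  apply/measurable_EFinP; apply: measurable_funM => //.
  apply: measurable_funB => //; apply: measurable_cos.
  exact: measurable_funM.
have f0 n w : 0 <= (f n w)%:E.
  by rewrite lee_fin mulr_ge0 ?mulr_ge0 ?sqr_ge0 ?cosB1_ge0.
have fX w : (f n w)%:E @[n --> \oo] --> ((X w) ^+ 2)%:E.
  apply: cvg_EFin; first exact: nearW.
  apply/cvgrPdist_le => e e0 /=.
  have inv0 : (2 * `|X w| ^+ 3 * n.+1%:R^-1)%R @[n --> \oo] --> (0 : R)%R.
    rewrite -(mulr0 (2 * `|X w| ^+ 3)%R); apply: cvgMr.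
    exact: cvg_harmonic.
  move/cvgrPdist_le : inv0 => /(_ e e0); apply: filterS => n.
  rewrite sub0r normrN; apply: le_trans.
  have n0 : (0 < n.+1%:R :> R)%R by [].
  have := cosB1B_le (n.+1%:R^-1 * X w)%R.
  set y := (n.+1%:R^-1 * X w)%R => hy.
  have -> : ((X w) ^+ 2 - f n w = 2 * n.+1%:R ^+ 2 * (y ^+ 2 / 2 - (1 - cos y)))%R.
    by rewrite /f -/y; rewrite {2}/y; field; rewrite gt_eqF.
  rewrite normrM [X in (X * _ <= _)%R]ger0_norm ?mulr_ge0 ?sqr_ge0//.
  rewrite (le_trans (ler_wpM2l _ hy)) ?mulr_ge0 ?sqr_ge0//.
  rewrite [leRHS]ger0_norm; last first.
    by apply: mulr_ge0; [apply: mulr_ge0 => //; exact: exprn_ge0|rewrite invr_ge0].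
  rewrite le_eqVlt; apply/orP; left; apply/eqP.
  rewrite /y normrM ger0_norm ?invr_ge0//; field; by rewrite gt_eqF.
have := fatou P measurableT mf (fun n w _ => f0 n w).
under eq_integral do rewrite (cvg_limn_einf_sup (fX _)).1.
move=> /le_trans; apply.
rewrite limn_einf_lim; apply: lime_le; first exact: is_cvg_einfs.
apply: nearW => n; apply: ge_ereal_inf; exists (\int[P]_w (f n w)%:E); first by exists n => /=.
have bc : bounded_measurable (fun w => cos (n.+1%:R^-1 * X w)).
  by apply: bounded_measurable_cos; exact: measurable_funM.
have b1 : bounded_measurable (fun w => 1 - cos (n.+1%:R^-1 * X w))%R.
  by apply: bounded_measurableB => //; exact: bounded_measurable_cst.
rewrite EFin_Rintegral ?lee_fin; last first.
  by apply: bounded_measurable_integrable; exact: bounded_measurableZ.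
rewrite RintegralZl//; last exact: bounded_measurable_integrable.
rewrite RintegralB//; last 2 first.
  by apply/bounded_measurable_integrable/bounded_measurable_cst.
  exact: bounded_measurable_integrable.
rewrite Rintegral_probability_cst.
rewrite (le_trans (ler_wpM2l _ (hX _)))//.
rewrite le_eqVlt; apply/orP; left; apply/eqP; field.
by rewrite gt_eqF.
Qed.

End second_moment.

(** * Bernstein polynomials *)

Section bernstein.
Context {R : realType}.
Implicit Types (p : R) (m k : nat).

(** The binomial weights, by conditioning on the last trial. *)
Fixpoint bern p m k : R :=
  if m is m'.+1 then
    (1 - p) * bern p m' k + (if k is k'.+1 then p * bern p m' k' else 0)
  else (k == 0)%:R.

Lemma bern_ge0 p m k : 0 <= p <= 1 -> 0 <= bern p m k.
Proof.
move=> /andP[p0 p1]; elim: m k => [|m IHm] [|k]//=.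
- by rewrite addr0 mulr_ge0 ?subr_ge0.
- by rewrite addr_ge0// mulr_ge0 ?subr_ge0.
Qed.

Lemma bern_gt p m k : (m < k)%N -> bern p m k = 0.
Proof.
elim: m k => [|m IHm] [|k]//= mk.
by rewrite !IHm ?(ltnW mk)// !mulr0 addr0.
Qed.

(** Conditioning the expectation of h on the last trial; mean and variance of
    the binomial law follow by induction, with no binomial coefficient. *)
Lemma sum_bernS p m (h : nat -> R) :
  \sum_(k < m.+2) h k * bern p m.+1 k =
  \sum_(k < m.+1) ((1 - p) * h k + p * h k.+1) * bern p m k.
Proof.
under eq_bigr do rewrite /= mulrDr.
rewrite big_split/= big_ord_recr/= (@bern_gt p m m.+1)// !mulr0 addr0.
rewrite [X in _ + X]big_ord_recl/= mulr0 add0r -big_split/=.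
by apply: eq_bigr => k _; ring.
Qed.

Lemma sum_bern p m : \sum_(k < m.+1) bern p m k = 1.
Proof.
elim: m => [|m IHm]; first by rewrite big_ord_recl big_ord0 addr0.
under eq_bigr do rewrite -[bern _ _ _]mul1r.
rewrite (sum_bernS p m (fun=> 1)) -[RHS]IHm; apply: eq_bigr => k _ /=; ring.
Qed.

Lemma sum_bern_sqr p m c :
  \sum_(k < m.+1) (k%:R - c) ^+ 2 * bern p m k =
  m%:R * (p * (1 - p)) + (m%:R * p - c) ^+ 2.
Proof.
elim: m c => [|m IHm] c; first by rewrite big_ord_recl big_ord0 /=; ring.
rewrite (sum_bernS p m (fun k => (k%:R - c) ^+ 2)).
under eq_bigr => k _.
  have -> : ((1 - p) * (k%:R - c) ^+ 2 + p * (k.+1%:R - c) ^+ 2) * bern p m k =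
      (k%:R - (c - p)) ^+ 2 * bern p m k + p * (1 - p) * bern p m k.
    by rewrite -natr1; ring.
  over.
by rewrite big_split/= -mulr_sumr sum_bern IHm -natr1; ring.
Qed.

Lemma bern_variance p m : 0 <= p <= 1 ->
  \sum_(k < m.+2) (k%:R / m.+1%:R - p) ^+ 2 * bern p m.+1 k <= m.+1%:R^-1.
Proof.
move=> /andP[p0 p1].
have m0 : m.+1%:R != 0 :> R by rewrite pnatr_eq0.
have -> : \sum_(k < m.+2) (k%:R / m.+1%:R - p) ^+ 2 * bern p m.+1 k =
    m.+1%:R ^- 2 *
    \sum_(k < m.+2) (k%:R - m.+1%:R * p) ^+ 2 * bern p m.+1 k.
  by rewrite mulr_sumr; apply: eq_bigr => k _; field; rewrite nat1r.
rewrite (sum_bern_sqr p m.+1 (m.+1%:R * p)) subrr expr0n addr0.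
rewrite [leLHS](_ : _ = m.+1%:R^-1 * (p * (1 - p))); last by field; rewrite nat1r.
by rewrite ler_piMr ?invr_ge0//; nra.
Qed.

End bernstein.

(** * Trigonometric approximation of continuous functions *)

Section trigonometric_polynomials.
Context {R : realType} {n : nat}.
Implicit Types (f g : 'rV[R]_n -> R).

Inductive trigpoly : ('rV[R]_n -> R) -> Prop :=
| trigpoly_cos (t : 'I_n -> R) (th : R) :
    trigpoly (fun x => cos (\sum_i t i * x ord0 i + th))
| trigpolyD f g : trigpoly f -> trigpoly g -> trigpoly (fun x => f x + g x)
| trigpolyZ c f : trigpoly f -> trigpoly (fun x => c * f x).

Lemma trigpoly_cst c : trigpoly (fun=> c).
Proof.
rewrite (_ : (fun=> c) =
    fun x : 'rV[R]_n => c * cos (\sum_i (fun=> 0) i * x ord0 i + 0)).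
  exact/trigpolyZ/trigpoly_cos.
by apply/funext => x; rewrite big1 ?addr0 ?cos0 ?mulr1// => i _; rewrite mul0r.
Qed.

(** A product of two cosines is half a sum of two cosines. *)
Lemma trigpolyM f g : trigpoly f -> trigpoly g -> trigpoly (fun x => f x * g x).
Proof.
move=> tf; elim: tf g => [t th|f1 f2 _ IH1 _ IH2|c f1 _ IH1] g tg; last 2 first.
- by under eq_fun do rewrite mulrDl; apply: trigpolyD; [exact: IH1|exact: IH2].
- by under eq_fun do rewrite -mulrA; apply/trigpolyZ/IH1.
elim: tg => [s ph|g1 g2 _ IH1 _ IH2|c g1 _ IH1]; last 2 first.
- by under eq_fun do rewrite mulrDr; exact: trigpolyD.
- by under eq_fun do rewrite mulrCA; exact: trigpolyZ.
under eq_fun => x.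
  rewrite cosM mulrC; rewrite mulrDr.
  have -> : \sum_i t i * x ord0 i + th + (\sum_i s i * x ord0 i + ph) =
      \sum_i (fun i => t i + s i) i * x ord0 i + (th + ph).
    by under [in RHS]eq_bigr do rewrite mulrDl; rewrite big_split/=; ring.
  have -> : \sum_i t i * x ord0 i + th - (\sum_i s i * x ord0 i + ph) =
      \sum_i (fun i => t i - s i) i * x ord0 i + (th - ph).
    by under [in RHS]eq_bigr do rewrite mulrBl; rewrite sumrB; ring.
  over.
by apply: trigpolyD; apply: trigpolyZ; exact: trigpoly_cos.
Qed.

Lemma trigpoly_sum (I : Type) (s : seq I) (h : I -> 'rV[R]_n -> R) :
  (forall i, trigpoly (h i)) -> trigpoly (fun x => \sum_(i <- s) h i x).
Proof.
move=> th; elim: s => [|i s IHs].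
  by under eq_fun do rewrite big_nil; exact: trigpoly_cst.
by under eq_fun do rewrite big_cons; exact: trigpolyD.
Qed.

Lemma trigpoly_prod (I : Type) (s : seq I) (h : I -> 'rV[R]_n -> R) :
  (forall i, trigpoly (h i)) -> trigpoly (fun x => \prod_(i <- s) h i x).
Proof.
move=> th; elim: s => [|i s IHs].
  by under eq_fun do rewrite big_nil; exact: trigpoly_cst.
by under eq_fun do rewrite big_cons; exact: trigpolyM.
Qed.

Lemma trigpoly_bern p m k : trigpoly p -> trigpoly (fun x => bern (p x) m k).
Proof.
move=> tp; elim: m k => [|m IHm] k /=; first exact: trigpoly_cst.
apply: trigpolyD.
  apply: trigpolyM => //; apply: trigpolyD; first exact: trigpoly_cst.
  by under eq_fun do rewrite -mulN1r; exact: trigpolyZ.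
by case: k => [|k]; [exact: trigpoly_cst|exact: trigpolyM].
Qed.

(** The sine, rescaled to take values in [0, 1]: the abscissa at which the
    Bernstein weights are evaluated. *)
Definition sin01 (A y : R) : R := (1 + sin (y / A)) / 2.

Lemma sin01_itv A y : 0 <= sin01 A y <= 1.
Proof.
rewrite /sin01; have := sin_le1 (y / A); have := sin_geN1 (y / A) => *.
by apply/andP; split; lra.
Qed.

Lemma trigpoly_sin01 A i : trigpoly (fun x => sin01 A (x ord0 i)).
Proof.
rewrite /sin01; under eq_fun do rewrite mulrC mulrDr.
apply: trigpolyD; first exact: trigpoly_cst; apply: trigpolyZ.
rewrite (_ : (fun _ => _) = fun x : 'rV[R]_n =>
  cos (\sum_j (fun j => (j == i)%:R / A) j * x ord0 j + - (pi / 2))).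
  exact: trigpoly_cos.
apply/funext => x; rewrite cosBpihalf (bigD1 i)//= eqxx big1 ?addr0.
  by congr sin; rewrite /= mul1r mulrC.
by move=> j /negbTE ->; rewrite mul0r mul0r.
Qed.

(** Bernstein's construction evaluates f at points whose image under sin01 is
    close to q.  Any nearest point of [-A, A] will do, and sin_expands bounds its
    distance to the points x of that interval in terms of q - sin01 A x. *)
Lemma sin01_inverse (A : R) : 0 < A -> exists node : R -> R, forall q,
  `|node q| <= A /\ forall x, `|x| <= A ->
    `|node q - x| <= 4 * A / cos 1 * `|q - sin01 A x|.
Proof.
move=> A0; have A00 : A != 0 by rewrite gt_eqF.
have c1 : 0 < cos 1 :> R := cos1_gt0 R.
have ex q : exists y, `|y| <= A /\ forall x, `|x| <= A ->
    `|q - sin01 A y| <= `|q - sin01 A x|.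
  have cf : continuous (fun y => `|q - sin01 A y|).
    move=> y; apply: cvg_norm; apply: cvgB; first exact: cvg_cst.
    apply: cvgMl; apply: cvgD; first exact: cvg_cst.
    apply: (@cvg_comp _ _ _ (fun y => y / A) (@sin R)); last exact: continuous_sin.
    by apply: cvgMl; exact: cvg_id.
  have NAA : - A <= A by lra.
  have [y /[!in_itv]/= yA ymin] := EVT_min NAA (continuous_subspaceT cf).
  exists y; split; first by rewrite ler_norml.
  by move=> x; rewrite ler_norml => xA; apply: ymin; rewrite in_itv.
have [node nodeP] := choice ex; exists node => q.
have [nA nmin] := nodeP q; split => // x xA.
have sub1 y : `|y| <= A -> `|y / A| <= 1.
  by move=> yA; rewrite normrM normfV (gtr0_norm A0) ler_pdivrMr// mul1r.
have := sin_expands (sub1 _ nA) (sub1 _ xA).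
have -> : sin (node q / A) - sin (x / A) =
    2 * ((sin01 A (node q) - q) + (q - sin01 A x)) by rewrite /sin01; field.
rewrite normrM (ger0_norm (_ : 0 <= 2))//.
have := ler_normD (sin01 A (node q) - q) (q - sin01 A x).
rewrite distrC -mulrBl normrM normfV (gtr0_norm A0).
have := nmin x xA.
set a := `|_ - sin01 A x|; set b := `|_ - sin01 A (node q)|.
set e := `|_ + _|; set u := `|node q - x| => ba eab cu.
have {}cu : cos 1 * (u / A) <= 4 * a by lra.
have -> : u = cos 1 * (u / A) * (A / cos 1) by field; rewrite A00 gt_eqF.
have -> : 4 * A / cos 1 * a = 4 * a * (A / cos 1) by ring.
by rewrite ler_wpM2r// divr_ge0// ltW.
Qed.

(** Heine's theorem on a box, with one point allowed outside the box. *)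
Lemma continuous_box_uniform f (A e : R) : continuous f -> 0 < e ->
  exists2 dl : R, 0 < dl & forall x y : 'rV[R]_n, (forall i, `|x ord0 i| <= A) ->
    (forall i, `|y ord0 i - x ord0 i| < dl) -> `|f x - f y| <= e.
Proof.
move=> cf e0.
pose K := [set x : 'rV[R]_n | forall i, `[- A, A]%classic (x ord0 i)].
have cK : compact K.
  by apply: (@rV_compact _ _ (fun=> `[- A, A]%classic)) => _; exact: segment_compact.
pose Q (dl : R) (x : 'rV[R]_n) := forall y : 'rV[R]_n,
  (forall i, `|y ord0 i - x ord0 i| < dl) -> `|f x - f y| <= e.
have [/(_ cK) cover _] := @compact_near_coveringP _ K.
have H := cover R (0:R)^'+ Q _ _.
have {H}: \forall dl \near (0:R)^'+, K `<=` Q dl.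
  apply: H => x Kx.
  have /cvgrPdist_lt /(_ (e / 2)) := cf x.
  rewrite divr_gt0// => /(_ isT) /nbhs_ballP[r /= r0 xr].
  exists (ball x (r / 2), [set dl | 0 < dl < r / 2]).
    split => /=; first by apply: nbhsx_ballx; rewrite divr_gt0.
    near=> dl; apply/andP; split; near: dl; first exact: nbhs_right_gt.
    by apply: nbhs_right_lt; rewrite divr_gt0.
  move=> [x' dl] /= [xx' /andP[dl0 dlr]] y yx'.
  have bx' : ball x r x' by apply: le_ball xx'; lra.
  have bxy : ball x r y.
    rewrite [r]splitr; apply: (ball_triangle xx'); split; first by rewrite divr_gt0.
    move=> i j; rewrite (ord1 i) /ball/= /ball_/= distrC.
    exact: lt_trans (yx' j) dlr.
  have h1 := xr _ bx'; have h2 := xr _ bxy.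
  rewrite /= in h1 h2.
  have -> : f x' - f y = (f x - f y) - (f x - f x') by ring.
  by rewrite (le_trans (ler_normB _ _))//; lra.
move=> H.
near (0:R)^'+ => dl; exists dl; first by near: dl; exact: nbhs_right_gt.
move=> x y xA xy.
have : Q dl x.
  have: K `<=` Q dl by near: dl; exact: H.
  by apply => i /=; rewrite in_itv/= -ler_norml.
exact.
Unshelve. all: by end_near. Qed.

(** Trigonometric polynomials approximate a bounded continuous function,
    uniformly on a box and without exceeding its bound anywhere: they are its
    Bernstein polynomials in the variables (1 + sin (x_i / A)) / 2.  The error
    off the box is absorbed in a multiple of the sum of the (x_i / A)^2. *)
Lemma trigpoly_approx f (K A e : R) : continuous f -> (forall x, `|f x| <= K) ->
  0 < A -> 0 < e -> exists g, [/\ trigpoly g, forall x, `|g x| <= K &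
    forall x, `|f x - g x| <= e + 2 * K * (A ^- 2 * \sum_i x ord0 i ^+ 2)].
Proof.
move=> cf fK A0 e0.
have e20 : 0 < e / 2 by rewrite divr_gt0.
have [dl dl0 fdl] := continuous_box_uniform A cf e20.
have [node nodeP] := sin01_inverse A0.
have c1 : 0 < cos 1 :> R := cos1_gt0 R.
pose eta : R := dl / (8 * A / cos 1).
have eta0 : 0 < eta by rewrite !divr_gt0// mulr_gt0.
have K0 : 0 <= K := le_trans (normr_ge0 _) (fK 0).
pose B := 2 * K * (n%:R / eta ^+ 2).
have B0 : 0 <= B by rewrite !mulr_ge0// invr_ge0 exprn_ge0// ltW.
pose m := Num.truncn (B / (e / 2)).
have mB : B * m.+1%:R^-1 <= e / 2.
  rewrite ler_pdivrMr// mulrC -ler_pdivrMr//.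
  have := truncn_itv (divr_ge0 B0 (ltW e20)).
  by move=> /andP[_ /ltW].
pose W (k : {ffun 'I_n -> 'I_m.+2}) (x : 'rV[R]_n) : R :=
  \prod_i bern (sin01 A (x ord0 i)) m.+1 (k i).
pose nd (k : {ffun 'I_n -> 'I_m.+2}) : 'rV[R]_n :=
  \row_i node ((k i)%:R / m.+1%:R).
have W0 k x : 0 <= W k x.
  by apply: prodr_ge0 => i _; apply: bern_ge0; exact: sin01_itv.
have W1 x : \sum_k W k x = 1.
  rewrite -(bigA_distr_bigA (fun i (j : 'I_m.+2) =>
    bern (sin01 A (x ord0 i)) m.+1 j)).
  by rewrite big1// => i _; exact: sum_bern.
have Wsqr (x : 'rV[R]_n) (i : 'I_n) : \sum_(k : {ffun 'I_n -> 'I_m.+2}) ((k i)%:R / m.+1%:R -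
  sin01 A (x ord0 i)) ^+ 2 * W k x
    <= m.+1%:R^-1.
  pose F i' (j : 'I_m.+2) : R :=
    (if i' == i then (j%:R / m.+1%:R - sin01 A (x ord0 i)) ^+ 2 else 1) *
    bern (sin01 A (x ord0 i')) m.+1 j.
  have -> : \sum_(k : {ffun 'I_n -> 'I_m.+2}) ((k i)%:R / m.+1%:R -
      sin01 A (x ord0 i)) ^+ 2 * W k x =
      \sum_(k : {ffun 'I_n -> 'I_m.+2}) \prod_i' F i' (k i').
    apply: eq_bigr => k _; rewrite /F big_split/= -/(W k x); congr (_ * _).
    rewrite (bigD1 i)//= eqxx big1 ?mulr1//.
    by move=> j /negbTE ->.
  rewrite -(bigA_distr_bigA F) (bigD1 i)//= [X in _ * X]big1 ?mulr1; last first.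
    move=> j /negbTE ji; rewrite -[RHS](sum_bern (sin01 A (x ord0 j)) m.+1).
    by apply: eq_bigr => k _; rewrite /F ji mul1r.
  have := @bern_variance _ (sin01 A (x ord0 i)) m (sin01_itv _ _).
  by apply: le_trans; apply: ler_sum => k _; rewrite /F eqxx.
(* W k x is the product of the binomial weights at the coordinates of x: a
   probability in k, concentrated where nd k is close to x. *)
exists (fun x => \sum_k f (nd k) * W k x).
have gK x : `|\sum_k f (nd k) * W k x| <= K.
  rewrite -[K]mulr1 -(W1 x) mulr_sumr (le_trans (ler_norm_sum _ _ _))//.
  apply: ler_sum => k _; rewrite normrM (ger0_norm (W0 _ _)).
  exact: ler_wpM2r.
split => //.
  apply: trigpoly_sum => k; apply: trigpolyZ; apply: trigpoly_prod => i.
  exact/trigpoly_bern/trigpoly_sin01.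
move=> x; have S0 : 0 <= A ^- 2 * \sum_i x ord0 i ^+ 2.
  by rewrite mulr_ge0 ?invr_ge0 ?exprn_ge0 ?(ltW A0)// sumr_ge0// => i _; exact: sqr_ge0.
have [|/existsNP[i /negP]] := pselect (forall i, `|x ord0 i| <= A); last first.
  rewrite -ltNge => xA.
  rewrite (@le_trans _ _ (2 * K))//.
    by rewrite (le_trans (ler_normB _ _))//; have := fK x; have := gK x; lra.
  rewrite -[leLHS]add0r lerD ?(ltW e0)// ler_peMr ?mulr_ge0//.
  rewrite mulrC ler_pdivlMr ?exprn_gt0// mul1r.
  rewrite (bigD1 i)//= -[leLHS]addr0 lerD//; last first.
    by rewrite sumr_ge0// => j _; exact: sqr_ge0.
  by rewrite -(real_normK (num_real (x _ _))) lerXn2r ?nnegrE ?(ltW A0) ?(ltW xA).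
move=> xA.
rewrite (@le_trans _ _ e)//; last by rewrite lerDl mulr_ge0// mulr_ge0.
have -> : f x - \sum_k f (nd k) * W k x = \sum_k (f x - f (nd k)) * W k x.
  under [RHS]eq_bigr do rewrite mulrBl.
  by rewrite sumrB -mulr_sumr W1 mulr1.
rewrite (le_trans (ler_norm_sum _ _ _))//.
(* Either the node nd k is within dl of x, or Chebyshev's inequality applies to
   one of the coordinates. *)
have hk k : `|(f x - f (nd k)) * W k x| <= e / 2 * W k x + 2 * K / eta ^+ 2 *
    \sum_i ((k i)%:R / m.+1%:R - sin01 A (x ord0 i)) ^+ 2 * W k x.
  rewrite normrM (ger0_norm (W0 _ _)) -mulr_suml mulrA -mulrDl ler_wpM2r//.
  have [near_k|/existsNP[i /negP]] := pselect (forall i,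
      `|(k i)%:R / m.+1%:R - sin01 A (x ord0 i)| <= eta).
    rewrite (@le_trans _ _ (e / 2))//; last first.
      rewrite lerDl; apply: mulr_ge0; last by apply: sumr_ge0 => i _; exact: sqr_ge0.
      apply: divr_ge0; first by rewrite mulr_ge0.
      by apply: exprn_ge0; exact: (ltW eta0).
    apply: fdl => // i; rewrite mxE.
    have [_ /(_ _ (xA i))] := nodeP ((k i)%:R / m.+1%:R).
    move=> /le_lt_trans; apply.
    have D0 : 0 < 4 * A / cos 1 by rewrite divr_gt0// mulr_gt0.
    rewrite (le_lt_trans (ler_wpM2l (ltW D0) (near_k i)))//.
    have -> : 4 * A / cos 1 * eta = dl / 2.
      by rewrite /eta; field; rewrite !gt_eqF.
    lra.
  rewrite -ltNge => far_k.
  rewrite (@le_trans _ _ (2 * K))//.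
    by rewrite (le_trans (ler_normB _ _))//; have := fK x; have := fK (nd k); lra.
  rewrite -[leLHS]add0r lerD ?(ltW e20)// -mulrA ler_peMr ?mulr_ge0//.
  rewrite mulrC ler_pdivlMr ?exprn_gt0// mul1r.
  rewrite (bigD1 i)//= -[leLHS]addr0 lerD//; last first.
    by rewrite sumr_ge0// => j _; exact: sqr_ge0.
  by rewrite -[leRHS](real_normK (num_real _)) lerXn2r ?nnegrE ?(ltW eta0) ?(ltW far_k).
apply: (le_trans (ler_sum _ (fun k _ => hk k))).
rewrite big_split/= -mulr_sumr W1 mulr1 -mulr_sumr exchange_big/=.
have -> : e = e / 2 + e / 2 by lra.
rewrite lerD//; first lra.
apply: le_trans mB.
have -> : B * m.+1%:R^-1 = 2 * K / eta ^+ 2 * (\sum_(i < n) m.+1%:R^-1).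
  by rewrite sumr_const card_ord -[_ *+ n]mulr_natl /B; ring.
rewrite ler_wpM2l//.
  apply: divr_ge0; first by rewrite mulr_ge0.
  by apply: exprn_ge0; exact: (ltW eta0).
by apply: ler_sum => i _; exact: Wsqr.
Qed.

End trigonometric_polynomials.

(** * Levy's continuity theorem *)

Section random_vector.
Context {R : realType} {n : nat} d (T : measurableType d) (P : probability T R).
Variable (Z : 'I_n -> T -> R).
Hypothesis mZ : forall i, measurable_fun setT (Z i).

Lemma trigpoly_bounded_measurable g : trigpoly g ->
  bounded_measurable (fun w => g (\row_i Z i w)).
Proof.
elim=> [t th|f1 f2 _ ? _ ?|c f1 _ ?]; last 2 first.
- exact: bounded_measurableD.
- exact: bounded_measurableZ.
apply: bounded_measurable_cos; apply: measurable_funD => //.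
apply: measurable_sum => i; apply: measurable_funM => //.
under eq_fun do rewrite mxE; exact: mZ.
Qed.

(** A continuous function is a pointwise limit of trigonometric polynomials, so
    its composition with a random vector is measurable. *)
Lemma continuous_bounded_measurable_row (f : 'rV[R]_n -> R) K :
  continuous f -> (forall x, `|f x| <= K) ->
  bounded_measurable (fun w => f (\row_i Z i w)).
Proof.
move=> cf fK; split; last by exists K.
have h (m : nat) := trigpoly_approx cf fK (ltr0Sn R m) (divr_gt0 ltr01 (ltr0Sn R m)).
have [g gP] := choice h.
apply: (@measurable_fun_cvg _ _ _ _ (fun m w => g m (\row_i Z i w))).
  by move=> m; have [tg _ _] := gP m; have [] := trigpoly_bounded_measurable tg.
move=> w _; set x := \row_i _.
have K0 : 0 <= K := le_trans (normr_ge0 _) (fK 0).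
have S0 : 0 <= \sum_i x ord0 i ^+ 2 by apply: sumr_ge0 => i _; exact: sqr_ge0.
apply/cvgrPdist_le => e e0 /=.
have : (1 + 2 * K * \sum_i x ord0 i ^+ 2) * m.+1%:R^-1 @[m --> \oo] --> (0 : R).
  set c := 1 + _; rewrite -[X in _ --> X](mulr0 c); apply: cvgMr.
  exact: cvg_harmonic.
move/cvgrPdist_le => /(_ e e0); apply: filterS => m.
rewrite sub0r normrN; apply: le_trans.
have [_ _ /(_ x) /le_trans] := gP m; apply.
have m0 : 0 < m.+1%:R^-1 :> R by rewrite invr_gt0.
have m1 : m.+1%:R^-1 <= 1 :> R by rewrite invf_le1// ler1n.
rewrite ger0_norm; last by rewrite mulr_ge0 ?(ltW m0)// addr_ge0// !mulr_ge0.
rewrite [leRHS]mulrDl lerD//.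
rewrite -!mulrA ler_wpM2l// ler_wpM2l// mulrC ler_wpM2l//.
by rewrite expr2 invfM ler_piMr// ltW.
Qed.

(** The error of trigpoly_approx off the box is a multiple of the second
    moments, which the quadratic bound on the characteristic functions controls. *)
Lemma mean_approx (C A K e : R) (f g : 'rV[R]_n -> R) :
  (forall i h, 1 - \int[P]_w cos (h * Z i w) <= C * h ^+ 2) ->
  0 <= K -> 0 < A -> 0 <= e ->
  bounded_measurable (fun w => f (\row_i Z i w)) ->
  bounded_measurable (fun w => g (\row_i Z i w)) ->
  (forall x, `|f x - g x| <= e + 2 * K * (A ^- 2 * \sum_i x ord0 i ^+ 2)) ->
  `|\int[P]_w f (\row_i Z i w) - \int[P]_w g (\row_i Z i w)| <=
    e + 2 * K * (A ^- 2 * (n%:R * (2 * C))).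
Proof.
move=> hC K0 A0 e0 bf bg fg.
have sq i : (\int[P]_w (Z i w ^+ 2)%:E <= (2 * C)%:E)%E.
  by apply: second_moment_le => // h; exact: hC.
have isq i : P.-integrable setT (EFin \o (fun w => Z i w ^+ 2)).
  apply/integrableP; split; first exact/measurable_EFinP/measurable_funX.
  rewrite (le_lt_trans _ (ltry (2 * C)))// (le_trans _ (sq i))//.
  by under eq_integral do rewrite /= ger0_norm ?sqr_ge0//.
have isum : P.-integrable setT (EFin \o (fun w => \sum_i Z i w ^+ 2)).
  rewrite (_ : _ \o _ = fun w => (\sum_i (Z i w ^+ 2)%:E)%E); last first.
    by apply/funext => w /=; rewrite sumEFin.
  by apply: (@integrable_sum _ _ _ P setT measurableT _ _ xpredT
    (fun i w => (Z i w ^+ 2)%:E)) => // i _; exact: isq.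
have iscaled : P.-integrable setT (EFin \o
    (fun w => 2 * K * (A ^- 2 * \sum_i Z i w ^+ 2))).
  rewrite (_ : _ \o _ = fun w =>
      ((2 * K * A ^- 2)%:E * (EFin \o (fun w => \sum_i Z i w ^+ 2)%R) w)%E).
    exact: integrableZl.
  by apply/funext => w /=; rewrite mulrA EFinM.
have ibnd : P.-integrable setT (EFin \o
    (fun w => e + 2 * K * (A ^- 2 * \sum_i Z i w ^+ 2))).
  apply: (@integrableD _ _ _ P setT measurableT (fun=> e%:E)
     (EFin \o fun w => 2 * K * (A ^- 2 * \sum_i Z i w ^+ 2))).
    exact: finite_measure_integrable_cst.
  exact: iscaled.
rewrite -RintegralB//; try exact: bounded_measurable_integrable.
rewrite (le_trans (norm_Rintegral_le _ ibnd _))//.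
- by have [] := bounded_measurableB bf bg.
- move=> w; rewrite (le_trans (fg _))// lerD2l ler_wpM2l ?mulr_ge0//.
  rewrite ler_wpM2l ?invr_ge0 ?exprn_ge0 ?(ltW A0)//.
  by under eq_bigr do rewrite mxE.
rewrite RintegralD//; last exact: finite_measure_integrable_cst.
rewrite Rintegral_probability_cst lerD2l.
under eq_Rintegral do rewrite mulrA.
rewrite RintegralZl// -mulrA ler_wpM2l ?mulr_ge0//.
rewrite ler_wpM2l ?invr_ge0 ?exprn_ge0 ?(ltW A0)//.
rewrite -lee_fin -EFin_Rintegral//.
under eq_integral do rewrite -sumEFin.
rewrite integral_sum//.
rewrite (le_trans (lee_sum _ (fun i _ => sq i)))//.
by rewrite sumEFin lee_fin sumr_const card_ord -[_ *+ n]mulr_natl.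
Qed.

End random_vector.

(** Levy's continuity theorem for random vectors whose characteristic functions
    are uniformly quadratic at 0: this gives uniformly bounded second moments,
    so that trigonometric polynomials can replace the test function. *)
Theorem cvg_mean_of_cos (R : realType) (n : nat)
    d (T : measurableType d) (P : probability T R)
    d' (T' : measurableType d') (Q : probability T' R)
    (Z : nat -> 'I_n -> T -> R) (Y : 'I_n -> T' -> R) (C : R) :
  (forall N i, measurable_fun setT (Z N i)) ->
  (forall i, measurable_fun setT (Y i)) ->
  (forall (t : 'I_n -> R) th,
    \int[P]_w cos (\sum_i t i * Z N i w + th) @[N --> \oo] -->
    \int[Q]_w cos (\sum_i t i * Y i w + th)) ->
  (forall N i h, 1 - \int[P]_w cos (h * Z N i w) <= C * h ^+ 2) ->
  forall (f : 'rV[R]_n -> R) K, continuous f -> (forall x, `|f x| <= K) ->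
  \int[P]_w f (\row_i Z N i w) @[N --> \oo] --> \int[Q]_w f (\row_i Y i w).
Proof.
move=> mZ mY ZY ZC f K cf fK.
(* The limit inherits the quadratic bound, so mean_approx applies to it too. *)
have YC i h : 1 - \int[Q]_w cos (h * Y i w) <= C * h ^+ 2.
  pose t (j : 'I_n) : R := if j == i then h else 0.
  have tE (S : Type) (V : 'I_n -> S -> R) w : \sum_j t j * V j w + 0 = h * V i w.
    rewrite addr0 (bigD1 i)//= /t eqxx big1 ?addr0// => j /negbTE ->.
    by rewrite mul0r.
  have cv : \int[P]_w cos (h * Z N i w) @[N --> \oo] --> \int[Q]_w cos (h * Y i w).
    have := ZY t 0; under eq_Rintegral do rewrite tE.
    by under eq_cvg do under eq_Rintegral do rewrite tE.
  apply: (ler_cvg_to (cvgB (cvg_cst (1 : R)) cv) (cvg_cst (C * h ^+ 2))).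
  by apply: nearW => N; exact: ZC.
have rowE (S : Type) (V : 'I_n -> S -> R) (t : 'I_n -> R) w :
    \sum_i t i * V i w = \sum_i t i * (\row_j V j w) ord0 i.
  by apply: eq_bigr => i _; rewrite mxE.
have Zg g : trigpoly g ->
    \int[P]_w g (\row_i Z N i w) @[N --> \oo] --> \int[Q]_w g (\row_i Y i w).
  elim=> [t th|f1 f2 t1 IH1 t2 IH2|c f1 t1 IH1].
  - have := ZY t th.
    under eq_Rintegral do rewrite (rowE _ Y).
    by under eq_cvg do under eq_Rintegral do rewrite (rowE _ (Z _)).
  - rewrite RintegralD//; last 2 first.
      exact/bounded_measurable_integrable/trigpoly_bounded_measurable.
      exact/bounded_measurable_integrable/trigpoly_bounded_measurable.
    under eq_cvg => N.
      rewrite RintegralD//; last 2 first.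
        exact/bounded_measurable_integrable/trigpoly_bounded_measurable.
        exact/bounded_measurable_integrable/trigpoly_bounded_measurable.
      over.
    exact: cvgD.
  - rewrite RintegralZl//; last first.
      exact/bounded_measurable_integrable/trigpoly_bounded_measurable.
    under eq_cvg => N.
      rewrite RintegralZl//; last first.
        exact/bounded_measurable_integrable/trigpoly_bounded_measurable.
      over.
    exact: cvgMr.
have K0 : 0 <= K := le_trans (normr_ge0 _) (fK 0).
apply/cvgrPdist_le => e e0.
pose M := 2 * K * (n%:R * (2 * `|C|)).
have M0 : 0 <= M by rewrite !mulr_ge0.
(* A makes the contribution of the complement of the box at most e / 8. *)
pose A := 1 + 8 * M / e.
have A1 : 1 <= A by rewrite lerDl divr_ge0 ?(ltW e0)// mulr_ge0.
have A0 : 0 < A := lt_le_trans ltr01 A1.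
have MA : 2 * K * (A ^- 2 * (n%:R * (2 * C))) <= e / 8.
  rewrite (@le_trans _ _ (M / A))//.
    have -> : M / A = 2 * K * (A^-1 * (n%:R * (2 * `|C|))) by rewrite /M; ring.
    rewrite ler_wpM2l ?mulr_ge0//.
    rewrite (@le_trans _ _ (A ^- 2 * (n%:R * (2 * `|C|))))//.
      rewrite ler_wpM2l ?invr_ge0 ?sqr_ge0//.
      by rewrite ler_wpM2l// ler_wpM2l// ler_norm.
    rewrite ler_wpM2r ?mulr_ge0//.
    by rewrite expr2 invfM ler_piMr ?invr_ge0 ?(ltW A0)// invf_le1.
  rewrite ler_pdivrMr// /A mulrDr.
  have -> : e / 8 * (8 * M / e) = M by field; rewrite gt_eqF.
  by rewrite mulr1 lerDr divr_ge0 ?(ltW e0).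
have e8 : 0 < e / 8 by rewrite divr_gt0.
have [g [tg gK fg]] := trigpoly_approx cf fK A0 e8.
have e2 : 0 < e / 2 by rewrite divr_gt0.
have := Zg g tg => /cvgrPdist_le /(_ _ e2).
apply: filterS => N /=.
have h1 := mean_approx (mZ N) (ZC N) K0 A0 (ltW e8)
  (continuous_bounded_measurable_row (mZ N) cf fK)
  (trigpoly_bounded_measurable (mZ N) tg) fg.
have h2 := mean_approx mY YC K0 A0 (ltW e8)
  (continuous_bounded_measurable_row mY cf fK)
  (trigpoly_bounded_measurable mY tg) fg.
move: h1 h2; set a := \int[P]_w f _; set b := \int[P]_w g _.
set a' := \int[Q]_w f _; set b' := \int[Q]_w g _ => h1 h2 h3.
have -> : a' - a = (a' - b') + (b' - b) - (a - b) by ring.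
rewrite (le_trans (ler_normB _ _))//.
have := ler_normD (a' - b') (b' - b); lra.
Qed.

(** * Uniqueness of laws with a given characteristic function *)

Section ramps.
Context {R : realType}.

(** The continuous function that is 0 before 0, 1 after 1 and affine between. *)
Definition ramp (u : R) : R := (`|u| - `|u - 1| + 1) / 2.

Lemma ramp_continuous : continuous ramp.
Proof.
move=> u; apply: cvgMl; apply: cvgD; last exact: cvg_cst.
apply: cvgB; first by apply: cvg_norm; exact: cvg_id.
by apply: cvg_norm; apply: cvgB; [exact: cvg_id|exact: cvg_cst].
Qed.

Lemma ramp_le0 u : u <= 0 -> ramp u = 0.
Proof. by move=> u0; rewrite /ramp ler0_norm// ler0_norm; [field|lra]. Qed.

Lemma ramp_ge1 u : 1 <= u -> ramp u = 1.
Proof. by move=> u1; rewrite /ramp !ger0_norm; [field|lra|lra]. Qed.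

Lemma ramp_itv u : 0 <= ramp u <= 1.
Proof.
have [u0|u0] := leP u 0; first by rewrite ramp_le0// lexx ler01.
have [u1|u1] := leP 1 u; first by rewrite ramp_ge1// lexx ler01.
rewrite /ramp (gtr0_norm u0) ler0_norm; last lra.
by apply/andP; split; lra.
Qed.

Lemma ramp_cvg (u : R) : ramp (k%:R * u) @[k --> \oo] --> ((0 < u)%R%:R : R).
Proof.
have [u0|u0] := leP u 0.
  under eq_cvg do rewrite ramp_le0 ?mulr_ge0_le0//.
  exact: cvg_cst.
apply: cvg_near_cst; near=> k.
rewrite ramp_ge1// -ler_pdivrMr// div1r.
near: k; exact: nbhs_infty_ger.
Unshelve. all: by end_near. Qed.

Lemma ramp_prod_cvg n (u : 'I_n -> R) :
  \prod_i ramp (k%:R * u i) @[k --> \oo] --> (([forall i, 0 < u i]%R)%:R : R).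
Proof.
have -> : ([forall i, 0 < u i]%R)%:R = \prod_i (0 < u i)%R%:R :> R.
  case: (boolP [forall i, 0 < u i]) => [/forallP u0|].
    by rewrite big1// => i _; rewrite u0.
  rewrite negb_forall => /existsP[i /negbTE u0].
  by rewrite (bigD1 i)//= u0 mul0r.
apply: (@cvg_big R 'I_n *%R 1 xpredT (@mul_continuous R) nat \oo (index_enum _)
  (fun i k => ramp (k%:R * u i)) (fun i => (0 < u i)%R%:R : R) _ _).
by move=> i _; exact: ramp_cvg.
Qed.

End ramps.

Section law_unique.
Context {R : realType} {n : nat}.

(** Lower orthants are stable under intersection and generate the product
    sigma-algebra. *)
Lemma tuple_measure_unique (m1 m2 : {measure set (n.-tuple R) -> \bar R}) :
  (m1 setT < +oo)%E ->
  (forall a : 'I_n -> R, m1 [set x | forall i, tnth x i < a i] =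
                         m2 [set x | forall i, tnth x i < a i]) ->
  forall B, measurable B -> m1 B = m2 B.
Proof.
move=> m1oo m12.
pose G : set (set (n.-tuple R)) :=
  [set E | exists a : 'I_n -> R, E = [set x | forall i, tnth x i < a i]].
pose g (k : nat) : set (n.-tuple R) := [set x | forall i, tnth x i < k%:R].
have mG : G `<=` measurable.
  move=> _ [a ->]; rewrite (_ : mkset _ =
      \bigcap_(i in [set: 'I_n]) [set x | tnth x i < a i]); last first.
    by apply/seteqP; split => x /= h i => [_|]; apply: h.
  apply: fin_bigcap_measurable => // i _.
  rewrite -[X in measurable X]setTI (_ : mkset _ = (@tnth n R ^~ i) @^-1` `]-oo, a i[).
    exact: measurable_tnth.
  by apply/seteqP; split => x /=; rewrite in_itv.
have gcover : \bigcup_k g k = setT.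
  apply/seteqP; split => // x _.
  pose M := \sum_i `|tnth x i|.
  exists (Num.truncn M).+1 => // i /=.
  rewrite (le_lt_trans (ler_norm _))//.
  rewrite (@le_lt_trans _ _ M)//.
    by rewrite /M (bigD1 i)//= lerDl sumr_ge0.
  by have /andP[] := truncn_itv (sumr_ge0 _ (fun i _ => normr_ge0 (tnth x i)) : 0 <= M).
have GE : @measurable _ (n.-tuple R) = <<s G >>.
  apply/seteqP; split; last first.
    by apply: smallest_sub => //; exact: sigma_algebra_measurable.
  apply: smallest_sub; first exact: smallest_sigma_algebra.
  move=> E; rewrite -bigcup_seq => -[i _ [B mB <-]].
  have mti : @measurable_fun _ _ (g_sigma_algebraType G) R setT (@tnth n R ^~ i).
    apply: (measurability (@RGenInftyO.G R)); first exact: RGenInftyO.measurableE.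
    move=> _ [_ [a ->] <-].
    rewrite (_ : _ `&` _ = \bigcup_k
       [set x | forall j, tnth x j < (if j == i then a else k%:R)]).
      apply: bigcupT_measurable => k; apply: sub_sigma_algebra.
      by exists (fun j => if j == i then a else k%:R).
    apply/seteqP; split => x /=.
      rewrite in_itv/= => -[_ xa].
      have : [set: n.-tuple R] x by [].
      rewrite -gcover => -[k _ /= xk]; exists k => // j /=.
      by case: eqP => [->|_]; [exact: xa|exact: xk].
    move=> [k _ /(_ i)]; rewrite eqxx => xa; by split.
  exact: mti.
move=> B mB.
apply: (measure_unique G g GE) => //.
- move=> _ _ [a ->] [b ->]; exists (fun i => Num.min (a i) (b i)).
  apply/seteqP; split => x /=.
    by move=> [xa xb] i; rewrite lt_min xa xb.
  by move=> h; split => i; have := h i; rewrite lt_min => /andP[].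
- by move=> k; exists (fun=> k%:R).
- by move=> _ [a ->].
- move=> k; rewrite (le_lt_trans _ m1oo)//; apply: le_measure; rewrite ?inE//.
  by apply: mG; exists (fun=> k%:R).
Qed.

End law_unique.

Lemma measurable_mktuple d (T : measurableType d) (R : realType) n
    (Z : 'I_n -> T -> R) : (forall i, measurable_fun setT (Z i)) ->
  measurable_fun setT (fun w => [tuple Z i w | i < n]).
Proof.
move=> mZ; apply/measurable_fun_tnthP => i.
by rewrite (_ : _ \o _ = Z i)//; apply/funext => w /=; rewrite tnth_mktuple.
Qed.

(** The continuity theorem for constant sequences identifies the means of
    bounded continuous functions; products of ramps approximate the indicators
    of orthants. *)
Theorem tuple_law_unique (R : realType) (n : nat)
    d (T : measurableType d) (P : probability T R)
    d' (T' : measurableType d') (Q : probability T' R)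
    (Z : 'I_n -> T -> R) (Y : 'I_n -> T' -> R) (C : R) :
  (forall i, measurable_fun setT (Z i)) ->
  (forall i, measurable_fun setT (Y i)) ->
  (forall (t : 'I_n -> R) th, \int[P]_w cos (\sum_i t i * Z i w + th) =
    \int[Q]_w cos (\sum_i t i * Y i w + th)) ->
  (forall i h, 1 - \int[P]_w cos (h * Z i w) <= C * h ^+ 2) ->
  forall B : set (n.-tuple R), measurable B ->
  P [set w | B [tuple Z i w | i < n]] = Q [set w | B [tuple Y i w | i < n]].
Proof.
move=> mZ mY ZY ZC.
have mtZ := measurable_mktuple mZ; have mtY := measurable_mktuple mY.
pose m1 := pushforward P (fun w => [tuple Z i w | i < n]).
pose m2 := pushforward Q (fun w => [tuple Y i w | i < n]).
apply: (@tuple_measure_unique R n m1 m2).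
  by have : (P setT < +oo)%E by rewrite probability_setT ltry.
move=> a; rewrite /m1 /m2 /pushforward.
pose f (k : nat) (x : 'rV[R]_n) := \prod_i ramp (k%:R * (a i - x ord0 i)).
have fK k x : `|f k x| <= 1.
  rewrite /f normr_prod; apply: prodr_ile1 => i _.
  by rewrite normr_ge0/=; have /andP[r0 r1] := ramp_itv (k%:R * (a i - x ord0 i));
    rewrite ger0_norm.
have fc k : continuous (f k).
  apply: continuous_big; first exact: mul_continuous.
  move=> i _ x.
  have h : k%:R * (a i - y ord0 i) @[y --> x] --> k%:R * (a i - x ord0 i).
    apply: cvgM; first exact: cvg_cst.
    by apply: cvgB; [exact: cvg_cst|exact: coord_continuous].
  apply: (@cvg_comp _ _ _ (fun y : 'rV[R]_n => k%:R * (a i - y ord0 i)) ramp _ _ _ h).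
  exact: ramp_continuous.
have fE k : \int[P]_w f k (\row_i Z i w) = \int[Q]_w f k (\row_i Y i w).
  have := @cvg_mean_of_cos R n _ _ P _ _ Q (fun=> Z) Y C (fun=> mZ) mY.
  move=> /(_ (fun t th => _)) /(_ (fun=> ZC) (f k) 1 (fc k) (fK k)).
  have h t th : \int[P]_w cos (\sum_i t i * Z i w + th) @[N --> \oo] -->
      \int[Q]_w cos (\sum_i t i * Y i w + th) by rewrite ZY; exact: cvg_cst.
  move=> /(_ h) /cvg_lim <-//; rewrite lim_cst//.
have lim1 d1 (T1 : measurableType d1) (P1 : probability T1 R) (Z1 : 'I_n -> T1 -> R) :
    (forall i, measurable_fun setT (Z1 i)) ->
    (\int[P1]_w f k (\row_i Z1 i w))%:E @[k --> \oo] -->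
    P1 ((fun w => [tuple Z1 i w | i < n]) @^-1` [set x | forall i, tnth x i < a i]).
  move=> mZ1; set E := _ @^-1` _.
  have mE : measurable E.
    rewrite /E (_ : _ @^-1` _ = \bigcap_(i in [set: 'I_n]) (Z1 i @^-1` `]-oo, a i[)).
      by apply: fin_bigcap_measurable => // i _; rewrite -[X in measurable X]setTI; exact: mZ1.
    apply/seteqP; split => w /= h i.
      by move=> _; have := h i; rewrite tnth_mktuple/= in_itv.
    by have := h i Logic.I; rewrite tnth_mktuple/= in_itv.
  rewrite -(setIT E) -integral_indic//.
  rewrite EFin_Rintegral; last exact: integrable_indic.
  apply: cvg_EFin; first exact: nearW.
  apply: (@Rdominated_cvg _ _ _ P1 (fun k w => f k (\row_i Z1 i w)) _ (fun=> 1)).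
  - by move=> k; have [] := continuous_bounded_measurable_row mZ1 (fc k) (fK k).
  - move=> w; rewrite (_ : \1_E w = ([forall i, 0 < a i - Z1 i w]%R)%:R).
      rewrite (_ : (fun k => _) = fun k => \prod_i ramp (k%:R * (a i - Z1 i w))).
        exact: ramp_prod_cvg.
      by apply/funext => k; apply: eq_bigr => i _; rewrite mxE.
    rewrite indicE; congr (nat_of_bool _)%:R.
    apply/idP/forallP => [/[!inE] h i|h].
      by rewrite subr_gt0; have := h i; rewrite tnth_mktuple.
    by rewrite inE => i /=; rewrite tnth_mktuple -subr_gt0.
  - exact: finite_measure_integrable_cst.
  - by move=> k w; exact: fK.
have hP := lim1 _ _ P Z mZ; have hQ := lim1 _ _ Q Y mY.
rewrite (_ : (fun k => _) = fun k => (\int[Q]_w f k (\row_i Y i w))%:E) in hP.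
  exact: (cvg_unique (@ereal_hausdorff R) hP hQ).
by apply/funext => k; rewrite fE.
Qed.

(** * Expansion of characteristic functions at 0 *)

Section small_argument.
Context {R : realType}.

Lemma expRN_taylor (y : R) : 0 <= y -> `|expR (- y) - 1 + y| <= y ^+ 2.
Proof.
move=> y0; have h1 := expR_ge1Dx (- y).
have h2 : expR (- y) <= (1 + y)^-1.
  rewrite expRN lef_pV2 ?posrE ?expR_gt0 ?expR_ge1Dx//; lra.
have h3 : (1 + y)^-1 <= 1 - y + y ^+ 2.
  rewrite -div1r ler_pdivrMr; last lra.
  have -> : (1 - y + y ^+ 2) * (1 + y) = 1 + y ^+ 3 by ring.
  by rewrite lerDl exprn_ge0.
rewrite ger0_norm; lra.
Qed.

(** Sums of independent angles, real part and imaginary part: the error in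
    replacing one factor (c, s) by the real number r is made N times. *)
Lemma trig_product_approx (C D : nat -> R) (c s r : R) N :
  (forall k, `|D k| <= 1) -> (forall k, `|C k| <= 1) -> 0 <= r <= 1 ->
  (forall k, C k.+1 = C k * c - D k * s) ->
  `|C N - r ^+ N * C 0%N| <= N%:R * (`|c - r| + `|s|).
Proof.
move=> D1 C1 /andP[r0 r1] CS; elim: N => [|N IHN].
  by rewrite expr0 mul1r subrr normr0 mul0r.
have -> : C N.+1 - r ^+ N.+1 * C 0%N =
    C N * (c - r) + (- D N) * s + r * (C N - r ^+ N * C 0%N).
  by rewrite CS exprS; ring.
rewrite (le_trans (ler_normD _ _))// -natr1 mulrDl mul1r addrC lerD//.
  by rewrite normrM ger0_norm// (le_trans _ IHN)// ler_piMl.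
rewrite (le_trans (ler_normD _ _))// lerD// normrM ler_piMl// normrN//.
Qed.

Lemma expr_sub_le (a b : R) N : `|a| <= 1 -> 0 <= b <= 1 ->
  `|a ^+ N - b ^+ N| <= N%:R * `|a - b|.
Proof.
move=> a1 b01.
have := @trig_product_approx (fun k => a ^+ k) (fun=> 0) a 0 b N.
rewrite !expr0 !mulr1 !normr0 !addr0; apply => //.
- by move=> k; rewrite normrX exprn_ile1.
- by move=> k; rewrite mul0r subr0 exprSr.
Qed.

End small_argument.

Section characteristic_expansion.
Context d (T : measurableType d) (R : realType) (P : probability T R).
Variables (V : T -> R) (s2 : R) (h : nat -> R).
Hypothesis mV : measurable_fun setT V.
Hypothesis iV : P.-integrable setT (EFin \o V).
Hypothesis iV2 : P.-integrable setT (EFin \o (fun w => V w ^+ 2)).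
Hypothesis EV : \int[P]_w V w = 0.
Hypothesis EV2 : \int[P]_w V w ^+ 2 = s2.
Hypothesis h0 : forall k, h k != 0.
Hypothesis hcvg : h k @[k --> \oo] --> (0 : R).

Let habs0 (a : R) : `|h k| * a @[k --> \oo] --> (0 : R).
Proof.
rewrite -[X in _ --> X](mul0r a); apply: cvgMl.
by rewrite -[X in _ --> X](normr0 R); apply: cvg_norm.
Qed.

Let s20 : 0 <= s2.
Proof. by rewrite -EV2 Rintegral_ge0// => w _; exact: sqr_ge0. Qed.

Let mhV k : measurable_fun setT (fun w => h k * V w).
Proof. exact: measurable_funM. Qed.

(** The quotients are dominated by V^2. *)
Lemma cvg_cos_mean :
  (1 - \int[P]_w cos (h k * V w)) / h k ^+ 2 @[k --> \oo] --> s2 / 2.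
Proof.
have bc k := bounded_measurable_cos (mhV k).
have -> : s2 / 2 = \int[P]_w (V w ^+ 2 * 2^-1) by rewrite RintegralZr// EV2.
rewrite (_ : (fun k => _) =
    fun k => \int[P]_w ((1 - cos (h k * V w)) * (h k ^+ 2)^-1)); last first.
  apply/funext => k; rewrite RintegralZr//; last first.
    apply: bounded_measurable_integrable; apply: bounded_measurableB => //.
    exact: bounded_measurable_cst.
  rewrite RintegralB// ?Rintegral_probability_cst//.
    exact: finite_measure_integrable_cst.
  exact: bounded_measurable_integrable.
apply: (@Rdominated_cvg _ _ _ P
  (fun k w => (1 - cos (h k * V w)) * (h k ^+ 2)^-1) _ (fun w => V w ^+ 2)) => //.
- move=> k; apply: measurable_funM => //; apply: measurable_funB => //.
  exact: measurable_cos.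
- move=> w; apply/cvgrPdist_le => e e0.
  have := habs0 (`|V w| ^+ 3) => /cvgrPdist_le /(_ _ e0); apply: filterS => k.
  rewrite sub0r normrN; apply: le_trans.
  have -> : V w ^+ 2 * 2^-1 - (1 - cos (h k * V w)) * (h k ^+ 2)^-1 =
      ((h k * V w) ^+ 2 / 2 - (1 - cos (h k * V w))) / h k ^+ 2.
    by field; exact: h0.
  rewrite normrM normfV normrX ler_pdivrMr ?exprn_gt0 ?normr_gt0//.
  rewrite (le_trans (cosB1B_le _))// [X in _ <= X * _]ger0_norm ?mulr_ge0 ?exprn_ge0//.
  by rewrite normrM; rewrite le_eqVlt; apply/orP; left; apply/eqP; ring.
- move=> k w; rewrite ger0_norm; last first.
    by rewrite mulr_ge0 ?cosB1_ge0// invr_ge0 sqr_ge0.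
  rewrite ler_pdivrMr ?exprn_even_gt0 ?h0//.
  have := cosB1_le_sqr (h k * V w); have := sqr_ge0 (h k * V w); nra.
Qed.

(** As V is centred, V may be subtracted from its sine: the quotients then
    tend to 0 and are dominated by V^2. *)
Lemma cvg_sin_mean : \int[P]_w sin (h k * V w) / h k ^+ 2 @[k --> \oo] --> (0 : R).
Proof.
have bs k := bounded_measurable_sin (mhV k).
have -> : 0 = \int[P]_w (fun=> 0) w :> R by rewrite Rintegral_probability_cst.
rewrite (_ : (fun k => _) =
    fun k => \int[P]_w ((sin (h k * V w) - h k * V w) * (h k ^+ 2)^-1)); last first.
  have ihV k : P.-integrable setT (EFin \o (fun w => h k * V w)).
    rewrite (_ : _ \o _ = fun w => ((h k)%:E * (EFin \o V) w)%E)//.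
    exact: integrableZl.
  apply/funext => k; rewrite RintegralZr//; last first.
    apply: (@integrableB _ _ _ P setT measurableT (EFin \o _) (EFin \o _)) => //.
    exact: bounded_measurable_integrable.
  rewrite RintegralB//; last exact: bounded_measurable_integrable.
  by rewrite RintegralZl// EV mulr0 subr0.
apply: (@Rdominated_cvg _ _ _ P
  (fun k w => (sin (h k * V w) - h k * V w) * (h k ^+ 2)^-1) _ (fun w => V w ^+ 2)) => //.
- move=> k; apply: measurable_funM => //; apply: measurable_funB => //.
  exact: measurable_sin.
- move=> w; apply/cvgrPdist_le => e e0.
  have := habs0 (`|V w| ^+ 3) => /cvgrPdist_le /(_ _ e0); apply: filterS => k.
  rewrite !sub0r !normrN; apply: le_trans.
  rewrite normrM normfV normrX ler_pdivrMr ?exprn_gt0 ?normr_gt0//.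
  rewrite distrC (le_trans (sinB_sub_le _))// ge_min; apply/orP; right.
  rewrite [X in _ <= X * _]ger0_norm ?mulr_ge0 ?exprn_ge0//.
  by rewrite normrM; rewrite le_eqVlt; apply/orP; left; apply/eqP; ring.
- move=> k w; rewrite normrM normfV normrX ler_pdivrMr ?exprn_gt0 ?normr_gt0//.
  rewrite distrC (le_trans (sinB_sub_le _))// ge_min; apply/orP; left.
  by rewrite exprMn mulrC real_normK// num_real.
Qed.

(** The form in which the expansion enters trig_product_approx with
    N = 1 / h^2: the characteristic function of h V and that of a centred
    normal variable of the same variance differ by o(h^2). *)
Lemma characteristic_expansion :
  (`|\int[P]_w cos (h k * V w) - expR (- (s2 * h k ^+ 2 / 2))| +
   `|\int[P]_w sin (h k * V w)|) / h k ^+ 2 @[k --> \oo] --> (0 : R).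
Proof.
have h2 k : 0 < h k ^+ 2 by rewrite exprn_even_gt0 ?h0.
pose q := s2 / 2.
have exp0 : (expR (- (q * h k ^+ 2)) - 1 + q * h k ^+ 2) / h k ^+ 2
    @[k --> \oo] --> (0 : R).
  apply/cvgrPdist_le => e e0.
  have hh : `|h k| * (`|h k| * q ^+ 2) @[k --> \oo] --> (0 : R).
    rewrite -[X in _ --> X](mul0r 0); apply: cvgM; last exact: habs0.
    by under eq_cvg do rewrite -[`|_|]mulr1; exact: habs0.
  have := hh => /cvgrPdist_le /(_ _ e0); apply: filterS => k.
  rewrite !sub0r !normrN; apply: le_trans.
  have qh : 0 <= q * h k ^+ 2 by rewrite mulr_ge0 ?(ltW (h2 k))// divr_ge0.
  rewrite normrM normfV (gtr0_norm (h2 k)) ler_pdivrMr//.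
  rewrite (le_trans (expRN_taylor qh))//.
  rewrite mulrA -normrM -expr2 [X in _ <= X * _]ger0_norm ?mulr_ge0 ?sqr_ge0//.
  rewrite (ger0_norm (sqr_ge0 (h k))).
  by rewrite le_eqVlt; apply/orP; left; apply/eqP; ring.
have H := cvgD (cvg_norm (cvgD (cvgN cvg_cos_mean) (cvgD (cvg_cst q) (cvgN exp0))))
  (cvg_norm cvg_sin_mean).
rewrite -/q oppr0 addr0 addNr normr0 addr0 in H.
rewrite (_ : (fun k => _) = fun k =>
  `|- ((1 - \int[P]_w cos (h k * V w)) / h k ^+ 2) +
    (q - (expR (- (q * h k ^+ 2)) - 1 + q * h k ^+ 2) / h k ^+ 2)| +
  `|\int[P]_w sin (h k * V w) / h k ^+ 2|); first exact: H.
apply/funext => k.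
have absE a : `|a| / h k ^+ 2 = `|a / h k ^+ 2| by rewrite normf_div (gtr0_norm (h2 k)).
rewrite mulrDl !absE.
have -> : s2 * h k ^+ 2 / 2 = q * h k ^+ 2 by rewrite /q; ring.
congr (`|_| + _); field; exact: h0.
Qed.

End characteristic_expansion.

(** * Densities, image measures, affine changes of variables *)

Section density.
Context d (T : measurableType d) (R : realType).
Variables (mu nu : {measure set T -> \bar R}) (p : T -> R).
Hypothesis p0 : forall x, 0 <= p x.
Hypothesis mp : measurable_fun setT p.
Hypothesis nuE : forall A, measurable A -> nu A = (\int[mu]_(x in A) (p x)%:E)%E.
Local Open Scope ereal_scope.
Import HBNNSimple.

Lemma ge0_integral_density (f : T -> \bar R) : measurable_fun setT f ->
  (forall x, 0 <= f x) -> \int[nu]_x f x = \int[mu]_x (f x * (p x)%:E).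
Proof.
move=> mf f0.
have ind A : measurable A -> \int[nu]_x (\1_A x)%:E = \int[mu]_x ((\1_A x)%:E * (p x)%:E).
  move=> mA; rewrite integral_indic// setIT nuE//.
  rewrite integral_mkcond; apply: eq_integral => x _.
  by rewrite patchE indicE; case: ifPn; rewrite ?mul1e ?mul0e.
have nn (f_ : {nnsfun T >-> R}) : \int[nu]_x (f_ x)%:E = \int[mu]_x ((f_ x)%:E * (p x)%:E).
  under eq_integral do rewrite fimfunE -fsumEFin//.
  rewrite ge0_integral_fsum//; last 2 first.
    by move=> r; exact/measurable_EFinP/measurableT_comp.
    by move=> n x _; rewrite EFinM nnfun_muleindic_ge0.
  under [RHS]eq_integral => x _.
    rewrite fimfunE -fsumEFin// ge0_mule_fsuml; last first.
      by move=> r; rewrite EFinM nnfun_muleindic_ge0.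
    over.
  rewrite [RHS]ge0_integral_fsum//; last 2 first.
    move=> r; apply: emeasurable_funM; last exact/measurable_EFinP.
    by exact/measurable_EFinP/measurableT_comp.
    move=> r x _; apply: mule_ge0; last by rewrite lee_fin.
    by rewrite EFinM nnfun_muleindic_ge0.
  apply: eq_fsbigr => r rf.
  have mr : measurable (f_ @^-1` [set r]) by exact: measurable_sfunP.
  under eq_integral do rewrite EFinM.
  under [RHS]eq_integral do rewrite EFinM -muleA.
  have [r0|r0] := leP 0%R r.
    rewrite ge0_integralZl//; last exact/measurable_EFinP.
    rewrite ind// ge0_integralZl//.
      apply: emeasurable_funM; [exact/measurable_EFinP|exact/measurable_EFinP].
    by move=> x _; rewrite mule_ge0 ?lee_fin.
  rewrite preimage_nnfun0// !integral0_eq// => x _.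
    by rewrite indic0 mul0e mule0.
  by rewrite indic0 mule0.
pose g := nnsfun_approx measurableT mf.
transitivity (limn (fun n => \int[nu]_x (g n x)%:E)).
  rewrite -monotone_convergence//.
  - by apply: eq_integral => x _; apply/esym/cvg_lim => //; exact: cvg_nnsfun_approx.
  - by move=> n; exact/measurable_EFinP.
  - by move=> n x _; rewrite lee_fin.
  - by move=> x _ m n mn; rewrite lee_fin; exact/lefP/nd_nnsfun_approx.
under eq_fun do rewrite nn.
rewrite -monotone_convergence//.
- apply: eq_integral => x _; apply/cvg_lim => //.
  apply: cvgeZr => //; exact: cvg_nnsfun_approx.
- by move=> n; apply: emeasurable_funM; exact/measurable_EFinP.
- by move=> n x _; rewrite mule_ge0 ?lee_fin.
- move=> x _ m n mn; rewrite lee_wpmul2r ?lee_fin//.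
  exact/lefP/nd_nnsfun_approx.
Qed.

End density.

Definition image_measure d d' (T : measurableType d) (T' : measurableType d')
    (R : realType) (mu : {measure set T -> \bar R}) (f : T -> T')
    (mf : measurable_fun setT f) : {measure set T' -> \bar R} :=
  measure_function_pushforward__canonical__measure_function_Measure mu mf.

Section affine_change_of_variables.
Context {R : realType}.
Local Notation mu := (@lebesgue_measure R).
Local Open Scope ereal_scope.

Lemma measurable_affine (a b : R) :
  measurable_fun [set: measurableTypeR R] (fun x => a * x + b : measurableTypeR R)%R.
Proof. by apply: measurable_funD => //; exact: measurable_funM. Qed.

Lemma lebesgue_measure_affine (a b : R) (a0 : (0 < a)%R) (A : set R) :
  measurable A ->
  mu A = mscale (NngNum (ltW a0)) (image_measure mu (measurable_affine a b)) A.
Proof.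
apply: lebesgue_measure_unique => _ [[x y]] _ <-.
have E : (fun z : R => a * z + b)%R @^-1` [set` `]x, y]]%R =
    [set` `](x - b) / a, (y - b) / a]]%R.
  apply/seteqP; split => z /=; rewrite !in_itv/= ltr_pdivrMr// ler_pdivlMr//;
    by rewrite ltrBlDr lerBrDr mulrC.
change (mu [set` `]x, y]]%R = a%:E * mu ((fun z : R => a * z + b)%R @^-1` [set` `]x, y]]%R)).
rewrite E.
rewrite !lebesgue_measure_itv/= !lte_fin ltr_pM2r ?invr_gt0// ltrD2r.
case: ifPn => _; last by rewrite mule0.
rewrite -!EFinD -EFinM; congr EFin; field; by rewrite gt_eqF.
Qed.

Lemma ge0_integral_affine (a b : R) (f : R -> \bar R) : (0 < a)%R ->
  measurable_fun setT f -> (forall x, 0 <= f x) ->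
  \int[mu]_x f x = a%:E * \int[mu]_x f (a * x + b)%R.
Proof.
move=> a0 mf f0.
transitivity (\int[mscale (NngNum (ltW a0)) (image_measure mu (measurable_affine a b))]_x f x).
  by apply: eq_measure_integral => A mA _; exact: lebesgue_measure_affine.
rewrite ge0_integral_mscale//=; congr (_ * _).
by rewrite ge0_integral_pushforward//; exact: measurable_affine.
Qed.

Lemma ge0_integral_opp (f : R -> \bar R) :
  measurable_fun setT f -> (forall x, 0 <= f x) ->
  \int[mu]_x f x = \int[mu]_x f (- x)%R.
Proof.
move=> mf f0.
have mg : measurable_fun [set: measurableTypeR R] (-%R : _ -> measurableTypeR R).
  exact: oppr_measurable.
transitivity (\int[image_measure mu mg]_x f x).
  by apply: eq_measure_integral => A mA _; apply/esym; exact: lebesgue_measureN.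
by rewrite ge0_integral_pushforward.
Qed.

End affine_change_of_variables.

(** * Moments and characteristic function of the normal law *)

Section normal_integrals.
Context {R : realType}.
Local Notation mu := (@lebesgue_measure R).
Implicit Types (s t : R).

Lemma ge0_integral_normal m s (f : R -> \bar R) : measurable_fun setT f ->
  (forall x, 0 <= f x)%E ->
  (\int[normal_prob m s]_x f x = \int[mu]_x (f x * (normal_pdf m s x)%:E))%E.
Proof.
move=> mf f0; apply: ge0_integral_density => //.
- by move=> x; exact: normal_pdf_ge0.
- exact: measurable_normal_pdf.
Qed.

Lemma normal_peak_scale s : 0 < s -> normal_peak s = normal_peak 1 / s :> R.
Proof.
move=> s0; rewrite /normal_peak expr1n mul1r -mulrnAr sqrtrM ?sqr_ge0//.
by rewrite sqrtr_sqr gtr0_norm// invfM mulrC.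
Qed.

Lemma normal_pdf_scale s x : 0 < s ->
  s * normal_pdf 0 s (s * x) = normal_pdf 0 1 x.
Proof.
move=> s0; rewrite !normal_pdfE ?oner_eq0 ?gt_eqF// normal_peak_scale//.
rewrite /normal_fun !subr0 expr1n.
have -> : - (s * x) ^+ 2 / (s ^+ 2 *+ 2) = - x ^+ 2 / (1 *+ 2).
  rewrite -(mulr_natl (s ^+ 2)); field; by rewrite gt_eqF.
by field; rewrite gt_eqF.
Qed.

Lemma ge0_integral_normal_scale s (f : R -> \bar R) : 0 < s ->
  measurable_fun setT f -> (forall x, 0 <= f x)%E ->
  (\int[normal_prob 0%R s]_x f x = \int[normal_prob 0%R 1%R]_x f (s * x)%R)%E.
Proof.
move=> s0 mf f0.
have mfs : measurable_fun setT (fun x => f (s * x)).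
  by apply: measurableT_comp => //; exact: measurable_funM.
rewrite (ge0_integral_normal 0 s mf f0) (ge0_integral_normal 0 1 mfs (fun x => f0 _)).
rewrite (@ge0_integral_affine _ s 0)//; last 2 first.
- apply: emeasurable_funM => //; apply/measurable_EFinP.
  exact: measurable_normal_pdf.
- by move=> x; rewrite mule_ge0 ?lee_fin ?normal_pdf_ge0.
rewrite -ge0_integralZl//; last 3 first.
- apply: emeasurable_funM; first by under eq_fun do rewrite addr0.
  apply/measurable_EFinP; apply: (measurableT_comp (measurable_normal_pdf 0 s)).
  by apply: measurable_funD => //; exact: measurable_funM.
- by move=> x _; rewrite mule_ge0 ?lee_fin ?normal_pdf_ge0.
- by rewrite lee_fin ltW.
apply: eq_integral => x _.
by rewrite addr0 muleCA -EFinM normal_pdf_scale.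
Qed.

Lemma normal_prob_opp (A : set R) : measurable A ->
  normal_prob 0 1 (-%R @^-1` A) = normal_prob 0 1 A.
Proof.
move=> mA.
have mNA : measurable (-%R @^-1` A : set R).
  by rewrite -[X in measurable X]setTI; exact: oppr_measurable.
have mi (B : set R) : measurable B -> measurable_fun [set: R] (fun x => (\1_B x : R)%:E).
  by move=> mB; exact/measurable_EFinP.
have NE (B : set R) : measurable B ->
    normal_prob 0 1 B = (\int[normal_prob 0%R 1%R]_x (\1_B x)%:E)%E.
  by move=> mB; rewrite integral_indic// setIT.
rewrite !NE//.
have ind0 (B : set R) x : (0 <= (\1_B x : R)%:E)%E by rewrite lee_fin.
rewrite (ge0_integral_normal 0 1 (mi _ mNA) (ind0 _)).
rewrite (ge0_integral_normal 0 1 (mi _ mA) (ind0 _)) [RHS]ge0_integral_opp.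
- apply: eq_integral => x _; congr (_ * _)%E.
  by rewrite !normal_pdfE ?oner_eq0// /normal_fun !subr0 sqrrN.
- apply: emeasurable_funM; first exact: mi.
  by apply/measurable_EFinP; exact: measurable_normal_pdf.
- by move=> x; rewrite mule_ge0 ?lee_fin ?normal_pdf_ge0.
Qed.

Let N : probability (measurableTypeR R) R := normal_prob 0 1.

Lemma integral_normal_odd (f : R -> R) : measurable_fun setT f ->
  N.-integrable setT (EFin \o f) -> (forall x, f (- x) = - f x) ->
  \int[N]_x f x = 0.
Proof.
move=> mf fi fodd.
have e : (\int[N]_x (f x)%:E = \int[pushforward N (-%R : _ -> measurableTypeR R)]_x (f x)%:E)%E.
  by apply: eq_measure_integral => A mA _; rewrite /pushforward [RHS]normal_prob_opp.
have : \int[N]_x f x = - \int[N]_x f x.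
  rewrite {1}/Rintegral e integral_pushforward//.
  + rewrite preimage_setT.
    under eq_integral do rewrite /= fodd -mulN1r.
    rewrite -/(Rintegral N setT (fun x => -1 * f x)) RintegralZl// mulN1r//.
  + exact/measurable_EFinP.
  + rewrite preimage_setT (_ : _ \o _ = fun x => ((-1)%:E * (EFin \o f) x)%E).
      exact: integrableZl.
    by apply/funext => x /=; rewrite fodd -EFinM mulN1r.
lra.
Qed.

Lemma normal_pdf_gaussian_factor (e x : R) : 0 < e ->
  expR (- ((1 + e) ^+ 2 - 1) * x ^+ 2 / 2) * normal_pdf 0 1 x =
  (1 + e)^-1 * normal_pdf 0 (1 + e)^-1 x.
Proof.
move=> e0; have s0 : 0 < (1 + e)^-1 by rewrite invr_gt0; lra.
rewrite !normal_pdfE ?oner_eq0 ?gt_eqF// (normal_peak_scale s0) invrK.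
rewrite /normal_fun !subr0 expr1n mulrCA -expRD.
have -> : - ((1 + e) ^+ 2 - 1) * x ^+ 2 / 2 + - x ^+ 2 / (1 *+ 2) =
  - x ^+ 2 / ((1 + e)^-1 ^+ 2 *+ 2).
  rewrite -(mulr_natl (_ ^+ 2)); field; rewrite gt_eqF//; lra.
by field; rewrite gt_eqF//; lra.
Qed.

Lemma integral_normal_gaussian (e : R) : 0 < e ->
  (\int[N]_x (expR (- ((1 + e) ^+ 2 - 1) * x ^+ 2 / 2))%:E = ((1 + e)^-1)%:E)%E.
Proof.
move=> e0; have s0 : 0 < (1 + e)^-1 by rewrite invr_gt0; lra.
rewrite ge0_integral_normal//; last first.
  apply/measurable_EFinP; apply: measurableT_comp => //.
  by apply: measurable_funM => //; apply: measurable_funM => //; exact: measurable_funX.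
under eq_integral do rewrite -EFinM normal_pdf_gaussian_factor// EFinM.
rewrite ge0_integralZl//; last 3 first.
- by apply/measurable_EFinP; exact: measurable_normal_pdf.
- by move=> x _; rewrite lee_fin normal_pdf_ge0.
- by rewrite lee_fin ltW.
by rewrite integral_normal_pdf mule1.
Qed.

(** The variance is 1, by differentiating in a at 0 the Gaussian integral of
    exp (- a x^2 / 2); taking 1 + a to be a square keeps this integral rational. *)
Lemma normal_second_moment :
  N.-integrable setT (EFin \o (fun x => x ^+ 2)) /\ \int[N]_x x ^+ 2 = 1.
Proof.
pose a (k : nat) : R := (1 + k.+1%:R^-1) ^+ 2 - 1.
have k0 k : 0 < k.+1%:R^-1 :> R by rewrite invr_gt0.
have a0 k : 0 < a k by rewrite /a; move: (k0 k); move: (_^-1) => u u0; nra.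
have ac : a k @[k --> \oo] --> (0 : R).
  rewrite (_ : a = fun k => k.+1%:R^-1 * (2 + k.+1%:R^-1)).
    rewrite -[X in _ --> X](mul0r (2 + 0)).
    apply: cvgM; first exact: cvg_harmonic.
    by apply: cvgD; [exact: cvg_cst|exact: cvg_harmonic].
  by apply/funext => k; rewrite /a; move: (_^-1) => u; ring.
pose f k (x : R) := (1 - expR (- a k * x ^+ 2 / 2)) / a k.
have me k : measurable_fun [set: R] (fun x => expR (- a k * x ^+ 2 / 2)).
  apply: measurableT_comp => //.
  by apply: measurable_funM => //; apply: measurable_funM => //; exact: measurable_funX.
have mf k : measurable_fun setT (f k).
  by apply: measurable_funM => //; exact: measurable_funB.
have ey k x : 0 <= a k * x ^+ 2 / 2.
  by apply: mulr_ge0 => //; apply: mulr_ge0; [exact: (ltW (a0 k))|exact: sqr_ge0].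
have ele k x : expR (- a k * x ^+ 2 / 2) <= 1.
  by rewrite -[leRHS]expR0 ler_expR !mulNr oppr_le0.
have f0 k x : 0 <= f k x by rewrite divr_ge0 ?(ltW (a0 k))// subr_ge0.
have fle k x : f k x <= x ^+ 2 / 2.
  rewrite ler_pdivrMr//; have := expR_ge1Dx (- (a k * x ^+ 2 / 2)).
  have -> : - (a k * x ^+ 2 / 2) = - a k * x ^+ 2 / 2 by ring.
  lra.
have fcvg x : f k x @[k --> \oo] --> x ^+ 2 / 2.
  apply/cvgrPdist_le => e e0.
  have : a k * (x ^+ 2 / 2) ^+ 2 @[k --> \oo] --> (0 : R).
    by rewrite -[X in _ --> X](mul0r ((x ^+ 2 / 2) ^+ 2)); apply: cvgMl.
  move=> /cvgrPdist_le /(_ _ e0); apply: filterS => k.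
  rewrite sub0r normrN; apply: le_trans.
  have := expRN_taylor (ey k x).
  have -> : x ^+ 2 / 2 - f k x =
      (expR (- (a k * x ^+ 2 / 2)) - 1 + a k * x ^+ 2 / 2) / a k.
    rewrite /f !mulNr; field; by rewrite gt_eqF.
  rewrite normrM normfV (gtr0_norm (a0 k)) ler_pdivrMr// => /le_trans; apply.
  rewrite ger0_norm; last by rewrite mulr_ge0 ?sqr_ge0 ?(ltW (a0 k)).
  by rewrite le_eqVlt; apply/orP; left; apply/eqP; ring.
have be k : bounded_measurable (fun x : measurableTypeR R => expR (- a k * x ^+ 2 / 2)).
  by split; [exact: me|exists 1 => x; rewrite ger0_norm ?expR_ge0].
have If k : \int[N]_x f k x = (1 - (1 + k.+1%:R^-1)^-1) / a k.
  rewrite RintegralZr//; last first.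
    apply: bounded_measurable_integrable; apply: bounded_measurableB => //.
    exact: bounded_measurable_cst.
  rewrite RintegralB//; last 2 first.
    exact: finite_measure_integrable_cst.
    exact: bounded_measurable_integrable.
  rewrite Rintegral_probability_cst; congr ((_ - _) / _).
  by rewrite /Rintegral integral_normal_gaussian.
have Iflim : \int[N]_x f k x @[k --> \oo] --> (2^-1 : R).
  have -> : 2^-1 = ((1 + 0) * (2 + 0))^-1 :> R by field.
  rewrite (_ : (fun k => _) = fun k => ((1 + k.+1%:R^-1) * (2 + k.+1%:R^-1))^-1).
    apply: cvgV; first by rewrite !addr0 mul1r.
    by apply: cvgM; (apply: cvgD; [exact: cvg_cst|exact: cvg_harmonic]).
  apply/funext => k; rewrite If /a; have := k0 k.
  set u := _^-1 => u0; field.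
  by rewrite !gt_eqF//; nra.
have bound : (\int[N]_x (x ^+ 2 / 2)%:E <= (2^-1)%:E)%E.
  have h := fatou N measurableT (fun k => (measurable_EFinP _ _).2 (mf k))
    (fun k x _ => f0 k x : (0 <= (f k x)%:E)%E).
  have cE x : (f k x)%:E @[k --> \oo] --> (x ^+ 2 / 2)%:E.
    by apply: cvg_EFin; [exact: nearW|exact: fcvg].
  under eq_integral do rewrite -(cvg_limn_einf_sup (cE _)).1.
  apply: (le_trans h).
  have cI : (\int[N]_x (f k x)%:E)%E @[k --> \oo] --> (2^-1 : R)%:E.
    rewrite (_ : (fun k => _) = fun k => (\int[N]_x f k x)%:E).
      by apply: cvg_EFin; [exact: nearW|exact: Iflim].
    apply/funext => k; rewrite EFin_Rintegral//.
    apply: bounded_measurable_integrable; rewrite /f.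
    under eq_fun do rewrite mulrC; apply: bounded_measurableZ.
    by apply: bounded_measurableB => //; exact: bounded_measurable_cst.
  by rewrite (cvg_limn_einf_sup cI).1.
have ix : N.-integrable setT (EFin \o (fun x => x ^+ 2 / 2)).
  apply/integrableP; split.
    by apply/measurable_EFinP; apply: measurable_funM => //; exact: measurable_funX.
  rewrite (le_lt_trans _ (ltry (2^-1)))// (le_trans _ bound)//.
  by under eq_integral do rewrite /= ger0_norm ?divr_ge0 ?sqr_ge0//.
have Ix : \int[N]_x (x ^+ 2 / 2) = 2^-1.
  apply: (cvg_unique (@Rhausdorff R) _ Iflim).
  apply: (@Rdominated_cvg _ _ _ N f _ (fun x => x ^+ 2 / 2)) => //.
  by move=> k x; rewrite ger0_norm.
have ix2 : N.-integrable setT (EFin \o (fun x => x ^+ 2)).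
  rewrite (_ : _ \o _ = fun x => (2%:E * (EFin \o (fun x : R => x ^+ 2 / 2)%R) x)%E).
    exact: integrableZl.
  by apply/funext => x /=; rewrite -EFinM; congr EFin; field.
split => //; rewrite RintegralZr// in Ix; lra.
Qed.

(** Completing the square. *)
Lemma normal_pdf_convolution (u y : R) :
  normal_pdf 0 1 (u - y) * normal_pdf 0 1 y =
  normal_pdf 0 (Num.sqrt 2) u * normal_pdf (u / 2) (Num.sqrt 2)^-1 y.
Proof.
have s0 : 0 < Num.sqrt 2 :> R by rewrite sqrtr_gt0.
have s2 : Num.sqrt 2 ^+ 2 = 2 :> R by rewrite sqr_sqrtr.
rewrite !normal_pdfE ?oner_eq0 ?invr_eq0 ?gt_eqF//.
rewrite (normal_peak_scale s0) (@normal_peak_scale (Num.sqrt 2)^-1) ?invr_gt0// invrK.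
rewrite /normal_fun !subr0 expr1n exprVn s2 mulrACA -expRD.
rewrite [RHS]mulrACA -expRD; congr (_ * expR _).
  by field; rewrite gt_eqF.
by field.
Qed.

(** Stability of the normal law: integrate normal_pdf_convolution over y and
    exchange the order of integration. *)
Lemma normal_convolution (h : R -> \bar R) : measurable_fun setT h ->
  (forall x, 0 <= h x)%E ->
  (\int[N]_y \int[N]_x h (x + y)%R = \int[N]_x h (Num.sqrt 2 * x)%R)%E.
Proof.
move=> mh h0; have s0 : 0 < Num.sqrt 2 :> R by rewrite sqrtr_gt0.
have mp := @measurable_normal_pdf R 0 1.
pose F (z : measurableTypeR R * measurableTypeR R) : \bar R :=
  (h z.1 * (normal_pdf 0 1 (z.1 - z.2))%:E * (normal_pdf 0 1 z.2)%:E)%E.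
have mF : measurable_fun setT F.
  apply: emeasurable_funM; first apply: emeasurable_funM.
  - by apply: measurableT_comp => //; exact: measurable_fst.
  - apply/measurable_EFinP; apply: (measurableT_comp mp).
    by apply: measurable_funB; [exact: measurable_fst|exact: measurable_snd].
  - by apply/measurable_EFinP; apply: (measurableT_comp mp); exact: measurable_snd.
have F0 z : (0 <= F z)%E by rewrite !mule_ge0 ?lee_fin ?normal_pdf_ge0.
have inner y : (\int[N]_x h (x + y)%R =
    \int[mu]_u (h u * (normal_pdf 0 1 (u - y))%:E))%E.
  have mhy : measurable_fun [set: R] (fun x => h (x + y)).
    by apply: measurableT_comp => //; exact: measurable_funD.
  rewrite (ge0_integral_normal 0 1 mhy (fun x => h0 _)).
  rewrite [RHS](@ge0_integral_affine _ 1 y)//; last 2 first.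
  - apply: emeasurable_funM => //; apply/measurable_EFinP; apply: (measurableT_comp mp).
    exact: measurable_funB.
  - by move=> u; rewrite mule_ge0 ?lee_fin ?normal_pdf_ge0.
  by rewrite mul1e; apply: eq_integral => x _; rewrite mul1r addrK.
under eq_integral do rewrite inner.
have mI : measurable_fun [set: measurableTypeR R] (fun y =>
    \int[mu]_u (h u * (normal_pdf 0 1 (u - y)%R)%:E))%E.
  pose G (z : measurableTypeR R * measurableTypeR R) : \bar R :=
    (h z.1 * (normal_pdf 0 1 (z.1 - z.2))%:E)%E.
  apply: (@measurable_fun_fubini_tonelli_G _ _ _ _ R mu G).
    apply: emeasurable_funM.
    - by apply: measurableT_comp => //; exact: measurable_fst.
    - apply/measurable_EFinP; apply: (measurableT_comp mp).
      by apply: measurable_funB; [exact: measurable_fst|exact: measurable_snd].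
  by move=> z; rewrite mule_ge0 ?lee_fin ?normal_pdf_ge0.
have I0 y : (0 <= \int[mu]_u (h u * (normal_pdf 0 1 (u - y)%R)%:E))%E.
  by apply: integral_ge0 => u _; rewrite mule_ge0 ?lee_fin ?normal_pdf_ge0.
rewrite (ge0_integral_normal 0 1 mI I0).
transitivity (\int[mu]_y \int[mu]_u F (u, y))%E.
  apply: eq_integral => y _; rewrite /F/= ge0_integralZr//.
  - apply: emeasurable_funM => //; apply/measurable_EFinP; apply: (measurableT_comp mp).
    exact: measurable_funB.
  - by move=> u _; rewrite mule_ge0 ?lee_fin ?normal_pdf_ge0.
  - by rewrite lee_fin normal_pdf_ge0.
rewrite -(@fubini_tonelli _ _ _ _ R mu mu F mF F0).
transitivity (\int[mu]_u (h u * (normal_pdf 0 (Num.sqrt 2) u)%:E))%E.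
  apply: eq_integral => u _; rewrite /F/=.
  under eq_integral do rewrite -muleA -EFinM normal_pdf_convolution EFinM muleA.
  rewrite ge0_integralZl//; last 3 first.
  - by apply/measurable_EFinP; exact: measurable_normal_pdf.
  - by move=> y _; rewrite lee_fin normal_pdf_ge0.
  - by rewrite mule_ge0 ?lee_fin ?normal_pdf_ge0.
  by rewrite integral_normal_pdf mule1.
by rewrite -(ge0_integral_normal 0 _ mh h0) (ge0_integral_normal_scale s0 mh h0).
Qed.

Let mtx t : measurable_fun [set: measurableTypeR R] (fun x : R => t * x).
Proof. exact: measurable_funM. Qed.

Let C t := \int[N]_x cos (t * x).

Lemma normal_sin t : \int[N]_x sin (t * x) = 0.
Proof.
apply: integral_normal_odd; first by apply: measurable_sin; exact: mtx.
  exact: (bounded_measurable_integrable N (bounded_measurable_sin (mtx t))).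
by move=> x; rewrite mulrN sinN.
Qed.

Lemma normal_cos_shift t th : \int[N]_x cos (t * x + th) = C t * cos th.
Proof.
have bc := bounded_measurable_integrable N (bounded_measurable_cos (mtx t)).
have bs := bounded_measurable_integrable N (bounded_measurable_sin (mtx t)).
under eq_Rintegral do rewrite cosD mulrC [X in _ - X]mulrC.
rewrite RintegralB//; last 2 first.
- exact: (bounded_measurable_integrable N (bounded_measurableZ (cos th) (bounded_measurable_cos
  (mtx t)))).
- exact: (bounded_measurable_integrable N (bounded_measurableZ (sin th) (bounded_measurable_sin
  (mtx t)))).
by rewrite !RintegralZl// normal_sin mulr0 subr0 mulrC.
Qed.

Lemma normal_cos_double t : C (Num.sqrt 2 * t) = C t ^+ 2.
Proof.
pose h x := (1 + cos (t * x))%:E.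
have h0 x : (0 <= h x)%E by rewrite lee_fin -lerBlDl sub0r cos_geN1.
have mh : measurable_fun [set: R] h.
  apply/measurable_EFinP; apply: measurable_funD => //.
  by apply: measurable_cos; exact: measurable_funM.
have key (f : R -> R) : bounded_measurable (f : measurableTypeR R -> R) ->
    (\int[N]_x (1 + f x)%:E = (1 + \int[N]_x f x)%:E)%E.
  move=> bf; rewrite EFin_Rintegral; last first.
    apply: bounded_measurable_integrable; apply: bounded_measurableD => //.
    exact: bounded_measurable_cst.
  congr EFin; rewrite RintegralD//; last 2 first.
    exact: finite_measure_integrable_cst.
    exact: bounded_measurable_integrable.
  by rewrite Rintegral_probability_cst.
(* The constant 1 makes the integrand of normal_convolution nonnegative. *)
have := normal_convolution mh h0; rewrite /h.
under eq_integral => y _.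
  rewrite key; last first.
    apply: bounded_measurable_cos; under eq_fun do rewrite mulrDr.
    by apply: measurable_funD => //; exact: mtx.
  under eq_Rintegral do rewrite mulrDr.
  rewrite normal_cos_shift.
  over.
rewrite key; last first.
  apply: bounded_measurable_cos; under eq_fun do rewrite mulrA.
  exact: mtx.
rewrite key; last exact: (bounded_measurableZ (C t) (bounded_measurable_cos (mtx t))).
rewrite RintegralZl//;
  last exact: (bounded_measurable_integrable N (bounded_measurable_cos (mtx t))).
move=> [] /addrI; rewrite -expr2 -/(C t) => ->.
by rewrite /C; apply: eq_Rintegral => x _; rewrite mulrA [t * _]mulrC.
Qed.

(** A normal variable is 2^-k times a sum of 4^k independent ones. *)
Lemma normal_cos_pow t k : C t = C (t / 2 ^+ k) ^+ (4 ^ k).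
Proof.
elim: k => [|k IHk]; first by rewrite expr0 divr1 expn0 expr1.
have C2 r : C (2 * r) = C r ^+ 4.
  have -> : 2 * r = Num.sqrt 2 * (Num.sqrt 2 * r).
    by rewrite mulrA -expr2 sqr_sqrtr.
  by rewrite !normal_cos_double -exprM.
rewrite IHk expnS exprM -C2; congr (C _ ^+ _).
by rewrite exprS; field; rewrite expf_neq0.
Qed.

(** By normal_cos_pow the value at t is a power of the value at t / 2^k, where
    the second-order expansion at 0 determines the limit. *)
Theorem normal_characteristic t : C t = expR (- (t ^+ 2 / 2)).
Proof.
have [->|t0] := eqVneq t 0.
  rewrite /C expr0n mul0r oppr0 expR0.
  by under eq_Rintegral do rewrite mul0r cos0; rewrite Rintegral_probability_cst.
pose h (k : nat) : R := t / 2 ^+ k.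
have p0 k : 0 < 2 ^+ k :> R by rewrite exprn_gt0.
have h0 k : h k != 0 by rewrite mulf_neq0// invr_neq0// gt_eqF.
have hc : h k @[k --> \oo] --> (0 : R).
  rewrite -[X in _ --> X](mulr0 t) /h; apply: cvgM; first exact: cvg_cst.
  under eq_cvg do rewrite -exprVn; apply: cvg_expr.
  by rewrite ger0_norm// invf_lt1// ltr1n.
have [ix2 vx] := normal_second_moment.
have idm : measurable_fun [set: measurableTypeR R] (id : measurableTypeR R -> R).
  exact: measurable_id.
have ix : N.-integrable setT (EFin \o (id : R -> R)).
  exact: (integrable_of_sqr idm ix2).
have mx : \int[N]_x x = 0 by apply: integral_normal_odd.
have := characteristic_expansion idm ix ix2 mx vx h0 hc.
move=> H; apply/eqP; rewrite -subr_eq0 -normr_le0.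
have t20 : 0 < t ^+ 2 by rewrite exprn_even_gt0.
have L : t ^+ 2 * ((`|C (h k) - expR (- (1 * h k ^+ 2 / 2))| +
   `|\int[N]_x sin (h k * x)|) / h k ^+ 2) @[k --> \oo] --> (0 : R).
  rewrite -[X in _ --> X](mulr0 (t ^+ 2)).
  by apply: cvgM; [exact: cvg_cst|exact: H].
apply: (ler_cvg_to (cvg_cst `|C t - expR (- (t ^+ 2 / 2))|) L).
apply: nearW => k.
have h2 : 0 < h k ^+ 2 by rewrite exprn_even_gt0 ?h0.
have hE : t ^+ 2 / h k ^+ 2 = (4 ^ k)%:R.
  rewrite /h exprMn exprVn -exprM mulnC exprM -natrX natrX -natrX.
  by rewrite invfM invrK mulrA divff ?gt_eqF// mul1r -!natrX.
rewrite normal_sin normr0 addr0.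
set A := `|C (h k) - _|; have -> : t ^+ 2 * (A / h k ^+ 2) = t ^+ 2 / h k ^+ 2 * A by ring.
rewrite hE (normal_cos_pow t k) -/(h k).
have -> : expR (- (t ^+ 2 / 2)) = expR (- (1 * h k ^+ 2 / 2)) ^+ (4 ^ k).
  rewrite -expRM_natl -hE; congr expR; field; exact: h0.
apply: expr_sub_le.
  apply: norm_Rintegral_bound; last by move=> x; exact: cos_max.
  by apply: measurable_cos; exact: mtx.
by rewrite expR_ge0/= -[leRHS]expR0 ler_expR oppr_le0 mul1r divr_ge0// ltW.
Qed.

End normal_integrals.

(** * Two independent uniform variables from one *)

Definition mfun_of d d' (T : measurableType d) (T' : measurableType d')
    (f : T -> T') (mf : measurable_fun setT f) : {mfun T >-> T'} :=
  HB.pack f (isMeasurableFun.Build _ _ _ _ f mf).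

Section doubling.
Context {R : realType}.
Local Notation mu := (@lebesgue_measure R).

Definition unif : probability (measurableTypeR R) R := uniform_prob (@ltr01 R).

(** The leading binary digit of a point of the unit interval, and the digits
    that follow it. *)
Definition bit (x : R) : R := \1_(`[2^-1, +oo[) x.
Definition doubling (x : R) : R := 2 * x - bit x.

Lemma bit01 x : bit x = 0 \/ bit x = 1.
Proof. by rewrite /bit indicE; case: (_ \in _); [right|left]. Qed.

Lemma measurable_bit : measurable_fun [set: measurableTypeR R] bit.
Proof. exact: measurable_indic. Qed.

Lemma measurable_doubling :
  measurable_fun [set: measurableTypeR R] (doubling : R -> measurableTypeR R).
Proof.
apply: measurable_funB; last exact: measurable_bit.
exact: measurable_funM.
Qed.

(** Each half of the unit interval is an affine copy of the whole, on which the
    leading digit is constant and the following digits are uniform. *)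
Lemma ge0_integral_doubling (H : R -> R -> \bar R) :
  (forall c, measurable_fun setT (H c)) -> (forall c x, 0 <= H c x)%E ->
  (\int[unif]_x H (bit x) (doubling x) =
   2^-1%:E * (\int[unif]_x H 0%R x + \int[unif]_x H 1%R x))%E.
Proof.
move=> mH H0.
pose F x := H (bit x) (doubling x).
have FE x : F x = if x < 2^-1 then H 0 (2 * x) else H 1 (2 * x - 1).
  rewrite /F /doubling /bit indicE; case: ltP => x2.
    by rewrite memNset ?subr0//= in_itv/= andbT; apply/negP; rewrite -ltNge.
  by rewrite mem_set//= in_itv/= andbT.
have mH0 : measurable_fun [set: measurableTypeR R] (fun x => H 0 (2 * x)).
  by apply: (measurableT_comp (mH 0)); exact: measurable_funM.
have mH1 : measurable_fun [set: measurableTypeR R] (fun x => H 1 (2 * x - 1)).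
  exact: (measurableT_comp (mH 1) (measurable_affine 2 (- 1))).
have mF : measurable_fun [set: measurableTypeR R] F.
  rewrite (_ : F = fun x => if x < 2^-1 then H 0 (2 * x) else H 1 (2 * x - 1)).
    by apply: measurable_fun_ifT => //; exact: measurable_fun_ltr.
  by apply/funext => x; rewrite FE.
have F0 x : (0 <= F x)%E by exact: H0.
have restr (A : set R) (f : R -> \bar R) : measurable A ->
    measurable_fun setT f -> measurable_fun setT (f \_ A).
  move=> mA mf; apply/(measurable_restrictT f mA); exact: measurable_funS mf.
have half c (b : R) (G : R -> \bar R) (A B : set R) : measurable_fun setT G ->
    measurable A -> (forall x, 0 <= G x)%E ->
    (forall x, A (2^-1 * x + b) <-> B x) -> (forall x, G (2^-1 * x + b) = H c x) ->
    (\int[mu]_(x in A) G x = 2^-1%:E * \int[mu]_(x in B) H c x)%E.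
  move=> mG mA G0 AB GH.
  rewrite integral_mkcond (@ge0_integral_affine _ 2^-1 b)//; last 2 first.
  - exact: restr.
  - by move=> x; rewrite patchE; case: ifP.
  rewrite [in RHS]integral_mkcond; congr (_ * _)%E; apply: eq_integral => x _.
  rewrite !patchE GH; congr (if _ then _ else _).
  by apply/idP/idP; rewrite !inE => /AB.
rewrite (integral_uniform _ mF F0) (integral_uniform _ (mH 0) (H0 0)).
rewrite (integral_uniform _ (mH 1) (H0 1)).
have -> : ((1 - 0)^-1 = 1 :> R)%R by rewrite subr0 invr1.
rewrite !mul1e.
rewrite [in LHS](_ : `[0, 1]%classic = `[0, 2^-1[%classic `|` `[2^-1, 1]%classic :> set R);
  last first.
  apply/seteqP; split => x /=; rewrite !in_itv/=.
    move=> /andP[x0 x1]; case: (ltP x 2^-1) => x2; [left|right].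
      by rewrite x0.
    by rewrite x1.
  by move=> [/andP[x0 x1]|/andP[x0 x1]]; apply/andP; split; lra.
rewrite ge0_integral_setU//=; last 2 first.
- exact: measurable_funS mF.
- rewrite disj_set2E; apply/eqP/seteqP; split => // x /=; rewrite !in_itv/=.
  by move=> [/andP[_ x1] /andP[x2 _]]; lra.
rewrite muleDr//; last by apply: ge0_adde_def; rewrite inE; exact: integral_ge0.
congr (_ + _)%E.
- transitivity (\int[mu]_(x in `[0%R, 2^-1%R[) H 0%R (2 * x)%R)%E.
    apply: eq_integral => x; rewrite inE/= in_itv/= => /andP[_ x2].
    by rewrite -/(F x) FE x2.
  rewrite (half 0 0 (fun x => H 0 (2 * x)) _ `[0, 1[%classic)//.
  + congr (_ * _)%E.
    apply: integral_itv_bndo_bndc.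
    exact: measurable_funS (mH 0).
  + by move=> x; rewrite /= !in_itv/= addr0; split => /andP[x0 x1]; apply/andP; split; lra.
  + by move=> x; congr (H 0 _); rewrite addr0 mulrA divff ?mul1r.
- transitivity (\int[mu]_(x in `[2^-1%R, 1%R]) H 1%R (2 * x - 1)%R)%E.
    apply: eq_integral => x; rewrite inE/= in_itv/= => /andP[x2 _].
    by rewrite -/(F x) FE ltNge x2.
  rewrite (half 1 2^-1 (fun x => H 1 (2 * x - 1)) _ `[0, 1]%classic)//.
  + by move=> x; rewrite /= !in_itv/=; split => /andP[x0 x1]; apply/andP; split; lra.
  + by move=> x; congr (H 1 _); field.
Qed.

Lemma mean_doubling (H : R -> R -> R) :
  (forall c, bounded_measurable (H c : measurableTypeR R -> R)) ->
  \int[unif]_x H (bit x) (doubling x) =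
  (\int[unif]_x H 0 x + \int[unif]_x H 1 x) / 2.
Proof.
move=> bH.
have [K0 H0K] := (bH 0).2; have [K1 H1K] := (bH 1).2.
pose K := `|K0| + `|K1|.
have HK c x : c = 0 \/ c = 1 -> `|H c x| <= K.
  move=> [->|->]; rewrite /K.
    by rewrite (le_trans (H0K x))// (le_trans (ler_norm _))// lerDl.
  by rewrite (le_trans (H1K x))// (le_trans (ler_norm _))// lerDr.
pose G c x : \bar R := (Num.max 0 (K + H c x))%:E.
have GE c x : c = 0 \/ c = 1 -> G c x = (K + H c x)%:E.
  move=> c01; rewrite /G max_r//; have := HK c x c01; rewrite ler_norml => /andP[+ _].
  by rewrite -lerBlDl sub0r.
have := @ge0_integral_doubling G; rewrite /=.
have mG c : measurable_fun [set: measurableTypeR R] (G c).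
  apply/measurable_EFinP; apply: measurable_maxr => //.
  by apply: measurable_funD => //; have [] := bH c.
move=> /(_ mG) /(_ (fun c x => _)) h.
have {h} := h (fun c x => ltac:(rewrite /G lee_fin le_max lexx//)).
have bHb : bounded_measurable (fun x : measurableTypeR R => H (bit x) (doubling x)).
  split; last by exists K => x; apply: HK; exact: bit01.
  rewrite (_ : (fun _ => _) =
      fun x => (1 - bit x) * H 0 (doubling x) + bit x * H 1 (doubling x)).
    apply: measurable_funD; apply: measurable_funM.
    - by apply: measurable_funB => //; exact: measurable_bit.
    - by apply: measurableT_comp; [have [] := bH 0|exact: measurable_doubling].
    - exact: measurable_bit.
    - by apply: measurableT_comp; [have [] := bH 1|exact: measurable_doubling].
  by apply/funext => x; case: (bit01 x) => ->; ring.
have key (f : measurableTypeR R -> R) : bounded_measurable f ->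
    (\int[unif]_x (K + f x)%:E = (K + \int[unif]_x f x)%:E)%E.
  move=> bf; rewrite EFin_Rintegral; last first.
    apply: bounded_measurable_integrable; apply: bounded_measurableD => //.
    exact: bounded_measurable_cst.
  congr EFin; rewrite RintegralD//; last 2 first.
    exact: finite_measure_integrable_cst.
    exact: bounded_measurable_integrable.
  by rewrite Rintegral_probability_cst.
under eq_integral do rewrite (GE _ _ (bit01 _)).
under [X in (_ * (X + _))%E]eq_integral do rewrite (GE _ _ (or_introl erefl)).
under [X in (_ * (_ + X))%E]eq_integral do rewrite (GE _ _ (or_intror erefl)).
rewrite (key _ bHb) (key _ (bH 0)) (key _ (bH 1)) -EFinD -EFinM => -[] h.
by apply: (addrI K); rewrite h; field.
Qed.

End doubling.

Section even_digits.
Context {R : realType}.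

Fixpoint even_digits_sum (m : nat) (x : R) : R :=
  if m is m'.+1 then (bit x + even_digits_sum m' (doubling (doubling x))) / 2
  else 0.

Lemma even_digits_sum01 m x : 0 <= even_digits_sum m x <= 1.
Proof.
elim: m x => [|m IHm] x /=; first by rewrite lexx ler01.
have := IHm (doubling (doubling x)) => /andP[? ?].
by case: (bit01 x) => ->; apply/andP; split; lra.
Qed.

Lemma even_digits_sum_le m x : even_digits_sum m x <= even_digits_sum m.+1 x.
Proof.
elim: m x => [|m IHm] x.
  by have /andP[] := even_digits_sum01 1 x.
rewrite [leLHS]/= [leRHS]/= ler_pM2r// lerD2l; exact: IHm.
Qed.

(** The number whose binary digits are the digits of x of even rank. *)
Definition even_digits (x : R) : R := limn (even_digits_sum ^~ x).

Lemma even_digits_cvg x : even_digits_sum ^~ x @ \oo --> even_digits x.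
Proof.
apply: nondecreasing_is_cvgn; first by apply/nondecreasing_seqP => m; exact: even_digits_sum_le.
by exists 1 => _ [m _ <-]; have /andP[] := even_digits_sum01 m x.
Qed.

Lemma even_digitsE x :
  even_digits x = (bit x + even_digits (doubling (doubling x))) / 2.
Proof.
have h : (fun m => (bit x + even_digits_sum m (doubling (doubling x))) / 2) @ \oo -->
    (bit x + even_digits (doubling (doubling x))) / 2.
  by apply: cvgMl; apply: cvgD; [exact: cvg_cst|exact: even_digits_cvg].
apply: (cvg_unique (@Rhausdorff R) _ h).
by have := @even_digits_cvg x; rewrite -cvg_shiftS.
Qed.

Lemma even_digits01 x : 0 <= even_digits x <= 1.
Proof.
apply/andP; split.
  apply: (ler_cvg_to (cvg_cst 0) (@even_digits_cvg x)); apply: nearW => m.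
  by have /andP[] := even_digits_sum01 m x.
apply: limr_le; first by apply/cvg_ex; exists (even_digits x); exact: even_digits_cvg.
apply: nearW => m.
by have /andP[] := even_digits_sum01 m x.
Qed.

Lemma measurable_even_digits : measurable_fun [set: measurableTypeR R] even_digits.
Proof.
apply: (measurable_fun_cvg (h := even_digits_sum)).
  elim=> [|m IHm] /=; first exact: measurable_cst.
  apply: measurable_funM => //; apply: measurable_funD; first exact: measurable_bit.
  by apply: (measurableT_comp IHm); apply: measurableT_comp; exact: measurable_doubling.
by move=> x _; exact: even_digits_cvg.
Qed.

Definition odd_digits (x : R) : R := even_digits (doubling x).

(** Removing the leading digit exchanges the even and the odd ranks. *)
Lemma even_odd_digits x : even_digits x = (bit x + odd_digits (doubling x)) / 2.
Proof. exact: even_digitsE. Qed.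

End even_digits.

Section product_probability.
Context d1 d2 (T1 : measurableType d1) (T2 : measurableType d2) (R : realType).
Variables (P : probability T1 R) (Q : probability T2 R).

Let prod_setT : (P \x Q)%E setT = 1%E.
Proof.
transitivity (P setT * Q setT)%E; last by rewrite !probability_setT mule1.
by rewrite -setXTT; exact: product_measure1E.
Qed.

Definition prod_probability : probability (T1 * T2)%type R :=
  HB.pack (P \x Q)%E (Measure_isProbability.Build _ _ _ (P \x Q)%E prod_setT).

Lemma mean_prod_mul (f : T1 -> R) (g : T2 -> R) :
  bounded_measurable f -> bounded_measurable g ->
  \int[prod_probability]_z (f z.1 * g z.2) = (\int[P]_x f x) * \int[Q]_y g y.
Proof.
move=> bf bg.
have bfg : bounded_measurable (fun z : T1 * T2 => f z.1 * g z.2).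
  have [mf [K fK]] := bf; have [mg [L gL]] := bg.
  apply: bounded_measurableM.
    split; last by exists K => z; exact: fK.
    by apply: measurableT_comp => //; exact: measurable_fst.
  split; last by exists L => z; exact: gL.
  by apply: measurableT_comp => //; exact: measurable_snd.
have ifg := bounded_measurable_integrable prod_probability bfg.
apply: EFin_inj; rewrite -EFin_Rintegral//.
rewrite -(integral12_prod_meas1 (m1 := P) (m2 := Q) ifg) /=.
under eq_integral => x _.
  rewrite /fubini_F/= EFin_Rintegral; last first.
    exact: (bounded_measurable_integrable Q (bounded_measurableZ (f x) bg)).
  rewrite RintegralZl//; last exact: bounded_measurable_integrable.
  over.
rewrite EFin_Rintegral; last first.
  apply: bounded_measurable_integrable; apply: bounded_measurableM => //.
  exact: bounded_measurable_cst.
by rewrite RintegralZr//; exact: bounded_measurable_integrable.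
Qed.

End product_probability.

(** The positive and the negative part are treated separately, so that the
    integrals may be infinite. *)
Lemma eq_law_integral d d1 d2 (S : measurableType d) (T1 : measurableType d1)
    (T2 : measurableType d2) (R : realType) (P : probability T1 R)
    (Q : probability T2 R) (X : T1 -> S) (Y : T2 -> S) (F : S -> \bar R) :
  measurable_fun setT X -> measurable_fun setT Y ->
  (forall B, measurable B -> P (X @^-1` B) = Q (Y @^-1` B)) ->
  measurable_fun setT F -> (\int[P]_w F (X w) = \int[Q]_w F (Y w))%E.
Proof.
move=> mX mY XY mF.
have ge0 (G : S -> \bar R) : measurable_fun setT G -> (forall x, 0 <= G x)%E ->
    (\int[P]_w G (X w) = \int[Q]_w G (Y w))%E.
  move=> mG G0.
  transitivity (\int[image_measure P mX]_x G x)%E.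
    by rewrite ge0_integral_pushforward.
  transitivity (\int[image_measure Q mY]_x G x)%E.
    by apply: eq_measure_integral => B mB _; exact: XY.
  by rewrite ge0_integral_pushforward.
rewrite integralE [in RHS]integralE; congr (_ - _)%E.
  rewrite (funepos_comp F X) (funepos_comp F Y).
  exact: (ge0 _ (measurable_funepos mF) (funepos_ge0 F)).
rewrite (funeneg_comp F X) (funeneg_comp F Y).
exact: (ge0 _ (measurable_funeneg mF) (funeneg_ge0 F)).
Qed.

Lemma eq_law_mean d d1 d2 (S : measurableType d) (T1 : measurableType d1)
    (T2 : measurableType d2) (R : realType) (P : probability T1 R)
    (Q : probability T2 R) (X : T1 -> S) (Y : T2 -> S) (F : S -> R) :
  measurable_fun setT X -> measurable_fun setT Y ->
  (forall B, measurable B -> P (X @^-1` B) = Q (Y @^-1` B)) ->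
  measurable_fun setT F -> \int[P]_w F (X w) = \int[Q]_w F (Y w).
Proof.
move=> mX mY XY mF; apply: (congr1 fine).
by apply: (eq_law_integral mX mY XY (F := EFin \o F)); exact/measurable_EFinP.
Qed.

Section uniform_pair.
Context {R : realType}.
Local Notation U := (@unif R).

Let mlin (a b : R) : measurable_fun [set: measurableTypeR R] (fun x : R => a * x + b).
Proof. exact: measurable_affine. Qed.

Lemma unif_mean_le (f : R -> R) (K : R) :
  bounded_measurable (f : measurableTypeR R -> R) -> 0 <= K ->
  (forall x, 0 <= x <= 1 -> `|f x| <= K) -> `|\int[U]_x f x| <= K.
Proof.
move=> bf K0 fK; have [mf [M fM]] := bf.
have iU := bounded_measurable_integrable U bf.
rewrite (le_trans (le_normr_Rintegral _ iU))// -lee_fin -EFin_Rintegral; last first.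
  exact: integrable_norm.
have mn : measurable_fun [set: R] (fun x => `|f x|%:E).
  by apply/measurable_EFinP; exact: measurableT_comp.
have n0 x : (0 <= `|f x|%:E)%E by rewrite lee_fin.
rewrite (integral_uniform _ mn n0).
have -> : ((1 - 0)^-1 = 1 :> R)%R by rewrite subr0 invr1.
rewrite mul1e.
have le1 : (\int[lebesgue_measure]_(x in `[0%R, 1%R]) `|f x|%:E <=
    \int[lebesgue_measure]_(x in `[0%R, 1%R]) (cst K%:E) x)%E.
  by apply: ge0_le_integral => //; apply: measurable_funTS; exact: mn.
apply: (le_trans le1).
rewrite le_eqVlt; apply/orP; left; apply/eqP.
transitivity (K%:E * lebesgue_measure (`[0%R, 1%R]%classic : set R))%E.
  exact: integral_cst.
by rewrite lebesgue_measure_itv/= lte_fin ltr01 -EFinD subr0 mule1.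
Qed.

Let C (t th : R) := \int[U]_x cos (t * x + th).
Let S (t th : R) := \int[U]_x sin (t * x + th).

Let C_near t th : `|C t th - cos th| <= `|t|.
Proof.
rewrite /C -[X in _ - X](Rintegral_probability_cst U) -RintegralB//; last 2 first.
- exact: (bounded_measurable_integrable U (bounded_measurable_cos (mlin t th))).
- exact: finite_measure_integrable_cst.
apply: unif_mean_le => //.
  apply: bounded_measurableB; last exact: bounded_measurable_cst.
  exact: (bounded_measurable_cos (mlin t th)).
move=> x /andP[x0 x1]; rewrite (le_trans (cos_lipschitz _ _))// addrK normrM.
by rewrite (ger0_norm x0) ler_piMr.
Qed.

Let SE t th : S t th = C t (th - pi / 2).
Proof. by apply: eq_Rintegral => x _; rewrite addrA cosBpihalf. Qed.

Let C_double t th : C t th = (C (t / 2) th + C (t / 2) (th + t / 2)) / 2.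
Proof.
have h := @mean_doubling R (fun c x => cos (t / 2 * x + (c * (t / 2) + th)))
  (fun c => bounded_measurable_cos (mlin _ _)).
transitivity (\int[U]_x cos (t / 2 * doubling x + (bit x * (t / 2) + th))).
  by apply: eq_Rintegral => x _; congr cos; rewrite /doubling; field.
rewrite h /C; congr ((_ + _) / 2); apply: eq_Rintegral => x _; congr cos; ring.
Qed.

Let me01 : measurable_fun [set: measurableTypeR R] (@even_digits R) := measurable_even_digits.
Let mo01 : measurable_fun [set: measurableTypeR R] (@odd_digits R).
Proof.
by apply: (measurableT_comp measurable_even_digits); exact: measurable_doubling.
Qed.

Let A (t1 t2 th : R) := \int[U]_x cos (t1 * even_digits x + t2 * odd_digits x + th).

Let mA t1 t2 th : measurable_fun [set: measurableTypeR R]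
  (fun x => t1 * even_digits x + t2 * odd_digits x + th).
Proof.
by apply: measurable_funD => //; apply: measurable_funD; exact: measurable_funM.
Qed.

Let A_rec t1 t2 th : A t1 t2 th = (A t2 (t1 / 2) th + A t2 (t1 / 2) (th + t1 / 2)) / 2.
Proof.
have h := @mean_doubling R (fun c x =>
   cos (t2 * even_digits x + t1 / 2 * odd_digits x + (c * (t1 / 2) + th)))
  (fun c => bounded_measurable_cos (mA _ _ _)).
transitivity (\int[U]_x cos (t2 * even_digits (doubling x) +
    t1 / 2 * odd_digits (doubling x) + (bit x * (t1 / 2) + th))).
  apply: eq_Rintegral => x _; congr cos.
  by rewrite even_odd_digits /odd_digits; field.
rewrite h /A; congr ((_ + _) / 2); apply: eq_Rintegral => x _; congr cos; ring.
Qed.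

Let A_near t1 t2 th : `|A t1 t2 th - cos th| <= `|t1| + `|t2|.
Proof.
have bA := bounded_measurable_cos (mA t1 t2 th).
rewrite /A -[X in _ - X](Rintegral_probability_cst U) -RintegralB//; last 2 first.
- exact: bounded_measurable_integrable.
- exact: finite_measure_integrable_cst.
apply: norm_Rintegral_bound.
  by have [] := bounded_measurableB bA (bounded_measurable_cst _ (cos th)).
move=> x; rewrite (le_trans (cos_lipschitz _ _))// addrK.
have /andP[e0 e1] := even_digits01 x; have /andP[p0 p1] := even_digits01 (doubling x).
by rewrite (le_trans (ler_normD _ _))// lerD// normrM ler_piMr// ger0_norm.
Qed.

Let UU := prod_probability U U.

Let mean_UU_cos (a b : measurableTypeR R -> R) : measurable_fun setT a ->
  measurable_fun setT b ->
  \int[UU]_z cos (a z.1 + b z.2) =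
  (\int[U]_x cos (a x)) * (\int[U]_x cos (b x)) -
  (\int[U]_x sin (a x)) * (\int[U]_x sin (b x)).
Proof.
move=> ma mb; have bca := bounded_measurable_cos ma.
have bsa := bounded_measurable_sin ma.
have bcb := bounded_measurable_cos mb; have bsb := bounded_measurable_sin mb.
rewrite -!mean_prod_mul//.
have lift1 (f : measurableTypeR R -> R) : bounded_measurable f ->
    bounded_measurable (fun z : measurableTypeR R * measurableTypeR R => f z.1).
  move=> [mf [K fK]]; split; last by exists K => z; exact: fK.
  by apply: measurableT_comp => //; exact: measurable_fst.
have lift2 (f : measurableTypeR R -> R) : bounded_measurable f ->
    bounded_measurable (fun z : measurableTypeR R * measurableTypeR R => f z.2).
  move=> [mf [K fK]]; split; last by exists K => z; exact: fK.
  by apply: measurableT_comp => //; exact: measurable_snd.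
under eq_Rintegral do rewrite cosD.
rewrite RintegralB//.
- exact: (bounded_measurable_integrable UU (bounded_measurableM (lift1 _ bca) (lift2 _ bcb))).
- exact: (bounded_measurable_integrable UU (bounded_measurableM (lift1 _ bsa) (lift2 _ bsb))).
Qed.

Let B (t1 t2 th : R) := \int[UU]_z cos (t1 * z.1 + t2 * z.2 + th).

Let B_E t1 t2 th th' : B t1 t2 (th + th') = C t1 th * C t2 th' - S t1 th * S t2 th'.
Proof.
rewrite -(mean_UU_cos (mlin t1 th) (mlin t2 th')).
by apply: eq_Rintegral => z _; congr cos; ring.
Qed.

Let B_rec t1 t2 th : B t1 t2 th = (B t2 (t1 / 2) th + B t2 (t1 / 2) (th + t1 / 2)) / 2.
Proof.
rewrite -[in LHS](add0r th) -[in B t2 (t1 / 2) th](addr0 th) !B_E !SE.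
rewrite (C_double t1 0) (C_double t1 (0 - pi / 2)) !add0r.
rewrite [t1 / 2 - pi / 2]addrC; ring.
Qed.

Let B_near t1 t2 th : `|B t1 t2 th - cos th| <= 2 * (`|t1| + `|t2|).
Proof.
rewrite -(add0r th) B_E !SE add0r.
have h1 := C_near t1 0; have h2 := C_near t1 (0 - pi / 2); have h3 := C_near t2 th.
rewrite cos0 in h1; rewrite cosBpihalf sin0 subr0 in h2.
have c1 a b : `|C a b| <= 1.
  apply: norm_Rintegral_bound; last by move=> x; exact: cos_max.
  by have [] := bounded_measurable_cos (mlin a b).
have -> : C t1 0 * C t2 th - C t1 (0 - pi / 2) * C t2 (th - pi / 2) - cos th =
    (C t1 0 - 1) * C t2 th - C t1 (0 - pi / 2) * C t2 (th - pi / 2) + (C t2 th - cos th).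
  by ring.
have n1 : `|(C t1 0 - 1) * C t2 th| <= `|t1|.
  by rewrite normrM (le_trans _ h1)// ler_piMr.
have n2 : `|C t1 (0 - pi / 2) * C t2 (th - pi / 2)| <= `|t1|.
  by rewrite normrM (le_trans _ h2)// ler_piMr.
rewrite (le_trans (ler_normD _ _))//.
have := ler_normB ((C t1 0 - 1) * C t2 th) (C t1 (0 - pi / 2) * C t2 (th - pi / 2)).
by have := normr_ge0 t2; lra.
Qed.

(** Both characteristic functions satisfy the recursion obtained by extracting
    the leading digit, which halves one of the frequencies; at frequency 0 they
    are continuous and agree. *)
Let AB m t1 t2 th : `|A t1 t2 th - B t1 t2 th| <= 3 * (`|t1| + `|t2|) / 2 ^+ m.
Proof.
elim: m t1 t2 th => [|m IHm] t1 t2 th.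
  have -> : A t1 t2 th - B t1 t2 th = (A t1 t2 th - cos th) - (B t1 t2 th - cos th) by ring.
  rewrite expr0 divr1 (le_trans (ler_normB _ _))//.
  by have := A_near t1 t2 th; have := B_near t1 t2 th; lra.
have half th' : `|A t2 (t1 / 2) th' - B t2 (t1 / 2) th'| <=
    3 * (`|t1| + `|t2|) / 2 ^+ m.+1.
  have e : 3 * (`|t1| + `|t2|) / 2 ^+ m.+1 = 3 * (`|t1 / 2| + `|t2 / 2|) / 2 ^+ m.
    rewrite !normrM (ger0_norm (_ : 0 <= 2^-1))// exprS invfM; ring.
  rewrite A_rec B_rec e.
  have := IHm (t1 / 2) (t2 / 2) th'; have := IHm (t1 / 2) (t2 / 2) (th' + t2 / 2).
  set x1 := A _ _ _; set y1 := B _ _ _; set x2 := A _ _ _; set y2 := B _ _ _ => h1 h2.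
  have -> : (x2 + x1) / 2 - (y2 + y1) / 2 = ((x2 - y2) + (x1 - y1)) / 2 by ring.
  rewrite normrM (ger0_norm (_ : 0 <= 2^-1))//.
  by have := ler_normD (x2 - y2) (x1 - y1); lra.
rewrite A_rec B_rec.
have := half th; have := half (th + t1 / 2).
set x1 := A _ _ _; set y1 := B _ _ _; set x2 := A _ _ _; set y2 := B _ _ _ => h1 h2.
have -> : (x2 + x1) / 2 - (y2 + y1) / 2 = ((x2 - y2) + (x1 - y1)) / 2 by ring.
rewrite normrM (ger0_norm (_ : 0 <= 2^-1))//.
by have := ler_normD (x2 - y2) (x1 - y1); lra.
Qed.

Let AB_eq t1 t2 th : A t1 t2 th = B t1 t2 th.
Proof.
apply/eqP; rewrite -subr_eq0 -normr_le0.
have L : 3 * (`|t1| + `|t2|) / 2 ^+ m @[m --> \oo] --> (0 : R).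
  rewrite -[X in _ --> X](mulr0 (3 * (`|t1| + `|t2|))); apply: cvgM; first exact: cvg_cst.
  under eq_cvg do rewrite -exprVn; apply: cvg_expr.
  by rewrite ger0_norm// invf_lt1// ltr1n.
apply: (ler_cvg_to (cvg_cst `|A t1 t2 th - B t1 t2 th|) L).
by apply: nearW => m; exact: AB.
Qed.

(** The pair of even_digits and odd_digits has the characteristic function,
    hence the law, of a pair of independent uniform variables. *)
Theorem mean_even_odd (f g : R -> R) :
  bounded_measurable (f : measurableTypeR R -> R) ->
  bounded_measurable (g : measurableTypeR R -> R) ->
  \int[U]_x (f (even_digits x) * g (odd_digits x)) =
  (\int[U]_x f x) * \int[U]_x g x.
Proof.
move=> bf bg; rewrite -mean_prod_mul//.
pose Z (i : 'I_2) (x : measurableTypeR R) : R :=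
  if i == ord0 then even_digits x else odd_digits x.
pose Y (i : 'I_2) (z : measurableTypeR R * measurableTypeR R) : R :=
  if i == ord0 then z.1 else z.2.
have mZ i : measurable_fun setT (Z i) by rewrite /Z; case: (i == ord0); [exact: me01|exact: mo01].
have mY i : measurable_fun setT (Y i).
  by rewrite /Y; case: (i == ord0); [exact: measurable_fst|exact: measurable_snd].
have ZY (t : 'I_2 -> R) th : \int[U]_w cos (\sum_i t i * Z i w + th) =
    \int[UU]_w cos (\sum_i t i * Y i w + th).
  under eq_Rintegral do rewrite !big_ord_recl big_ord0 addr0.
  under [RHS]eq_Rintegral do rewrite !big_ord_recl big_ord0 addr0.
  exact: AB_eq.
have ZC i h : 1 - \int[U]_w cos (h * Z i w) <= 1 * h ^+ 2.
  have mhZ : measurable_fun setT (fun w => h * Z i w) by exact: measurable_funM.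
  have bc := bounded_measurable_cos mhZ.
  rewrite -{1}(Rintegral_probability_cst U 1) -RintegralB//; last 2 first.
  - exact: finite_measure_integrable_cst.
  - exact: bounded_measurable_integrable.
  rewrite (le_trans (ler_norm _))// norm_Rintegral_bound//.
    by have [] := bounded_measurableB (bounded_measurable_cst _ 1) bc.
  move=> w; rewrite ger0_norm ?cosB1_ge0// (le_trans (cosB1_le_sqr _))//.
  have /andP[z0 z1] : 0 <= Z i w <= 1.
    by rewrite /Z; case: ifP => _; exact: even_digits01.
  have z2 : Z i w ^+ 2 <= 1 by rewrite exprn_ile1.
  rewrite exprMn mul1r; set zz := _ ^+ 2 in z2 *; set hh := h ^+ 2.
  by have := sqr_ge0 h; rewrite -/hh => hh0; nra.
have law := tuple_law_unique mZ mY ZY ZC.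
pose F (x : 2.-tuple R) := f (tnth x ord0) * g (tnth x (lift ord0 ord0)).
have lift (k : R -> R) (i : 'I_2) : bounded_measurable (k : measurableTypeR R -> R) ->
    bounded_measurable (fun x : 2.-tuple R => k (tnth x i)).
  move=> [mk [K kK]]; split; last by exists K => x; exact: kK.
  by apply: measurableT_comp => //; exact: measurable_tnth.
have bF : bounded_measurable F by apply: bounded_measurableM; exact: lift.
have := eq_law_mean (measurable_mktuple mZ) (measurable_mktuple mY) law bF.1.
rewrite /F; under eq_Rintegral do rewrite !tnth_mktuple.
by move=> ->; apply: eq_Rintegral => z _; rewrite !tnth_mktuple.
Qed.

End uniform_pair.

(** * A sequence of independent normal variables *)

Section normal_quantile.
Context {R : realType}.
Local Notation N := (normal_prob 0 1 : probability (measurableTypeR R) R).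

Let measurable_idR : measurable_fun [set: measurableTypeR R] (id : R -> R).
Proof. exact: measurable_id. Qed.

Let id_rv : {RV N >-> R} := mfun_of measurable_idR.

Let Phi (x : R) : R := fine (N `]-oo, x]%classic).

Let PhiE x : (Phi x)%:E = cdf id_rv x.
Proof. by rewrite /Phi fineK// fin_num_measure. Qed.

Let Phi01 x : 0 <= Phi x <= 1.
Proof. by rewrite -!lee_fin PhiE cdf_ge0 cdf_le1. Qed.

Let Phi_nd : {homo Phi : x y / x <= y}.
Proof. by move=> x y xy; rewrite -lee_fin !PhiE; exact: cdf_nondecreasing. Qed.

(** The generalized inverse of the normal distribution function. *)
Definition normal_quantile (u : R) : R :=
  if 0 < u < 1 then inf [set x | u <= Phi x] else 0.

Let quantile_set u : 0 < u < 1 -> has_inf [set x | u <= Phi x].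
Proof.
move=> /andP[u0 u1]; split.
  have := cvg_cdfy1 id_rv => /fine_cvg /cvgrPdist_lt /(_ (1 - u)).
  rewrite subr_gt0 => /(_ u1) h; near (+oo%R : set_system R) => x.
  exists x => /=; have : `|1 - Phi x| < 1 - u by near: x; exact: h.
  by have /andP[p0 p1] := Phi01 x; rewrite ger0_norm ?subr_ge0//; lra.
have := cvg_cdfNy0 id_rv => /fine_cvg /cvgrPdist_lt /(_ u u0) h.
near (-oo%R : set_system R) => x.
exists x => y /= uy; rewrite leNgt; apply/negP => yx.
have : `|0 - Phi x| < u by near: x; exact: h.
have /andP[p0 p1] := Phi01 x; rewrite sub0r normrN ger0_norm//.
by have := Phi_nd (ltW yx); lra.
Unshelve. all: by end_near. Qed.

(** Right continuity of the distribution function makes this an equivalence. *)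
Let quantile_gt u x : 0 < u < 1 -> (x < normal_quantile u) = (Phi x < u).
Proof.
move=> u01; rewrite /normal_quantile u01; have [ne lb] := quantile_set u01.
apply/idP/idP => [xq|pu].
  by rewrite ltNge; apply/negP => ux; move: xq; rewrite ltNge ge_inf.
have rc := @cdf_right_continuous _ _ _ _ id_rv x.
have : Phi y @[y --> x^'+] --> Phi x.
  by apply: fine_cvg; rewrite PhiE; exact: rc.
move=> /cvgrPdist_lt /(_ (u - Phi x)); rewrite subr_gt0 => /(_ pu) h.
near x^'+ => y.
have xy : x < y by near: y; exact: nbhs_right_gt.
apply: (lt_le_trans xy); apply: lb_le_inf => // z /= uz.
rewrite leNgt; apply/negP => zy.
have : `|Phi x - Phi y| < u - Phi x by near: y; exact: h.
rewrite distrC ger0_norm ?subr_ge0; last by apply: Phi_nd; exact: ltW.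
by have := Phi_nd (ltW zy); lra.
Unshelve. all: by end_near. Qed.

Let preimage_quantile x :
  normal_quantile @^-1` `]x, +oo[ `&` `]0, 1[ = `]Phi x, 1[%classic.
Proof.
apply/seteqP; split => u /=; rewrite !in_itv/= ?andbT.
  by move=> [xu u01]; rewrite -(quantile_gt x u01) xu; case/andP: u01.
move=> /andP[pu u1]; have /andP[p0 _] := Phi01 x.
have u01 : 0 < u < 1 by rewrite u1 (le_lt_trans p0 pu).
by rewrite quantile_gt.
Qed.

Lemma measurable_normal_quantile :
  measurable_fun [set: measurableTypeR R] (normal_quantile : _ -> measurableTypeR R).
Proof.
apply: (measurability (@RGenOInfty.G R)); first exact: RGenOInfty.measurableE.
move=> _ [_ [x ->] <-]; rewrite setTI.
have mI : measurable (`]0, 1[%classic : set (measurableTypeR R)) by exact: measurable_itv.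
have out u : ~ (0 < u < 1) -> normal_quantile u = 0.
  by rewrite /normal_quantile; case: ifP.
have [x0|x0] := ltP x 0.
  rewrite (_ : _ @^-1` _ = `]Phi x, 1[%classic `|` ~` `]0, 1[%classic).
    apply: measurableU; last exact: measurableC.
    exact: measurable_itv.
  rewrite -preimage_quantile; apply/seteqP; split => u /=.
    move=> h; have [u01|u01] := pselect (`]0, 1[%classic u); [left|right] => //.
  move=> [[]//|]; rewrite !in_itv/= andbT => u01.
  by rewrite out.
rewrite (_ : _ @^-1` _ = `]Phi x, 1[%classic); first exact: measurable_itv.
rewrite -preimage_quantile; apply/seteqP; split => u /=; last by move=> [].
move=> h; split => //; apply: contrapT; rewrite in_itv/= => u01.
by move: h; rewrite in_itv/= andbT out// ltNge x0.
Qed.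

Let unif_itv (A : set R) (a : R) : measurable A -> A `&` `]0, 1[ = `]a, 1[%classic ->
  0 <= a <= 1 -> unif A = (1 - a)%:E.
Proof.
move=> mA Aa /andP[a0 a1].
have mind : measurable_fun [set: R] (fun x => (\1_A x : R)%:E).
  exact/measurable_EFinP.
have ind0 x : (0 <= (\1_A x : R)%:E)%E by rewrite lee_fin.
transitivity (\int[unif]_x (\1_A x)%:E)%E.
  by rewrite (@integral_indic _ (measurableTypeR R) _ unif setT)// setIT.
rewrite (integral_uniform _ mind ind0).
have -> : ((1 - 0)^-1 = 1 :> R)%R by rewrite subr0 invr1.
rewrite mul1e (@integral_itv_bndoo _ 0 1 _ true false)//; last first.
  exact: measurable_funS mind.
rewrite integral_indic//.
transitivity (@lebesgue_measure R `]a, 1[%classic); first by rewrite -Aa.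
rewrite lebesgue_measure_itv/= lte_fin.
case: ltP => // a1'; congr EFin; lra.
Qed.

Lemma normal_quantile_law (B : set R) : measurable B ->
  unif (normal_quantile @^-1` B) = N B.
Proof.
move=> mB.
pose m : {measure set (measurableTypeR R) -> \bar R} :=
  image_measure unif measurable_normal_quantile.
pose g (k : nat) : set R := `]- k%:R, +oo[%classic.
apply: (@measure_unique _ R (measurableTypeR R) (@RGenOInfty.G R) g _ _ _ _ m N) => //.
- exact: RGenOInfty.measurableE.
- move=> _ _ [x ->] [y ->]; exists (Num.max x y).
  apply/seteqP; split => z /=; rewrite !in_itv/= !andbT gt_max.
    by move=> [-> ->].
  by move=> /andP[].
- by move=> k; exists (- k%:R).
- apply/seteqP; split => // x _; exists (Num.truncn `|x|).+1 => //=.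
  rewrite /g/= in_itv/= andbT ltrNl.
  have /andP[_ h] := truncn_itv (normr_ge0 x).
  by rewrite (le_lt_trans _ h)// -normrN ler_norm.
- move=> _ [x ->].
  have mA : measurable (normal_quantile @^-1` `]x, +oo[%classic : set R).
    by rewrite -[X in measurable X]setTI; apply: measurable_normal_quantile.
  rewrite /m /image_measure/= /pushforward (unif_itv mA (preimage_quantile x) (Phi01 x)).
  rewrite -setCitvl probability_setC//.
  by rewrite EFinB /Phi fineK// fin_num_measure.
- move=> k; apply: (le_lt_trans (probability_le1 _ _)); last exact: ltry.
  rewrite -[X in measurable X]setTI; apply: measurable_normal_quantile => //.
  exact: measurable_itv.
Qed.

Lemma mean_normal_quantile (f : R -> R) :
  bounded_measurable (f : measurableTypeR R -> R) ->
  \int[unif]_x f (normal_quantile x) = \int[N]_x f x.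
Proof.
move=> [mf _].
apply: (eq_law_mean (S := measurableTypeR R) (X := normal_quantile : measurableTypeR R ->
  measurableTypeR R)
  (Y := id : measurableTypeR R -> measurableTypeR R)) => //.
- exact: measurable_normal_quantile.
- by move=> B mB; rewrite normal_quantile_law.
Qed.

End normal_quantile.

Section gaussian_sequence.
Context {R : realType}.
Local Notation U := (@unif R).

(** Each term takes the even digits of what its predecessors have left. *)
Fixpoint uniform_seq (l : nat) (x : R) : R :=
  if l is l'.+1 then uniform_seq l' (odd_digits x) else even_digits x.

Let mo : measurable_fun [set: measurableTypeR R] (odd_digits : R -> measurableTypeR R).
Proof.
by apply: (measurableT_comp measurable_even_digits); exact: measurable_doubling.
Qed.

Let mu l : measurable_fun [set: measurableTypeR R] (uniform_seq l : R -> measurableTypeR R).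
Proof.
elim: l => [|l IHl]; first exact: measurable_even_digits.
exact: (measurableT_comp IHl mo).
Qed.

Definition gaussian_seq (l : nat) (x : R) : R := normal_quantile (uniform_seq l x).

Lemma measurable_gaussian_seq l :
  measurable_fun [set: measurableTypeR R] (gaussian_seq l : R -> R).
Proof. exact: (measurableT_comp measurable_normal_quantile (mu l)). Qed.

Let comb (t : nat -> R) (L : nat) (x : R) := \sum_(l < L) t l * gaussian_seq l x.

Let mcomb t L th : measurable_fun [set: measurableTypeR R] (fun x => comb t L x + th).
Proof.
apply: measurable_funD => //; apply: measurable_sum => l.
by apply: measurable_funM => //; exact: measurable_gaussian_seq.
Qed.

Lemma mean_cos_gaussian_seq (t : nat -> R) (L : nat) (th : R) :
  \int[U]_x cos (\sum_(l < L) t l * gaussian_seq l x + th) =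
  expR (- ((\sum_(l < L) t l ^+ 2) / 2)) * cos th.
Proof.
elim: L t th => [|L IHL] t th.
  under eq_Rintegral do rewrite big_ord0 add0r.
  by rewrite Rintegral_probability_cst big_ord0 mul0r oppr0 expR0 mul1r.
pose t' l := t l.+1; pose q := @normal_quantile R.
have mq : measurable_fun [set: measurableTypeR R] (fun x => t 0%N * q x).
  by apply: measurable_funM => //; exact: measurable_normal_quantile.
have mtx : measurable_fun [set: measurableTypeR R] (fun x : R => t 0%N * x).
  exact: measurable_funM.
have E (x : R) : \sum_(l < L.+1) t l * gaussian_seq l x + th =
    t 0%N * q (even_digits x) + (comb t' L (odd_digits x) + th).
  by rewrite big_ord_recl -addrA.
under eq_Rintegral do rewrite E cosD.
have bc := bounded_measurable_cos mq; have bs := bounded_measurable_sin mq.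
have bc' := bounded_measurable_cos (mcomb t' L th).
have bs' := bounded_measurable_sin (mcomb t' L th).
have comp (f g : measurableTypeR R -> R) : bounded_measurable f -> bounded_measurable g ->
    bounded_measurable (fun x : measurableTypeR R => f (even_digits x) * g (odd_digits x)).
  move=> [mf [K fK]] [mg [M gM]]; apply: bounded_measurableM.
    split; last by exists K => x; exact: fK.
    exact: (measurableT_comp mf measurable_even_digits).
  split; last by exists M => x; exact: gM.
  exact: (measurableT_comp mg mo).
rewrite RintegralB//; last 2 first.
- exact: (bounded_measurable_integrable U (comp _ _ bc bc')).
- exact: (bounded_measurable_integrable U (comp _ _ bs bs')).
rewrite (mean_even_odd bc bc') (mean_even_odd bs bs').
rewrite (mean_normal_quantile (bounded_measurable_cos mtx)).
rewrite (mean_normal_quantile (bounded_measurable_sin mtx)).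
rewrite normal_sin mul0r subr0 /comb IHL normal_characteristic.
by rewrite big_ord_recl mulrA -expRD -opprD -mulrDl.
Qed.

End gaussian_sequence.

(** * Cholesky factorization of an infinite kernel *)

Section cholesky.
Context {R : realType}.
Implicit Types (K : nat -> nat -> R) (c d : nat -> R).

Definition psd K := (forall i j, K i j = K j i) /\
  forall n c, 0 <= \sum_(i < n) \sum_(j < n) c i * c j * K i j.

Let sum_delta n j (f : nat -> R) : (j < n)%N ->
  \sum_(i < n) (i == j :> nat)%:R * f i = f j.
Proof.
move=> jn; rewrite (bigD1 (Ordinal jn))//= eqxx mul1r big1 ?addr0//.
move=> i; rewrite -val_eqE/= => /negbTE ->; exact: mul0r.
Qed.

(** The quadratic form at c + t e_j. *)
Let psd_perturb K n c j t : psd K -> (j < n)%N ->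
  0 <= \sum_(i < n) \sum_(k < n) c i * c k * K i k +
       2 * t * \sum_(i < n) c i * K i j + t ^+ 2 * K j j.
Proof.
move=> [Ksym Kpos] jn.
have := Kpos n (fun i => c i + t * (i == j)%:R).
rewrite (_ : \sum_(i < n) _ = \sum_(i < n) \sum_(k < n) c i * c k * K i k +
    2 * t * \sum_(i < n) c i * K i j + t ^+ 2 * K j j)//.
have inner (i : 'I_n) : \sum_(k < n) (c i + t * (i == j :> nat)%:R) *
      (c k + t * (k == j :> nat)%:R) * K i k =
    \sum_(k < n) c i * c k * K i k + t * (c i * K i j) +
    (i == j :> nat)%:R * (t * (\sum_(k < n) c k * K i k) + t ^+ 2 * K i j).
  under eq_bigr => k _.
    rewrite (_ : _ * _ * _ = c i * c k * K i k +
      (k == j :> nat)%:R * (t * (c i * K i k)) +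
      (i == j :> nat)%:R * t * (c k * K i k) +
      (k == j :> nat)%:R * ((i == j :> nat)%:R * t ^+ 2 * K i k)); last by ring.
    over.
  rewrite !big_split/= -mulr_sumr.
  rewrite (sum_delta (fun k => t * (c i * K i k)) jn).
  by rewrite (sum_delta (fun k => (i == j :> nat)%:R * t ^+ 2 * K i k) jn); ring.
under eq_bigr do rewrite inner.
rewrite !big_split/= -mulr_sumr.
rewrite (sum_delta (fun i => t * (\sum_(k < n) c k * K i k) + t ^+ 2 * K i j) jn).
rewrite (_ : \sum_(k < n) c k * K j k = \sum_(i < n) c i * K i j); first ring.
by apply: eq_bigr => k _; rewrite Ksym.
Qed.

Lemma psd_diag K j : psd K -> 0 <= K j j.
Proof.
move=> Kp; have := psd_perturb (fun=> 0) 1 Kp (ltnSn j).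
by rewrite !big1 ?mulr0 ?add0r ?expr1n ?mul1r// => i _;
  rewrite ?mul0r// big1// => k _; rewrite !mul0r.
Qed.

(** Otherwise the quadratic form at e_k + t e_j would be affine in t and take
    negative values. *)
Lemma psd_diag0 K j k : psd K -> K j j = 0 -> K k j = 0.
Proof.
move=> Kp Kjj.
pose n := maxn k.+1 j.+1.
have kn : (k < n)%N by rewrite leq_max ltnSn.
have jn : (j < n)%N by rewrite leq_max ltnSn orbT.
pose c i : R := (i == k)%:R.
have h t : 0 <= K k k + 2 * t * K k j.
  have := psd_perturb c t Kp jn; rewrite Kjj mulr0 addr0 /c.
  rewrite (sum_delta (fun i => K i j) kn).
  under eq_bigr do under eq_bigr do rewrite -mulrA.
  under eq_bigr do rewrite -mulr_sumr.
  rewrite (sum_delta (fun i => \sum_(l < n) (l == k :> nat)%:R * K i l) kn).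
  by rewrite (sum_delta (fun l => K k l) kn).
apply/eqP; apply: contraT => Kkj.
have := h (- (K k k + 1) / (2 * K k j)).
have -> : K k k + 2 * (- (K k k + 1) / (2 * K k j)) * K k j = - 1 by field.
by rewrite lerNr oppr0 ler10.
Qed.

(** The Schur complement.  When K j j = 0 the division by zero leaves K as it is,
    which is right as row j then vanishes by psd_diag0. *)
Definition schur j K (k l : nat) : R := K k l - K k j * K l j / K j j.

(** The quadratic form of the Schur complement at c is the minimum over t of
    that of K at c + t e_j. *)
Lemma psd_schur j K : psd K -> psd (schur j K).
Proof.
move=> Kp; have [Ksym Kpos] := Kp; split.
  by move=> k l; rewrite /schur Ksym [K k j * _]mulrC.
move=> n c.
pose N := maxn n j.+1; have jN : (j < N)%N by rewrite leq_max ltnSn orbT.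
have nN : (n <= N)%N by rewrite leq_maxl.
pose c' i := if (i < n)%N then c i else 0.
have ext (f : nat -> R) : \sum_(i < N) c' i * f i = \sum_(i < n) c i * f i.
  rewrite (big_ord_widen _ (fun i => c i * f i) nN) [RHS]big_mkcond/=.
  by apply: eq_bigr => i _; rewrite /c'; case: ifP => // _; rewrite mul0r.
pose b := \sum_(i < n) c i * K i j.
have := psd_perturb c' (- b / K j j) Kp jN.
rewrite (ext (K^~ j)) -/b.
have -> : \sum_(i < N) \sum_(k < N) c' i * c' k * K i k =
    \sum_(i < n) \sum_(k < n) c i * c k * K i k.
  under eq_bigr do under eq_bigr do rewrite -mulrA.
  under eq_bigr do rewrite -mulr_sumr ext.
  rewrite (ext (fun i => \sum_(k < n) c k * K i k)); apply: eq_bigr => i _; rewrite mulr_sumr.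
  by apply: eq_bigr => k _; rewrite mulrA.
have -> : \sum_(i < n) \sum_(k < n) c i * c k * schur j K i k =
    \sum_(i < n) \sum_(k < n) c i * c k * K i k - b ^+ 2 / K j j.
  rewrite expr2 {1}/b mulr_suml mulr_suml -sumrB; apply: eq_bigr => i _.
  rewrite mulr_sumr mulr_suml -sumrB; apply: eq_bigr => k _.
  by rewrite /schur; ring.
have [->|Kjj] := eqVneq (K j j) 0.
  rewrite invr0 !mulr0. by rewrite mul0r subr0 !addr0.
by congr (0 <= _); field.
Qed.

Fixpoint cholesky_rest K (m : nat) : nat -> nat -> R :=
  if m is m'.+1 then schur m' (cholesky_rest K m') else K.

Lemma psd_cholesky_rest K m : psd K -> psd (cholesky_rest K m).
Proof. by move=> Kp; elim: m => //= m IHm; exact: psd_schur. Qed.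

Definition cholesky K (k j : nat) : R :=
  cholesky_rest K j k j / Num.sqrt (cholesky_rest K j j j).

(** Each elimination step removes from K a kernel of rank one. *)
Lemma cholesky_restE K m k l : psd K ->
  K k l = \sum_(j < m) cholesky K k j * cholesky K l j + cholesky_rest K m k l.
Proof.
move=> Kp; elim: m => [|m IHm]; first by rewrite big_ord0 add0r.
rewrite {1}IHm big_ord_recr/= -addrA; congr (_ + _).
rewrite /cholesky /schur; set S := cholesky_rest K m.
rewrite mulrACA -invfM -expr2 sqr_sqrtr; last exact/psd_diag/psd_cholesky_rest.
by rewrite addrC subrK.
Qed.

Lemma cholesky_rest_eq0 K m k l : psd K -> (k < m)%N -> cholesky_rest K m k l = 0.
Proof.
move=> Kp; elim: m l => // m IHm l; rewrite ltnS leq_eqVlt => /orP[/eqP ->|km].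
  rewrite /= /schur; have Sp := psd_cholesky_rest m Kp.
  set S := cholesky_rest K m in Sp *.
  have [S0|S0] := eqVneq (S m m) 0.
    by rewrite Sp.1 (psd_diag0 l Sp S0) S0 mul0r mul0r subrr.
  by rewrite Sp.1; field.
by rewrite /= /schur !IHm// !mul0r subrr.
Qed.

Lemma cholesky_upper K k j : psd K -> (k < j)%N -> cholesky K k j = 0.
Proof. by move=> Kp kj; rewrite /cholesky cholesky_rest_eq0// mul0r. Qed.

Lemma choleskyE K m k l : psd K -> (k < m)%N ->
  K k l = \sum_(j < m) cholesky K k j * cholesky K l j.
Proof. by move=> Kp km; rewrite (cholesky_restE m k l Kp) cholesky_rest_eq0// addr0. Qed.

End cholesky.

(** * Gaussian processes with a given stationary covariance *)

Section gaussian_process.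
Context {R : realType} (K : nat -> nat -> R).
Hypothesis Kpsd : psd K.
Hypothesis Kstat : forall k l h, K (k + h)%N (l + h)%N = K k l.
Local Notation U := (@unif R).
Local Notation N := (normal_prob 0 1 : probability (measurableTypeR R) R).

Definition gaussian_coord (k : nat) (x : R) : R :=
  \sum_(l < k.+1) cholesky K k l * gaussian_seq l x.

Lemma measurable_gaussian_coord k :
  measurable_fun [set: measurableTypeR R] (gaussian_coord k : R -> R).
Proof.
apply: measurable_sum => l; apply: measurable_funM => //.
exact: measurable_gaussian_seq.
Qed.

Definition gaussian_rv (k : nat) : {RV U >-> R} := mfun_of (measurable_gaussian_coord k).

Definition covform n (ks : 'I_n -> nat) (c : 'I_n -> R) : R :=
  \sum_(i < n) \sum_(j < n) c i * c j * K (ks i) (ks j).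

Let gaussian_coord_widen k M x : (k < M)%N ->
  gaussian_coord k x = \sum_(l < M) cholesky K k l * gaussian_seq l x.
Proof.
move=> kM; rewrite /gaussian_coord.
rewrite (big_ord_widen _ (fun l => cholesky K k l * gaussian_seq l x) kM).
rewrite big_mkcond/=; apply: eq_bigr => l _; case: ltnP => // kl.
by rewrite cholesky_upper// mul0r.
Qed.

Let coord_bound n (ks : 'I_n -> nat) i : (ks i < \max_(j < n) (ks j).+1)%N.
Proof. exact: (leq_bigmax_cond (F := fun i => (ks i).+1)). Qed.

Let covform_sqr n (ks : 'I_n -> nat) (c : 'I_n -> R) :
  covform ks c = \sum_(l < \max_(j < n) (ks j).+1)
    (\sum_(i < n) c i * cholesky K (ks i) l) ^+ 2.
Proof.
rewrite /covform; under eq_bigr do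
  under eq_bigr do rewrite (choleskyE _ Kpsd (coord_bound ks _)) mulr_sumr.
under eq_bigr do rewrite exchange_big/=.
rewrite exchange_big/=; apply: eq_bigr => l _.
rewrite expr2 mulr_suml; apply: eq_bigr => i _.
by rewrite mulr_sumr; apply: eq_bigr => j _; rewrite mulrACA.
Qed.

(** Every coordinate is a combination of the same independent normal variables,
    with the rows of the Cholesky factor as coefficients. *)
Lemma mean_cos_gaussian n (ks : 'I_n -> nat) (c : 'I_n -> R) (th : R) :
  \int[U]_x cos (\sum_(i < n) c i * gaussian_rv (ks i) x + th) =
  expR (- (covform ks c / 2)) * cos th.
Proof.
pose t l := \sum_(i < n) c i * cholesky K (ks i) l.
rewrite covform_sqr -(mean_cos_gaussian_seq t).
apply: eq_Rintegral => x _; congr (cos (_ + _)).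
under eq_bigr do rewrite /= (gaussian_coord_widen _ (coord_bound ks _)) mulr_sumr.
rewrite exchange_big/=; apply: eq_bigr => l _.
by rewrite /t mulr_suml; apply: eq_bigr => i _; rewrite mulrA.
Qed.

Lemma covform_ge0 n (ks : 'I_n -> nat) (c : 'I_n -> R) : 0 <= covform ks c.
Proof. by rewrite covform_sqr sumr_ge0// => l _; exact: sqr_ge0. Qed.

Let expRN_le (x : R) : 1 - expR (- x) <= x.
Proof. by rewrite lerBlDl -lerBlDr; exact: expR_ge1Dx. Qed.

Let mW n (ks : 'I_n -> nat) (c : 'I_n -> R) :
  measurable_fun setT (fun x : measurableTypeR R => \sum_(i < n) c i * gaussian_rv (ks i) x).
Proof. by apply: measurable_sum => i; apply: measurable_funM. Qed.

Let mscale (s : R) : measurable_fun [set: measurableTypeR R] (fun x : R => s * x).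
Proof. exact: measurable_funM. Qed.

(** Identifying the combination with a multiple of a standard normal variable
    covers the degenerate case and gives all its moments. *)
Lemma gaussian_combination_law n (ks : 'I_n -> nat) (c : 'I_n -> R) (B : set R) :
  measurable B ->
  U [set x | B (\sum_(i < n) c i * gaussian_rv (ks i) x)] =
  N [set x | B (Num.sqrt (covform ks c) * x)].
Proof.
move=> mB; set v := covform ks c; have v0 : 0 <= v := covform_ge0 ks c.
pose W x := \sum_(i < n) c i * gaussian_rv (ks i) x.
have cosW (t th : R) : \int[U]_x cos (t * W x + th) = expR (- (v * t ^+ 2 / 2)) * cos th.
  transitivity (\int[U]_x cos (\sum_(i < n) (t * c i) * gaussian_rv (ks i) x + th)).
    apply: eq_Rintegral => x _; congr (cos (_ + _)); rewrite mulr_sumr.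
    by apply: eq_bigr => i _; rewrite mulrA.
  rewrite mean_cos_gaussian; congr (expR (- (_ / 2)) * _).
  rewrite /v /covform mulr_suml; apply: eq_bigr => i _.
  by rewrite mulr_suml; apply: eq_bigr => j _; ring.
pose C : set (1.-tuple R) := [set u | B (tnth u ord0)].
have mC : measurable C.
  by rewrite -[C]setTI; apply: (@measurable_tnth _ R 1 ord0).
have := @tuple_law_unique R 1 _ _ U _ _ N (fun=> W)
  (fun _ (x : measurableTypeR R) => Num.sqrt v * x) (v / 2).
move=> /(_ (fun=> mW ks c) (fun=> mscale _)).
have -> : [set x | B (W x)] = [set x | C [tuple W x | i < 1]].
  by apply/seteqP; split => x /=; rewrite /C/= tnth_mktuple.
have -> : [set x | B (Num.sqrt v * x)] = [set x | C [tuple Num.sqrt v * x | i < 1]].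
  by apply/seteqP; split => x /=; rewrite /C/= tnth_mktuple.
apply => //.
  move=> t th.
  under eq_Rintegral do rewrite big_ord1.
  under [RHS]eq_Rintegral do rewrite big_ord1 mulrA.
  by rewrite cosW normal_cos_shift normal_characteristic exprMn sqr_sqrtr// [_ * v]mulrC.
move=> _ h; under eq_Rintegral do rewrite -[_ * _]addr0.
rewrite cosW cos0 mulr1; apply: le_trans (expRN_le _) _.
by rewrite [X in _ <= X]mulrAC.
Qed.

Lemma gaussian_process_rv : gaussian_process gaussian_rv.
Proof.
move=> n ks c; exists 0, (Num.sqrt (covform ks c)) => B mB.
rewrite gaussian_combination_law// /gaussian_law.
set s := Num.sqrt _; have s0 : 0 <= s by exact: sqrtr_ge0.
case: eqVneq => [->|sn0].
  rewrite diracE; case: (boolP (0 \in B)) => B0.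
    rewrite (_ : [set x | _] = setT) ?probability_setT//.
    by apply/seteqP; split => x //= _; rewrite mul0r; exact: set_mem.
  rewrite (_ : [set x | _] = set0) ?measure0//.
  by apply/seteqP; split => x //=; rewrite mul0r => /mem_set; rewrite (negbTE B0).
have sgt0 : 0 < s by rewrite lt_def sn0.
have mind : measurable_fun [set: R] (fun x => (\1_B x : R)%:E).
  exact/measurable_EFinP.
have ind0 (x : R) : (0 <= (\1_B x : R)%:E)%E by rewrite lee_fin.
have := ge0_integral_normal_scale sgt0 mind ind0.
rewrite integral_indic// setIT => ->.
transitivity (\int[N]_x (\1_[set x | B (s * x)] x)%:E)%E => //.
rewrite integral_indic ?setIT//.
by rewrite -[X in measurable X]setTI; exact: mscale.
Qed.

Lemma stationary_process_rv : stationary_process gaussian_rv.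
Proof.
move=> n ks h B mB.
apply: (tuple_law_unique (C := K 0%N 0%N / 2) (Z := fun i => gaussian_rv (tnth ks i + h)%N)
  (Y := fun i => gaussian_rv (tnth ks i))) => //.
  move=> t th; rewrite (mean_cos_gaussian (fun i => (tnth ks i + h)%N)).
  rewrite (mean_cos_gaussian (tnth ks)); congr (expR (- (_ / 2)) * _).
  by apply: eq_bigr => i _; apply: eq_bigr => j _; rewrite Kstat.
move=> i u; have := mean_cos_gaussian (fun _ : 'I_1 => (tnth ks i + h)%N) (fun=> u) 0.
under eq_Rintegral do rewrite big_ord1 addr0.
move=> ->; rewrite cos0 mulr1 /covform !big_ord1; apply: le_trans (expRN_le _) _.
rewrite -[X in K X X]add0n Kstat -expr2.
by rewrite [leLHS](_ : _ = K 0 0 / 2 * u ^+ 2)//; ring.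
Qed.

Let integral_combination n (ks : 'I_n -> nat) (c : 'I_n -> R) (F : R -> \bar R) :
  measurable_fun setT F ->
  (\int[U]_x F (\sum_(i < n) c i * gaussian_rv (ks i) x)%R =
   \int[N]_x F (Num.sqrt (covform ks c) * x)%R)%E.
Proof.
move=> mF.
apply: (eq_law_integral (S := R) (X := fun x : measurableTypeR R => \sum_(i < n) c i *
  gaussian_rv (ks i) x)
  (Y := fun x : measurableTypeR R => Num.sqrt (covform ks c) * x)) => // B mB.
exact: gaussian_combination_law.
Qed.

Lemma expectation_gaussian_rv k : ('E_U[gaussian_rv k] = 0)%E.
Proof.
rewrite unlock.
have mE : measurable_fun setT (EFin : R -> \bar R) by exact/measurable_EFinP.
have := @integral_combination 1 (fun=> k) (fun=> 1) EFin mE.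
under eq_integral do rewrite big_ord1 mul1r.
move=> ->; set s := Num.sqrt _.
have [iN _] := @normal_second_moment R.
have iid : N.-integrable setT (fun x : R => x%:E).
  by apply: (integrable_of_sqr _ iN); exact: measurable_id.
under eq_integral do rewrite EFinM.
rewrite integralZl// EFin_Rintegral//.
rewrite (_ : Rintegral _ _ _ = 0) ?mule0//.
by apply: integral_normal_odd.
Qed.

Lemma gaussian_second_moment n (ks : 'I_n -> nat) (c : 'I_n -> R) :
  U.-integrable setT (fun x => ((\sum_(i < n) c i * gaussian_rv (ks i) x) ^+ 2)%:E) /\
  \int[U]_x (\sum_(i < n) c i * gaussian_rv (ks i) x) ^+ 2 = covform ks c.
Proof.
have msq : measurable_fun setT (fun x : R => (x ^+ 2)%:E).
  by apply/measurable_EFinP; exact: measurable_funX.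
have [iN EN] := @normal_second_moment R.
have E : (\int[U]_x ((\sum_(i < n) c i * gaussian_rv (ks i) x) ^+ 2)%:E = (covform ks c)%:E)%E.
  rewrite (integral_combination ks c msq).
  under eq_integral do rewrite exprMn sqr_sqrtr ?covform_ge0// EFinM.
  by rewrite integralZl// EFin_Rintegral// EN mule1.
split; last by rewrite /Rintegral E.
apply/integrableP; split.
  by apply/measurable_EFinP; apply: measurable_funX; exact: mW.
under eq_integral do rewrite gee0_abs ?lee_fin ?sqr_ge0//.
by rewrite E ltry.
Qed.

(** Polarization of gaussian_second_moment. *)
Lemma expectation_gaussian_rvM k l :
  ('E_U[fun w => gaussian_rv k w * gaussian_rv l w]%R = (K k l)%:E)%E.
Proof.
rewrite unlock.
pose ks (i : 'I_2) := if i == ord0 then k else l.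
pose c (e : R) (i : 'I_2) := if i == ord0 then 1 else e.
have W e x : \sum_(i < 2) c e i * gaussian_rv (ks i) x =
    gaussian_rv k x + e * gaussian_rv l x.
  by rewrite !big_ord_recl big_ord0 /c /ks/= mul1r addr0.
have cov e : covform ks (c e) = K k k + 2 * e * K k l + e ^+ 2 * K l l.
  rewrite /covform !big_ord_recl !big_ord0 /c /ks/=.
  by rewrite (Kpsd.1 l k); ring.
have [i1 E1] := gaussian_second_moment ks (c 1).
have [i2 E2] := gaussian_second_moment ks (c (- 1)).
under eq_integral => x _.
  rewrite (_ : gaussian_rv k x * gaussian_rv l x =
    4^-1 * ((\sum_(i < 2) c 1 i * gaussian_rv (ks i) x) ^+ 2 -
     (\sum_(i < 2) c (-1) i * gaussian_rv (ks i) x) ^+ 2)); last by rewrite !W; field.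
  rewrite EFinM EFinB.
  over.
rewrite integralZl//; last exact: integrableB.
rewrite integralB// !EFin_Rintegral// E1 E2 !cov -EFinB -EFinM.
by congr EFin; field.
Qed.

End gaussian_process.

(** * Integrals against conditional probabilities *)

Section nonneg_integrals.
Context d (T : measurableType d) (R : realType) (P : probability T R).
Implicit Types (A B : set T) (f g : T -> R) (Z : T -> nat).

Definition nonneg_measurable f := measurable_fun setT f /\ forall w, 0 <= f w.

Lemma nonneg_measurableD f g : nonneg_measurable f -> nonneg_measurable g ->
  nonneg_measurable (fun w => f w + g w).
Proof.
by move=> [mf f0] [mg g0]; split=> [|w]; [exact: measurable_funD|exact: addr_ge0].
Qed.

Lemma nonneg_measurableM f g : nonneg_measurable f -> nonneg_measurable g ->
  nonneg_measurable (fun w => f w * g w).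
Proof.
by move=> [mf f0] [mg g0]; split=> [|w]; [exact: measurable_funM|exact: mulr_ge0].
Qed.

Lemma nonneg_measurable_nat Z (u : nat -> R) : measurable_fun setT Z ->
  (forall n, 0 <= u n) -> nonneg_measurable (fun w => u (Z w)).
Proof. by move=> mZ u0; split => //; exact: (measurableT_comp _ mZ). Qed.

Lemma measurable_preimage1 Z n : measurable_fun setT Z -> measurable (Z @^-1` [set n]).
Proof. by move=> mZ; rewrite -[X in measurable X]setTI; exact: mZ. Qed.

Lemma integral_addr A f g : measurable A ->
  nonneg_measurable f -> nonneg_measurable g ->
  (\int[P]_(w in A) (f w + g w)%:E =
   \int[P]_(w in A) (f w)%:E + \int[P]_(w in A) (g w)%:E)%E.
Proof.
move=> mA [mf f0] [mg g0].
under eq_integral do rewrite EFinD.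
rewrite ge0_integralD//.
- by move=> w _; rewrite lee_fin.
- by apply/measurable_EFinP; exact: measurable_funTS.
- by move=> w _; rewrite lee_fin.
- by apply/measurable_EFinP; exact: measurable_funTS.
Qed.

Lemma integral_decomposition A Z f : measurable A -> measurable_fun setT Z ->
  nonneg_measurable f ->
  (\int[P]_(w in A) (f w)%:E =
   \sum_(n <oo) \int[P]_(w in A `&` Z @^-1` [set n]) (f w)%:E)%E.
Proof.
move=> mA mZ [mf f0].
rewrite [in LHS](_ : A = \bigcup_n (A `&` Z @^-1` [set n])); last first.
  by apply/seteqP; split => [w Aw|w [n _ []]//]; exists (Z w).
rewrite ge0_integral_bigcup//.
- by move=> n; apply: measurableI => //; exact: measurable_preimage1.
- by apply/measurable_EFinP; exact: measurable_funTS.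
- by move=> w _; rewrite lee_fin.
apply/trivIsetP => i j _ _ ij; apply/seteqP; split => // w [[_ /= wi] [_ /= wj]].
by move: ij; rewrite -wi -wj eqxx.
Qed.

(** The definition of a conditional probability is the case where g is an
    indicator; in general, the image under alpha of the law restricted to A has
    density q with respect to the law of alpha. *)
Lemma cond_prob_integral (alpha : T -> R) A (q g : R -> R) :
  measurable_fun setT alpha -> measurable A ->
  measurable_fun setT q -> (forall w, 0 <= q (alpha w)) ->
  measurable_fun setT g -> (forall w, 0 <= g (alpha w)) ->
  is_cond_prob P alpha A (fun w => q (alpha w)) ->
  (\int[P]_(w in A) (g (alpha w))%:E = \int[P]_w (g (alpha w) * q (alpha w))%:E)%E.
Proof.
move=> ma mA mq q0 mg g0 [_ Aq].
(* q and g are only known to be nonnegative on the range of alpha. *)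
pose q' x : R := `|q x|; pose g' x : R := `|g x|.
have mq' : measurable_fun setT q' by apply: measurableT_comp => //.
have mg' : measurable_fun setT (fun x => (g' x)%:E).
  by apply/measurable_EFinP; apply: measurableT_comp.
have g'0 x : (0 <= (g' x)%:E)%E by rewrite lee_fin /g'.
have mind : measurable_fun setT (\1_A : T -> R) by [].
have rE B : measurable B -> mrestr P mA B = (\int[P]_(w in B) (\1_A w)%:E)%E.
  by move=> mB; rewrite integral_indic// /mrestr setIC.
pose nu := image_measure (mrestr P mA) ma.
have nuE (B : set R) : measurable B -> nu B = (\int[image_measure P ma]_(x in B) (q' x)%:E)%E.
  move=> mB; have maB : measurable (alpha @^-1` B).
    by rewrite -[X in measurable X]setTI; exact: (ma measurableT _ mB).
  transitivity (mrestr P mA (alpha @^-1` B)) => //.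
  rewrite rE// Aq; last by exists B => //; rewrite setTI.
  rewrite ge0_integral_pushforward//.
    by apply: eq_integral => w _ /=; rewrite /q' ger0_norm.
  by apply/measurable_EFinP; exact: measurable_funTS.
  by move=> x _; rewrite lee_fin /q'.
have e1 := ge0_integral_density (fun x => normr_ge0 (q x)) mq' nuE mg' g'0.
transitivity (\int[nu]_x (g' x)%:E)%E.
  rewrite ge0_integral_pushforward//.
  have ind0 w : 0 <= (\1_A : T -> R) w by [].
  have mga : measurable_fun setT ((fun x => (g' x)%:E) \o alpha).
    exact: measurableT_comp.
  rewrite preimage_setT (ge0_integral_density ind0 mind rE mga) => [|w]; last exact: g'0.
  rewrite [LHS]integral_mkcond; apply: eq_integral => w _.
  rewrite patchE indicE /g'/=; case: ifP => _; rewrite ?mulr1 ?mule1 ?mule0//.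
  by rewrite ger0_norm.
rewrite e1 ge0_integral_pushforward//.
- by rewrite preimage_setT; apply: eq_integral => w _ /=; rewrite /g' /q' !ger0_norm ?EFinM.
- by apply: emeasurable_funM => //; exact/measurable_EFinP.
- by move=> x _; apply: mule_ge0 => //; rewrite lee_fin.
Qed.

End nonneg_integrals.

(** * Events of the past *)

Section past_events.
Context d (T : measurableType d) (R : realType) (P : probability T R).
Variables (alpha : T -> R) (I : choiceType) (U : I -> T -> nat) (q : I -> nat -> R -> R).
Hypothesis malpha : measurable_fun setT alpha.
Hypothesis mU : forall i, measurable_fun setT (U i).
Hypothesis mq : forall i n, measurable_fun setT (q i n).
Hypothesis q0 : forall i n w, 0 <= q i n (alpha w).
Hypothesis indep : cond_independent P alpha U.
Hypothesis qP : forall i n, is_cond_prob P alpha (U i @^-1` [set n]) (fun w => q i n (alpha w)).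
Implicit Types (A B : set T) (g : R -> R) (D : set I) (s : seq I).

Definition weight g := measurable_fun setT g /\ forall w, 0 <= g (alpha w).

Lemma weight_nonneg g : weight g -> nonneg_measurable (fun w => g (alpha w)).
Proof. by move=> [mg g0]; split => //; exact: measurableT_comp. Qed.

Lemma weightM g h : weight g -> weight h -> weight (fun a => g a * h a).
Proof.
by move=> [mg g0] [mh h0]; split=> [|w]; [exact: measurable_funM|exact: mulr_ge0].
Qed.

Lemma weightD g h : weight g -> weight h -> weight (fun a => g a + h a).
Proof.
by move=> [mg g0] [mh h0]; split=> [|w]; [exact: measurable_funD|exact: addr_ge0].
Qed.

Lemma weight_cst c : 0 <= c -> weight (fun=> c).
Proof. by []. Qed.

Lemma weight_q i n : weight (q i n).
Proof. by split. Qed.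

Lemma weight_prod s (v : I -> nat) : weight (fun a => \prod_(i <- s) q i (v i) a).
Proof.
elim: s => [|i s IHs]; first by under eq_fun do rewrite big_nil; exact: weight_cst.
by under eq_fun do rewrite big_cons; apply: weightM => //; exact: weight_q.
Qed.

Definition cylinder s (v : I -> nat) : set T :=
  \big[setI/setT]_(i <- s) (U i @^-1` [set v i]).

Lemma measurable_cylinder s v : measurable (cylinder s v).
Proof. by apply: bigsetI_measurable => i _; exact: measurable_preimage1. Qed.

(** Given alpha, the variables with index outside D are distributed
    independently of A: this is what being determined by D and alpha is used
    for, and unlike the latter it is directly stable under the operations by
    which the process is built. *)
Definition past D A := measurable A /\ forall g s v, weight g -> uniq s ->
  (forall i, i \in s -> ~ D i) ->
  (\int[P]_(w in A `&` cylinder s v) (g (alpha w))%:E =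
   \int[P]_(w in A) (g (alpha w) * \prod_(i <- s) q i (v i) (alpha w))%:E)%E.

Lemma past_setT D : past D setT.
Proof.
split=> // g s v [mg g0] us _; rewrite setTI.
have [mp p0] := weight_prod s v.
apply: (cond_prob_integral malpha (measurable_cylinder s v) mp p0 mg g0).
apply: (indep (B := fun i => [set v i]) (p := fun i w => q i (v i) (alpha w)) us).
by move=> i _; split => //; exact: qP.
Qed.

Lemma past_set0 D : past D set0.
Proof. by split=> // g s v _ _ _; rewrite set0I !integral_set0. Qed.

Lemma pastS D D' A : D `<=` D' -> past D A -> past D' A.
Proof.
move=> DD' [mA pA]; split => // g s v wg us sD; apply: pA => // i si Di.
exact: (sD i si (DD' _ Di)).
Qed.

Lemma past_integral1 D A i n g : past D A -> ~ D i -> weight g ->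
  (\int[P]_(w in A `&` U i @^-1` [set n]) (g (alpha w))%:E =
   \int[P]_(w in A) (g (alpha w) * q i n (alpha w))%:E)%E.
Proof.
move=> [_ pA] Di wg; have := pA g [:: i] (fun=> n) wg isT.
rewrite /cylinder big_seq1 => ->; last by move=> j; rewrite inE => /eqP ->.
by apply: eq_integral => w _; rewrite big_seq1.
Qed.

(** Apply the definition once with i added to the list of later indices, and
    once with i alone and the remaining factors moved into the weight. *)
Lemma past_setI D A i n : past D A -> ~ D i ->
  past (D `|` [set i]) (A `&` U i @^-1` [set n]).
Proof.
move=> pA Di; have [mA pA'] := pA; split.
  by apply: measurableI => //; exact: measurable_preimage1.
move=> g s v wg us sD.
have is_ : i \notin s by apply/negP => /sD; apply; right.
pose v' j := if j == i then n else v j.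
have v's j : j \in s -> v' j = v j.
  by rewrite /v' => js; case: eqP => // ji; move: is_; rewrite -ji js.
have -> : A `&` U i @^-1` [set n] `&` cylinder s v = A `&` cylinder (i :: s) v'.
  rewrite /cylinder big_cons {1}/v' eqxx -setIA; congr (_ `&` (_ `&` _)).
  by rewrite big_seq [RHS]big_seq; apply: eq_bigr => j js; rewrite v's.
rewrite pA'//; last 2 first.
- by rewrite /= is_.
- move=> j; rewrite inE => /predU1P[->//|js] Dj; exact: (sD j js (or_introl Dj)).
rewrite (past_integral1 n pA Di (weightM wg (weight_prod s v))).
apply: eq_integral => w _; rewrite big_cons {1}/v' eqxx [X in (_ * X)%:E]mulrC mulrA.
congr ((_ * _ * _)%:E).
by rewrite big_seq [RHS]big_seq; apply: eq_bigr => j js; rewrite v's.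
Qed.

Lemma past_bigcup D (A : nat -> set T) : (forall k, past D (A k)) ->
  trivIset setT A -> past D (\bigcup_k A k).
Proof.
move=> pA tA; have mA k := (pA k).1; split; first exact: bigcupT_measurable.
move=> g s v wg us sD.
have [mg g0] := weight_nonneg wg; have [mp p0] := weight_nonneg (weight_prod s v).
rewrite setI_bigcupl !ge0_integral_bigcup//.
- by apply: eq_eseriesr => k _; apply: (pA k).2.
- by apply/measurable_EFinP; apply: measurable_funTS; exact: measurable_funM.
- by move=> w _; rewrite lee_fin mulr_ge0.
- by move=> k; apply: measurableI => //; exact: measurable_cylinder.
- by apply/measurable_EFinP; exact: measurable_funTS.
- by move=> w _; rewrite lee_fin.
- exact: trivIset_setIr.
Qed.

Section mean.
Variables (D : set I) (B : set T) (Y : T -> nat) (i : I).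
Hypothesis mB : measurable B.
Hypothesis mY : measurable_fun setT Y.
Hypothesis pY : forall r, past D (B `&` Y @^-1` [set r]).
Hypothesis Di : ~ D i.

(** Decompose along the values of Y and of U i: on each piece the definition of
    the past replaces the event U i = n by its conditional probability, and the
    sum over n is F. *)
Lemma past_mean (u f : nat -> R) (F g : R -> R) :
  weight g -> weight F -> (forall n, 0 <= u n) -> (forall n, 0 <= f n) ->
  (forall w, \sum_(n <oo) (f n * q i n (alpha w))%:E = (F (alpha w))%:E)%E ->
  (\int[P]_(w in B) (g (alpha w) * u (Y w) * f (U i w))%:E =
   \int[P]_(w in B) (g (alpha w) * u (Y w) * F (alpha w))%:E)%E.
Proof.
move=> wg wF u0 f0 FE.
have ng := weight_nonneg wg; have nF := weight_nonneg wF.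
have nu := nonneg_measurable_nat mY u0; have nf := nonneg_measurable_nat (mU i) f0.
rewrite (integral_decomposition P mB mY (nonneg_measurableM (nonneg_measurableM ng nu) nf)).
rewrite (integral_decomposition P mB mY (nonneg_measurableM (nonneg_measurableM ng nu) nF)).
apply: eq_eseriesr => r _; have mBr := (pY r).1.
rewrite (integral_decomposition P mBr (mU i) (nonneg_measurableM (nonneg_measurableM ng nu) nf)).
have wgr n : weight (fun a => g a * u r * f n).
  by apply: weightM; [apply: weightM => //|]; exact: weight_cst.
transitivity (\sum_(n <oo) \int[P]_(w in B `&` Y @^-1` [set r])
    (g (alpha w) * u r * f n * q i n (alpha w))%:E)%E.
  apply: eq_eseriesr => n _; rewrite -(past_integral1 n (pY r) Di (wgr n)).
  by apply: eq_integral => w; rewrite inE => -[[_ /= ->] /= ->].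
rewrite -integral_nneseries//.
- apply: eq_integral => w; rewrite inE => -[_ /= ->].
  rewrite EFinM -FE -nneseriesZl.
    by apply: eq_eseriesr => n _; rewrite -EFinM mulrA.
  by move=> n _; rewrite lee_fin mulr_ge0.
- move=> n; apply/measurable_EFinP; apply: measurable_funTS.
  exact: (weight_nonneg (weightM (wgr n) (weight_q i n))).1.
- move=> n w _; rewrite lee_fin.
  exact: (weight_nonneg (weightM (wgr n) (weight_q i n))).2.
Qed.

(** Decompose along the value of Y. *)
Lemma past_add r : past (D `|` [set i]) (B `&` (fun w => Y w + U i w)%N @^-1` [set r]).
Proof.
pose A a := if (a <= r)%N then B `&` Y @^-1` [set a] `&` U i @^-1` [set (r - a)%N] else set0.
have -> : B `&` (fun w => Y w + U i w)%N @^-1` [set r] = \bigcup_a A a.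
  apply/seteqP; split => [w [Bw /= Yr]|w [a _]].
    by exists (Y w) => //; rewrite /A -Yr leq_addr addKn.
  by rewrite /A; case: leqP => // ar [[Bw /= Ya] /= Ua]; split => //=; rewrite Ya Ua subnKC.
apply: past_bigcup.
  by move=> a; rewrite /A; case: leqP => _; [exact: past_setI|exact: past_set0].
apply/trivIsetP => a b _ _ ab; apply/seteqP; split => // w [].
rewrite /A; case: leqP => // _ [[_ /= wa] _]; case: leqP => // _ [[_ /= wb] _].
by move: ab; rewrite -wa -wb eqxx.
Qed.

Variables (F1 F2 : R -> R).
Hypothesis wF1 : weight F1.
Hypothesis wF2 : weight F2.
Hypothesis F1E : forall w, (\sum_(n <oo) (n%:R * q i n (alpha w))%:E = (F1 (alpha w))%:E)%E.
Hypothesis F2E : forall w, (\sum_(n <oo) (n%:R ^+ 2 * q i n (alpha w))%:E = (F2 (alpha w))%:E)%E.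

Let nat0 (n : nat) : 0 <= n%:R :> R. Proof. by []. Qed.
Let sqr0 (n : nat) : 0 <= n%:R ^+ 2 :> R. Proof. exact: sqr_ge0. Qed.

Lemma past_mean_add g : weight g ->
  (\int[P]_(w in B) (g (alpha w) * (Y w + U i w)%:R)%:E =
   \int[P]_(w in B) (g (alpha w) * (Y w)%:R)%:E +
   \int[P]_(w in B) (g (alpha w) * F1 (alpha w))%:E)%E.
Proof.
move=> wg; have ng := weight_nonneg wg.
have nY := nonneg_measurable_nat mY nat0; have nU := nonneg_measurable_nat (mU i) nat0.
under eq_integral do rewrite natrD mulrDr.
rewrite (integral_addr P mB (nonneg_measurableM ng nY) (nonneg_measurableM ng nU)).
congr (_ + _)%E.
have := past_mean wg wF1 (fun=> ler01) nat0 F1E.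
by under eq_integral do rewrite mulr1; under [X in _ = X -> _]eq_integral do rewrite mulr1.
Qed.

Lemma past_mean_sqr_add g : weight g ->
  (\int[P]_(w in B) (g (alpha w) * (Y w + U i w)%:R ^+ 2)%:E =
   \int[P]_(w in B) (g (alpha w) * (Y w)%:R ^+ 2)%:E +
   (\int[P]_(w in B) (g (alpha w) * (2 * F1 (alpha w)) * (Y w)%:R)%:E +
    \int[P]_(w in B) (g (alpha w) * F2 (alpha w))%:E))%E.
Proof.
move=> wg; have ng := weight_nonneg wg.
have nY := nonneg_measurable_nat mY nat0; have nU := nonneg_measurable_nat (mU i) nat0.
have nY2 := nonneg_measurable_nat mY sqr0; have nU2 := nonneg_measurable_nat (mU i) sqr0.
have w2g : weight (fun a => 2 * g a) by apply: weightM => //; exact: weight_cst.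
have n2g := weight_nonneg w2g.
transitivity (\int[P]_(w in B) (g (alpha w) * (Y w)%:R ^+ 2 +
    (2 * g (alpha w) * (Y w)%:R * (U i w)%:R + g (alpha w) * (U i w)%:R ^+ 2))%:E)%E.
  by apply: eq_integral => w _; rewrite natrD; congr EFin; ring.
have n2 := nonneg_measurableM (nonneg_measurableM n2g nY) nU.
have n3 := nonneg_measurableM ng nU2.
rewrite (integral_addr P mB (nonneg_measurableM ng nY2) (nonneg_measurableD n2 n3)).
rewrite (integral_addr P mB n2 n3).
congr (_ + (_ + _))%E.
  rewrite (past_mean w2g wF1 nat0 nat0 F1E).
  by apply: eq_integral => w _; congr EFin; ring.
have := past_mean wg wF2 (fun=> ler01) sqr0 F2E.
by under eq_integral do rewrite mulr1; under [X in _ = X -> _]eq_integral do rewrite mulr1.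
Qed.

End mean.

End past_events.

(** * Moments of Poisson variables and of Bernoulli sums *)

Section discrete_moments.
Context {R : realType}.
Local Open Scope ereal_scope.

Lemma nneseries_shift (f : nat -> \bar R) : (forall k, 0 <= f k) ->
  \sum_(0 <= k <oo) f k = f 0%N + \sum_(0 <= k <oo) f k.+1.
Proof.
move=> f0; rewrite nneseries_recl//; congr (_ + _).
apply/cvg_lim => //; rewrite -(cvg_shiftS (fun n => \sum_(1 <= k < n) f k)).
rewrite (_ : (fun n => _) = fun n => \sum_(0 <= k < n) f k.+1); last first.
  by apply/funext => n; rewrite big_add1.
by apply: is_cvg_nneseries => n _ _; exact: f0.
Qed.

Lemma poisson_sum (r : R) : (0 < r)%R -> \sum_(n <oo) (poisson_pmf r n)%:E = 1.
Proof.
move=> r0; have h : poisson_prob r 0%N [set: nat] = 1 by exact: probability_setT.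
rewrite -h /poisson_prob r0 -nneseries_esumT// => n.
by rewrite lee_fin poisson_pmf_ge0.
Qed.

(** This identity lowers by one the order of a moment. *)
Lemma poisson_pmfS (r : R) n : (0 < r)%R ->
  (n.+1%:R * poisson_pmf r n.+1 = r * poisson_pmf r n)%R.
Proof.
move=> r0; rewrite /poisson_pmf r0 exprS factS natrM invfM.
have n0 : (n.+1%:R != 0 :> R)%R by [].
transitivity (n.+1%:R * n.+1%:R^-1 * (r * (r ^+ n * n`!%:R^-1 * expR (- r))))%R.
  by ring.
by rewrite mulfV// mul1r.
Qed.

Lemma poisson_mean (r : R) : (0 < r)%R ->
  \sum_(n <oo) (n%:R * poisson_pmf r n)%:E = r%:E.
Proof.
move=> r0; have p0 n : (0 <= poisson_pmf r n)%R by exact: poisson_pmf_ge0.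
rewrite nneseries_shift => [|n]; last by rewrite lee_fin mulr_ge0.
rewrite mul0r add0e.
under eq_eseriesr do rewrite poisson_pmfS// EFinM.
by rewrite nneseriesZl ?poisson_sum ?mule1// => n _; rewrite lee_fin.
Qed.

Lemma poisson_second_moment (r : R) : (0 < r)%R ->
  \sum_(n <oo) (n%:R ^+ 2 * poisson_pmf r n)%:E = (r + r ^+ 2)%:E.
Proof.
move=> r0; have p0 n : (0 <= poisson_pmf r n)%R by exact: poisson_pmf_ge0.
rewrite nneseries_shift => [|n]; last by rewrite lee_fin mulr_ge0// sqr_ge0.
rewrite expr0n/= mul0r add0e.
transitivity (\sum_(n <oo) r%:E * ((poisson_pmf r n)%:E + (n%:R * poisson_pmf r n)%:E)).
  apply: eq_eseriesr => n _.
  by rewrite expr2 -mulrA poisson_pmfS// -EFinD -EFinM -natr1; congr EFin; ring.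
rewrite nneseriesZl => [|n _]; last by rewrite -EFinD lee_fin addr_ge0// mulr_ge0.
rewrite nneseriesD; try by move=> n _ _; rewrite lee_fin ?mulr_ge0.
by rewrite poisson_sum// poisson_mean// -EFinD -EFinM; congr EFin; ring.
Qed.

Definition bernoulli_mass (n : nat) (a : R) : R :=
  match n with 0%N => 1 - a | 1%N => a | _ => 0 end%R.

Lemma bernoulli_moment (u : nat -> R) (a : R) : (0 <= a <= 1)%R ->
  (forall n, 0 <= u n)%R -> u 0%N = 0%R -> u 1%N = 1%R ->
  \sum_(n <oo) (u n * bernoulli_mass n a)%:E = a%:E.
Proof.
move=> /andP[a0 a1] u0 u00 u11.
have b0 n : 0 <= (u n * bernoulli_mass n a)%:E.
  by rewrite lee_fin mulr_ge0//; case: n => [|[|n]] //=; rewrite subr_ge0.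
rewrite nneseries_shift// nneseries_shift// u00 u11 mul0r add0e mul1r.
by rewrite eseries0 ?adde0// => n _ _; rewrite mulr0.
Qed.

Lemma measurable_invr : measurable_fun [set: R] (fun x : R => x^-1%R).
Proof.
rewrite (_ : (fun x => _) = (fun x : R => x * (x ^+ 2) `^ (- 1)))%R; last first.
  apply/funext => x; rewrite powR_inv1 ?sqr_ge0//.
  by have [->|x0] := eqVneq x 0%R; [rewrite mul0r invr0|field].
apply: measurable_funM => //.
exact: (measurableT_comp (measurable_powR (- 1)) (measurable_funX 2 (@measurable_id _ R setT))).
Qed.

End discrete_moments.

(** * Binomial thinning *)

Section bernoulli_sums.
Context d (T : measurableType d) (R : realType) (P : probability T R).
Variables (alpha : T -> R) (I : choiceType) (U : I -> T -> nat) (q : I -> nat -> R -> R).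
Hypothesis malpha : measurable_fun setT alpha.
Hypothesis mU : forall i, measurable_fun setT (U i).
Hypothesis mq : forall i n, measurable_fun setT (q i n).
Hypothesis q0 : forall i n w, 0 <= q i n (alpha w).
Variables (D : set I) (B : set T) (x : nat -> I) (e : I).
Hypothesis alpha01 : forall w, 0 <= alpha w <= 1.
Local Notation past := (past P alpha U q).
Local Notation weight := (weight alpha).
Hypothesis pB : past D B.
Hypothesis xD : forall j, ~ D (x j).
Hypothesis x_inj : injective x.
Hypothesis qx : forall j, q (x j) = @bernoulli_mass R.

Let S (m : nat) (w : T) : nat := (\sum_(j < m) U (x j) w)%N.
Let Dm m := D `|` [set i | exists2 j, (j < m)%N & i = x j].

Let mB : measurable B := pB.1.

Lemma measurable_sum_nat m : measurable_fun setT (S m).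
Proof.
elim: m => [|m IHm].
  by rewrite (_ : S 0 = fun=> 0%N)//; apply/funext => w; rewrite /S big_ord0.
rewrite (_ : S m.+1 = fun w => S m w + U (x m) w)%N; last first.
  by apply/funext => w; rewrite /S big_ord_recr.
exact: measurable_fun_addn.
Qed.

Lemma past_sum m r : past (Dm m) (B `&` S m @^-1` [set r]).
Proof.
elim: m r => [|m IHm] r.
  apply: (pastS (D := D)); first by move=> i Di; left.
  case: r => [|r].
    rewrite (_ : _ `&` _ = B)//; apply/seteqP; split => w //=; first by case.
    by move=> Bw; split => //; rewrite /S big_ord0.
  rewrite (_ : _ `&` _ = set0); first exact: past_set0.
  by apply/seteqP; split => w //= -[_]; rewrite /S big_ord0.
have xm : ~ Dm m (x m).
  by move=> [/xD//|[j jm /x_inj mj]]; move: jm; rewrite mj ltnn.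
have := past_add malpha mU mq q0 IHm xm r.
rewrite (_ : S m.+1 = fun w => S m w + U (x m) w)%N; last first.
  by apply/funext => w; rewrite /S big_ord_recr.
apply: pastS => i [[Di|[j jm ->]]|->]; first by left.
  by right; exists j => //; exact: ltnW.
by right; exists m.
Qed.

Let weight_alpha : weight (fun a => a).
Proof. by split=> // w; have /andP[] := alpha01 w. Qed.

Let F1E j w : (\sum_(n <oo) (n%:R * q (x j) n (alpha w))%:E = (alpha w)%:E)%E.
Proof. by rewrite qx; exact: bernoulli_moment. Qed.

Let F2E j w : (\sum_(n <oo) (n%:R ^+ 2 * q (x j) n (alpha w))%:E = (alpha w)%:E)%E.
Proof.
by rewrite qx; apply: bernoulli_moment; rewrite ?expr0n ?expr1n// => n; exact: sqr_ge0.
Qed.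

Let xDm m : ~ Dm m (x m).
Proof. by move=> [/xD//|[j jm /x_inj mj]]; move: jm; rewrite mj ltnn. Qed.

Let nweight (g : R -> R) : weight g -> nonneg_measurable (fun w => g (alpha w)).
Proof. exact: weight_nonneg. Qed.

Lemma mean_bernoulli_sum m g : weight g ->
  (\int[P]_(w in B) (g (alpha w) * (S m w)%:R)%:E =
   \int[P]_(w in B) (g (alpha w) * (m%:R * alpha w))%:E)%E.
Proof.
move=> wg; elim: m => [|m IHm].
  by apply: eq_integral => w _; rewrite /S big_ord0 mul0r.
transitivity (\int[P]_(w in B) (g (alpha w) * (S m w + U (x m) w)%:R)%:E)%E.
  by apply: eq_integral => w _; rewrite /S big_ord_recr.
rewrite (past_mean_add malpha mU mq q0 mB (measurable_sum_nat m) (past_sum m) (xDm (m := m))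
  weight_alpha (F1E m) wg) IHm.
have wma : weight (fun a => m%:R * a) by apply: weightM => //; exact: weight_cst.
rewrite -(integral_addr P mB (nweight (weightM wg wma)) (nweight (weightM wg weight_alpha))).
by apply: eq_integral => w _; rewrite -natr1; congr EFin; ring.
Qed.

Lemma mean_bernoulli_sum_sqr m g : weight g ->
  (\int[P]_(w in B) (g (alpha w) * (S m w)%:R ^+ 2)%:E =
   \int[P]_(w in B) (g (alpha w) * (m%:R * alpha w + (m * m.-1)%:R * alpha w ^+ 2))%:E)%E.
Proof.
move=> wg; elim: m => [|m IHm].
  by apply: eq_integral => w _; rewrite /S big_ord0 mul0n !mul0r expr0n addr0.
transitivity (\int[P]_(w in B) (g (alpha w) * (S m w + U (x m) w)%:R ^+ 2)%:E)%E.
  by apply: eq_integral => w _; rewrite /S big_ord_recr.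
rewrite (past_mean_sqr_add malpha mU mq q0 mB (measurable_sum_nat m) (past_sum m) (xDm (m :=
  m)) weight_alpha weight_alpha (F1E m) (F2E m) wg) IHm.
have w2a : weight (fun a => 2 * a) by apply: weightM => //; exact: weight_cst.
have wma : weight (fun a => m%:R * a) by apply: weightM => //; exact: weight_cst.
have wma2 : weight (fun a => (m * m.-1)%:R * a ^+ 2).
  apply: weightM; first exact: weight_cst.
  by under eq_fun do rewrite expr2; exact: weightM.
rewrite (mean_bernoulli_sum m (weightM wg w2a)).
rewrite -(integral_addr P mB (nweight (weightM (weightM wg w2a) wma)) (nweight (weightM wg
  weight_alpha))).
rewrite -(integral_addr P mB (nweight (weightM wg (weightD wma wma2)))
  (nweight (weightD (weightM (weightM wg w2a) wma) (weightM wg weight_alpha)))).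
apply: eq_integral => w _; congr EFin.
case: m {IHm wma wma2} => [|m]; first by rewrite !mul0n/= !mul0r; ring.
by rewrite !succnK !natrM -!natr1; ring.
Qed.

End bernoulli_sums.

(** * One step of the INAR(1) process *)

Section randomized_INAR1.
Context d (T : measurableType d) (R : realType) (P : probability T R) (lambda : R).
Variables (alpha : {RV P >-> R}) (X0 : {RV P >-> nat})
  (xi : nat -> nat -> {RV P >-> nat}) (eps : nat -> {RV P >-> nat}).
Hypothesis lambda_gt0 : 0 < lambda.
Hypothesis inputsP : randomized_INAR1_inputs lambda alpha X0 xi eps.
Local Notation I := (unit + nat * nat + nat)%type.
Local Notation X := (INAR1 X0 (fun k j => xi k j) (fun k => eps k)).
Local Notation U := (inputs X0 (fun k j => xi k j) (fun k => eps k)).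

Definition input_mass (i : I) (n : nat) (a : R) : R :=
  match i with
  | inl (inl _) => poisson_pmf (lambda / (1 - a)) n
  | inl (inr _) => bernoulli_mass n a
  | inr _ => poisson_pmf lambda n
  end.
Local Notation q := input_mass.
Local Notation weight := (weight alpha).
Local Notation past := (past P alpha U q).

Let alpha01 w : 0 <= alpha w <= 1.
Proof. by have /andP[/ltW -> /ltW ->] := alpha_in01 inputsP w. Qed.

Let malpha : measurable_fun setT alpha. Proof. by []. Qed.

Let mU i : measurable_fun setT (U i).
Proof. by case: i => [[[]|[k j]]|k] /=. Qed.

Let measurable_affine1 : measurable_fun [set: R] (fun a : R => 1 - a).
Proof. exact: measurable_funB. Qed.

Definition cond_mean (a : R) : R := lambda / (1 - a).

Lemma measurable_cond_mean : measurable_fun [set: R] cond_mean.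
Proof.
apply: measurable_funM => //.
exact: (measurableT_comp measurable_invr measurable_affine1).
Qed.

Let mq i n : measurable_fun setT (q i n).
Proof.
case: i => [[[]|[k j]]|k] //=.
  exact: (measurableT_comp (measurable_poisson_pmf n measurableT) measurable_cond_mean).
case: n => [|[|n]] /=; first exact: measurable_affine1.
    exact: measurable_id.
  exact: measurable_cst.
exact: measurable_cst.
Qed.

Let q0 i n w : 0 <= q i n (alpha w).
Proof.
case: i => [[[]|[k j]]|k] //=; try exact: poisson_pmf_ge0.
have /andP[a0 a1] := alpha01 w.
by case: n => [|[|n]] //=; rewrite subr_ge0.
Qed.

(** A Bernoulli variable given alpha takes no value but 0 and 1: the masses of
    these two exhaust the mass of every event determined by alpha. *)
Let xi_ge2 k j n : is_cond_prob P alpha (xi k j @^-1` [set n.+2]) (fun=> 0).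
Proof.
split=> [|A sA]; first exact: measurable_cst.
have mA : measurable A.
  by case: sA => B mB <-; apply: (malpha measurableT).
pose E m := xi k j @^-1` [set m] : set T.
have mE m : measurable (E m) by exact: (measurable_preimage1 _ (mU (inl (inr (k, j))))).
have [_ h1] := xi_bernoulli1 inputsP k j; have [_ h0] := xi_bernoulli0 inputsP k j.
have nI m : nonneg_measurable (\1_(E m) : T -> R) by split => //; exact: measurable_indic.
have na : nonneg_measurable (alpha : T -> R).
  by split => // w; have /andP[] := alpha01 w.
have nb : nonneg_measurable (fun w => 1 - alpha w).
  split; first exact: measurable_funB.
  by move=> w; rewrite subr_ge0; have /andP[] := alpha01 w.
have le : (\int[P]_(w in A) ((\1_(E 1%N) w + \1_(E 0%N) w) + \1_(E n.+2) w)%:E <=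
    \int[P]_(w in A) 1%:E)%E.
  apply: ge0_le_integral => //.
  - apply/measurable_EFinP; apply: measurable_funTS.
    exact: (nonneg_measurableD (nonneg_measurableD (nI _) (nI _)) (nI _)).1.
  - move=> w _; rewrite lee_fin !indicE.
    have eE m : (w \in E m) = (xi k j w == m).
      by apply/idP/eqP => [/set_mem//|e]; apply/mem_set.
    by rewrite !eE; case: (xi k j w) => [|[|m]]; rewrite ?add0r ?addr0//=; case: eqP.
move: le; rewrite (integral_addr P mA (nonneg_measurableD (nI _) (nI _)) (nI _)).
rewrite (integral_addr P mA (nI _) (nI _)) h1// h0//.
rewrite -(integral_addr P mA na nb).
under eq_integral do rewrite addrC subrK.
rewrite integral_cst// mul1e => le.
rewrite [RHS](_ : _ = 0%E); last by rewrite integral0.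
apply/eqP; rewrite eq_le; apply/andP; split; last first.
  by apply: integral_ge0 => w _; rewrite lee_fin; exact: (nI _).2.
have fA : P A \is a fin_num by exact: fin_num_measure.
by move: le; rewrite -[X in (_ <= X)%E]adde0 leeD2lE.
Qed.

Let qP i n : is_cond_prob P alpha (U i @^-1` [set n]) (fun w => q i n (alpha w)).
Proof.
case: i => [[[]|[k j]]|k] /=.
- exact: (X0_poisson inputsP n).
- case: n => [|[|n]] /=;
  [exact: (xi_bernoulli0 inputsP)|exact: (xi_bernoulli1 inputsP)|exact: xi_ge2].
- exact: (eps_poisson inputsP).
Qed.

Let past_setT := past_setT malpha mU mq q0 (inputs_independent inputsP) qP.

Lemma weight_id : weight (fun a => a).
Proof. by split=> // w; have /andP[] := alpha01 w. Qed.

Lemma weightX j : weight (fun a => a ^+ j).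
Proof.
split=> [|w]; first exact: measurable_funX.
by rewrite exprn_ge0//; have /andP[] := alpha01 w.
Qed.

Lemma weight_compl j : weight (fun a => 1 - a ^+ j).
Proof.
split=> [|w]; first by apply: measurable_funB => //; exact: measurable_funX.
by rewrite subr_ge0 exprn_ile1//; have /andP[] := alpha01 w.
Qed.

Lemma weight_cond_mean : weight cond_mean.
Proof.
split=> [|w]; first exact: measurable_cond_mean.
by rewrite divr_ge0 ?subr_ge0 ?(ltW lambda_gt0)//; have /andP[] := alpha01 w.
Qed.

Let nweight (g : R -> R) : weight g -> nonneg_measurable (fun w => g (alpha w)).
Proof. exact: weight_nonneg. Qed.

Definition inputs_until (k : nat) : set I := fun i =>
  match i with
  | inl (inl _) => True
  | inl (inr kj) => (kj.1 < k)%N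
  | inr l => (l < k)%N
  end.

(** Events that may depend on the process up to time k. Fixing the value of X k
    in addition makes the number of summands of the next step constant. *)
Definition past_until (k : nat) (B : set T) : Prop :=
  forall r, past (inputs_until k) (B `&` X k @^-1` [set r]).

Let x (k j : nat) : I := inl (inr (k, j)).
Let S (k m : nat) (w : T) : nat := (\sum_(j < m) U (x k j) w)%N.

Let x_fresh k j : ~ inputs_until k (x k j). Proof. by rewrite /= ltnn. Qed.

Let x_inj k : injective (x k). Proof. by move=> j j' []. Qed.

Let eps_fresh k m :
  ~ (inputs_until k `|` [set i | exists2 j, (j < m)%N & i = x k j]) (inr k).
Proof. by move=> [|[]//]; rewrite /= ltnn. Qed.

Let INAR1S k m w : X k w = m -> X k.+1 w = (S k m w + U (inr k) w)%N.
Proof. by move=> <-. Qed.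

Let past_branch k B m r : past_until k B ->
  past (inputs_until k `|` [set i | exists2 j, (j < m)%N & i = x k j])
    (B `&` X k @^-1` [set m] `&` S k m @^-1` [set r]).
Proof.
move=> pB; apply: (past_sum malpha mU mq q0 (pB m) (x_fresh (k := k)) (@x_inj k)).
Qed.

Lemma past_until0 : past_until 0 setT.
Proof.
move=> r; rewrite /=.
have h : past (set0 `|` [set inl (inl tt)]) (setT `&` U (inl (inl tt)) @^-1` [set r]).
  exact: (past_setI mU mq q0 r (past_setT _)).
by apply: pastS h => i [//|->].
Qed.

Lemma integral_X0 (f : nat -> R) (F g : R -> R) : weight g -> weight F ->
  (forall n, 0 <= f n) ->
  (forall w, \sum_(n <oo) (f n * q (inl (inl tt)) n (alpha w))%:E = (F (alpha w))%:E)%E ->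
  (\int[P]_w (g (alpha w) * f (X0 w))%:E = \int[P]_w (g (alpha w) * F (alpha w))%:E)%E.
Proof.
move=> wg wF f0 FE.
have p0 r : past set0 (setT `&` (fun=> 0%N) @^-1` [set r]).
  case: r => [|r].
    rewrite (_ : _ `&` _ = setT); first exact: past_setT.
    by apply/seteqP; split.
  rewrite (_ : _ `&` _ = set0); first exact: past_set0.
  by apply/seteqP; split => // w [].
have := past_mean malpha mU mq q0 measurableT (measurable_cst 0%N) p0
  (i := inl (inl tt)) (fun h => h) wg wF (fun=> ler01) f0 FE.
by under eq_integral do rewrite mulr1; under [X in _ = X -> _]eq_integral do rewrite mulr1.
Qed.

(** On X_k = m the next value is a sum of a fixed number of new inputs. *)
Lemma past_untilS k B : past_until k B -> past_until k.+1 B.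
Proof.
move=> pB r.
pose A m := B `&` X k @^-1` [set m] `&` (fun w => S k m w + U (inr k) w)%N @^-1` [set r].
have -> : B `&` X k.+1 @^-1` [set r] = \bigcup_m A m.
  apply/seteqP; split => [w [Bw wr]|w [m _] [[Bw wm] wr]].
    by exists (X k w).
  by split => //; exact: etrans (INAR1S wm) wr.
apply: (past_bigcup malpha mU mq q0) => [m|].
  have := past_add malpha mU mq q0 (past_branch m ^~ pB) (eps_fresh (m := m)) r.
  apply: pastS => i [[|[j jm ->]]|->] //=.
  by case: i => [[[]|[k' j]]|k'] //=; exact: ltnW.
apply/trivIsetP => a b _ _ ab; apply/seteqP; split => // w [].
move=> [[_ /= wa] _] [[_ /= wb] _].
by move: ab; rewrite -wa -wb eqxx.
Qed.

Lemma past_until_level k B r : past_until k B -> past_until k (B `&` X k @^-1` [set r]).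
Proof.
move=> pB r'; have [->|rr'] := eqVneq r' r; first by rewrite -setIA setIid; exact: pB.
rewrite (_ : _ `&` _ = set0); first exact: past_set0.
apply/seteqP; split => // w [[_ /= wr] /= wr']; move: rr'.
by rewrite -wr -wr' eqxx.
Qed.

Lemma measurable_INAR1 k : measurable_fun setT (X k).
Proof.
have pT : past_until k setT.
  by elim: k => [|k IHk]; [exact: past_until0|exact: past_untilS].
move=> _ B _; rewrite setTI (_ : _ @^-1` _ = \bigcup_(r in B) X k @^-1` [set r]).
  by apply: bigcup_measurable => r _; rewrite -[X in measurable X]setTI; exact: (pT r).1.
by apply/seteqP; split => [w Bw|w [r Br /= ->]//]; exists (X k w).
Qed.

Lemma past_untilT k : past_until k setT.
Proof. by elim: k => [|k IHk]; [exact: past_until0|exact: past_untilS]. Qed.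

Lemma past_until_add l j B : past_until l B -> past_until (j + l) B.
Proof. by move=> pB; elim: j => //= j IHj; exact: past_untilS. Qed.

Let weightl : weight (fun=> lambda).
Proof. by apply: weight_cst; exact: ltW. Qed.

Let weightl2 : weight (fun=> lambda + lambda ^+ 2).
Proof. by apply: weight_cst; rewrite addr_ge0 ?sqr_ge0 ?ltW. Qed.

Let eps_mean k w : (\sum_(n <oo) (n%:R * q (inr k) n (alpha w))%:E = lambda%:E)%E.
Proof. exact: poisson_mean. Qed.

Let eps_sqr k w :
  (\sum_(n <oo) (n%:R ^+ 2 * q (inr k) n (alpha w))%:E = (lambda + lambda ^+ 2)%:E)%E.
Proof. exact: poisson_second_moment. Qed.

Let mS k m : measurable_fun setT (S k m).
Proof. exact: (measurable_sum_nat mU (x k)). Qed.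

Let nX k : nonneg_measurable (fun w => (X k w)%:R : R).
Proof. exact: (nonneg_measurable_nat (measurable_INAR1 k) (fun n => ler0n _ n)). Qed.

Let nX2 k : nonneg_measurable (fun w => (X k w)%:R ^+ 2 : R).
Proof. exact: (nonneg_measurable_nat (measurable_INAR1 k) (fun n => sqr_ge0 _)). Qed.

(** On X_k = m the next value is a sum of m independent Bernoulli variables
    and of an independent Poisson variable. *)
Lemma integral_INAR1S k B g : measurable B -> past_until k B -> weight g ->
  (\int[P]_(w in B) (g (alpha w) * (X k.+1 w)%:R)%:E =
   \int[P]_(w in B) (g (alpha w) * alpha w * (X k w)%:R + g (alpha w) * lambda)%:E)%E.
Proof.
move=> mB pB wg; have ng := nweight wg; have na := nweight weight_id.
have nl := nweight weightl.
rewrite (integral_decomposition P mB (measurable_INAR1 k) (nonneg_measurableM ng (nX k.+1))).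
rewrite (integral_decomposition P mB (measurable_INAR1 k)
  (nonneg_measurableD (nonneg_measurableM (nonneg_measurableM ng na) (nX k))
    (nonneg_measurableM ng nl))).
apply: eq_eseriesr => m _; have mBm := (pB m).1.
have wma : weight (fun a => m%:R * a) by apply: weightM; [exact: weight_cst|exact: weight_id].
transitivity (\int[P]_(w in B `&` X k @^-1` [set m])
    (g (alpha w) * (S k m w + U (inr k) w)%:R)%:E)%E.
  by apply: eq_integral => w; rewrite inE => -[_ /= wm]; rewrite -(INAR1S wm).
rewrite (past_mean_add malpha mU mq q0 mBm (mS k m) (past_branch m ^~ pB) (eps_fresh (m := m))
  weightl (eps_mean k) wg).
rewrite (mean_bernoulli_sum malpha mU mq q0 alpha01 (pB m) (x_fresh (k := k)) (@x_inj k) _ _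
  wg)//.
rewrite -(integral_addr P mBm (nweight (weightM wg wma)) (nweight (weightM wg weightl))).
by apply: eq_integral => w; rewrite inE => -[_ /= ->]; congr EFin; ring.
Qed.

Lemma integral_INAR1S_sqr k B g : measurable B -> past_until k B -> weight g ->
  (\int[P]_(w in B) (g (alpha w) * (X k.+1 w)%:R ^+ 2)%:E =
   \int[P]_(w in B) (g (alpha w) * alpha w ^+ 2 * (X k w)%:R ^+ 2 +
     g (alpha w) * (alpha w * (1 - alpha w ^+ 1) + 2 * lambda * alpha w) * (X k w)%:R +
     g (alpha w) * (lambda + lambda ^+ 2))%:E)%E.
Proof.
move=> mB pB wg; have ng := nweight wg.
have w2l : weight (fun a => 2 * lambda * a).
  apply: weightM; [apply: weight_cst|exact: weight_id].
  by rewrite mulr_ge0// ltW.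
have w22l : weight (fun=> 2 * lambda) by apply: weight_cst; rewrite mulr_ge0// ltW.
have n1 := nonneg_measurableM (nweight (weightM wg (weightX 2))) (nX2 k).
have n2 := nonneg_measurableM (nweight (weightM wg
  (weightD (weightM weight_id (weight_compl 1)) w2l))) (nX k).
have n3 := nweight (weightM wg weightl2).
rewrite (integral_decomposition P mB (measurable_INAR1 k) (nonneg_measurableM ng (nX2 k.+1))).
rewrite (integral_decomposition P mB (measurable_INAR1 k)
  (nonneg_measurableD (nonneg_measurableD n1 n2) n3)).
apply: eq_eseriesr => m _; have mBm := (pB m).1.
have wma : weight (fun a => m%:R * a) by apply: weightM; [exact: weight_cst|exact: weight_id].
have wma2 : weight (fun a => (m * m.-1)%:R * a ^+ 2).
  by apply: weightM; [exact: weight_cst|exact: weightX].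
transitivity (\int[P]_(w in B `&` X k @^-1` [set m])
    (g (alpha w) * (S k m w + U (inr k) w)%:R ^+ 2)%:E)%E.
  by apply: eq_integral => w; rewrite inE => -[_ /= wm]; rewrite -(INAR1S wm).
rewrite (past_mean_sqr_add malpha mU mq q0 mBm (mS k m) (past_branch m ^~ pB) (eps_fresh (m := m))
  weightl weightl2 (eps_mean k) (eps_sqr k) wg).
rewrite (mean_bernoulli_sum malpha mU mq q0 alpha01 (pB m) (x_fresh (k := k)) (@x_inj k) _ _
  (weightM wg w22l))//.
rewrite (mean_bernoulli_sum_sqr malpha mU mq q0 alpha01 (pB m) (x_fresh (k := k)) (@x_inj k) _
  _ wg)//.
rewrite -(integral_addr P mBm (nweight (weightM (weightM wg w22l) wma)) n3).
rewrite -(integral_addr P mBm (nweight (weightM wg (weightD wma wma2)))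
  (nonneg_measurableD (nweight (weightM (weightM wg w22l) wma)) n3)).
apply: eq_integral => w; rewrite inE => -[_ /= ->]; congr EFin.
case: m {wma wma2 mBm} => [|m]; first by rewrite !mul0n/= ?expr0n/= ?mul0r ?mulr0; ring.
by rewrite succnK natrM -natr1; ring.
Qed.

End randomized_INAR1.

(** * Second-order structure of the process *)

Section moments.
Context d (T : measurableType d) (R : realType) (P : probability T R) (lambda : R).
Variables (alpha : {RV P >-> R}) (X0 : {RV P >-> nat})
  (xi : nat -> nat -> {RV P >-> nat}) (eps : nat -> {RV P >-> nat}).
Hypothesis lambda_gt0 : 0 < lambda.
Hypothesis inputsP : randomized_INAR1_inputs lambda alpha X0 xi eps.
Local Notation X := (INAR1 X0 (fun k j => xi k j) (fun k => eps k)).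
Local Notation weight := (weight alpha).
Local Notation mean := (cond_mean lambda).
Local Notation past_until := (past_until lambda alpha X0 xi eps).

Let alpha_lt1 w : 0 < 1 - alpha w.
Proof. by rewrite subr_gt0; have /andP[] := alpha_in01 inputsP w. Qed.

Let alpha_ge0 w : 0 <= alpha w.
Proof. by have /andP[/ltW] := alpha_in01 inputsP w. Qed.

Let nweight (g : R -> R) : weight g -> nonneg_measurable (fun w => g (alpha w)).
Proof. by apply: weight_nonneg. Qed.

Let mX k : measurable_fun setT (X k).
Proof. exact: (measurable_INAR1 inputsP). Qed.

Let nX k : nonneg_measurable (fun w => (X k w)%:R : R).
Proof. exact: (nonneg_measurable_nat (mX k) (fun n => ler0n _ n)). Qed.

Let nX2 k : nonneg_measurable (fun w => (X k w)%:R ^+ 2 : R).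
Proof. exact: (nonneg_measurable_nat (mX k) (fun n => sqr_ge0 _)). Qed.

Let pastT k : past_until k setT := past_untilT inputsP k.

Let wmean : weight mean := weight_cond_mean lambda_gt0 inputsP.
Let wid : weight (fun a => a) := weight_id inputsP.
Let wl : weight (fun=> lambda). Proof. by apply: weight_cst; exact: ltW. Qed.

Let meanE w : mean (alpha w) * (1 - alpha w) = lambda.
Proof. by rewrite /cond_mean divfK// gt_eqF. Qed.

Let meanS w : alpha w * mean (alpha w) + lambda = mean (alpha w).
Proof. by move: (mean (alpha w)) (meanE w) => m <-; ring. Qed.

Let X0_mean w :
  (\sum_(n <oo) (n%:R * input_mass lambda (inl (inl tt)) n (alpha w))%:E = (mean (alpha w))%:E)%E.
Proof. by apply: poisson_mean; rewrite divr_gt0. Qed.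

Let X0_sqr w :
  (\sum_(n <oo) (n%:R ^+ 2 * input_mass lambda (inl (inl tt)) n (alpha w))%:E =
   (mean (alpha w) + mean (alpha w) ^+ 2)%:E)%E.
Proof. by apply: poisson_second_moment; rewrite divr_gt0. Qed.

Let wmean2 : weight (fun a => mean a ^+ 2).
Proof.
have -> : (fun a => mean a ^+ 2) = (fun a => mean a * mean a) by apply/funext => a; rewrite expr2.
exact: weightM.
Qed.

(** lambda / (1 - alpha) is the fixed point of m |-> alpha m + lambda. *)
Lemma mean_INAR1 k g : weight g ->
  (\int[P]_w (g (alpha w) * (X k w)%:R)%:E = \int[P]_w (g (alpha w) * mean (alpha w))%:E)%E.
Proof.
elim: k g => [|k IHk] g wg;
  first exact: (integral_X0 inputsP wg wmean (fun n => ler0n _ n) X0_mean).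
rewrite (integral_INAR1S lambda_gt0 inputsP measurableT (pastT k) wg).
have wga := weightM wg wid.
rewrite (integral_addr P measurableT (nonneg_measurableM (nweight wga) (nX k)) (nweight
  (weightM wg wl))).
rewrite (IHk _ wga).
rewrite -(integral_addr P measurableT (nweight (weightM wga wmean)) (nweight (weightM wg wl))).
by apply: eq_integral => w _; rewrite -[in RHS]meanS; congr EFin; ring.
Qed.

(** m + m^2 is the second moment of a Poisson variable of mean m, and the
    recursion for second moments fixes it when m = alpha m + lambda. *)
Lemma mean_INAR1_sqr k g : weight g ->
  (\int[P]_w (g (alpha w) * (X k w)%:R ^+ 2)%:E =
   \int[P]_w (g (alpha w) * (mean (alpha w) + mean (alpha w) ^+ 2))%:E)%E.
Proof.
have wm2 := weightD wmean wmean2.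
elim: k g => [|k IHk] g wg; first exact: (integral_X0 inputsP wg wm2 (fun n => sqr_ge0 _) X0_sqr).
rewrite (integral_INAR1S_sqr lambda_gt0 inputsP measurableT (pastT k) wg).
have w2l : weight (fun a => 2 * lambda * a).
  by apply: weightM => //; apply: weight_cst; rewrite mulr_ge0// ltW.
have w1 := weightM wg (weightX inputsP 2).
have w2 := weightM wg (weightD (weightM wid (weight_compl inputsP 1)) w2l).
have w3 : weight (fun a => g a * (lambda + lambda ^+ 2)).
  by apply: weightM => //; apply: weight_cst; rewrite addr_ge0 ?sqr_ge0 ?ltW.
have n1 := nonneg_measurableM (nweight w1) (nX2 k).
have n2 := nonneg_measurableM (nweight w2) (nX k).
rewrite (integral_addr P measurableT (nonneg_measurableD n1 n2) (nweight w3)).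
rewrite (integral_addr P measurableT n1 n2) (IHk _ w1) (mean_INAR1 k w2).
rewrite -(integral_addr P measurableT (nweight (weightM w1 wm2)) (nweight (weightM w2 wmean))).
rewrite -(integral_addr P measurableT (nonneg_measurableD (nweight (weightM w1 wm2)) (nweight
  (weightM w2 wmean))) (nweight w3)).
by apply: eq_integral => w _; congr EFin; move: (mean (alpha w)) (meanE w) => m <-; ring.
Qed.

(** The sum of lambda alpha^i over i < j. *)
Let rest j a : R := mean a * (1 - a ^+ j).

Let wrest j : weight (rest j).
Proof. exact: (weightM wmean (weight_compl inputsP j)). Qed.

(** j thinnings leave alpha^j of the population at time l; the immigrants that
    arrived in between make up the rest. *)
Lemma mean_INAR1_past l j B g : measurable B -> past_until l B -> weight g ->
  (\int[P]_(w in B) (g (alpha w) * (X (j + l)%N w)%:R)%:E =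
   \int[P]_(w in B) (g (alpha w) * (alpha w ^+ j * (X l w)%:R + rest j (alpha w)))%:E)%E.
Proof.
move=> mB pB; elim: j g => [|j IHj] g wg.
  by apply: eq_integral => w _; rewrite /rest expr0 subrr mulr0 addr0 mul1r.
have pBj := past_until_add inputsP j pB.
rewrite (integral_INAR1S lambda_gt0 inputsP mB pBj wg).
have wga := weightM wg wid.
rewrite (integral_addr P mB (nonneg_measurableM (nweight wga) (nX _)) (nweight (weightM wg wl))).
have nr := nonneg_measurableD (nonneg_measurableM (nweight (weightX inputsP j)) (nX l))
  (nweight (wrest j)).
rewrite (IHj _ wga) -(integral_addr P mB (nonneg_measurableM (nweight wga) nr) (nweight
  (weightM wg wl))).
apply: eq_integral => w _; congr EFin.
by rewrite /rest exprS; move: (mean (alpha w)) (meanE w) => m <-; ring.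
Qed.

Lemma mean_INAR1_mul l j g : weight g ->
  (\int[P]_w (g (alpha w) * (X l w)%:R * (X (j + l)%N w)%:R)%:E =
   \int[P]_w (g (alpha w) * (alpha w ^+ j * mean (alpha w) + mean (alpha w) ^+ 2))%:E)%E.
Proof.
move=> wg; have ng := nweight wg; have naj := nweight (weightX inputsP j).
have nr := nweight (wrest j).
transitivity (\int[P]_w (g (alpha w) * (X l w)%:R *
    (alpha w ^+ j * (X l w)%:R + rest j (alpha w)))%:E)%E.
  rewrite (integral_decomposition P measurableT (mX l) (nonneg_measurableM (nonneg_measurableM
    ng (nX l)) (nX _))).
  rewrite (integral_decomposition P measurableT (mX l) (nonneg_measurableM (nonneg_measurableM
    ng (nX l))
    (nonneg_measurableD (nonneg_measurableM naj (nX l)) nr))).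
  apply: eq_eseriesr => r _; have wgr : weight (fun a => g a * r%:R).
    by apply: weightM => //; exact: weight_cst.
  have pB := past_until_level r (pastT l).
  have mB : measurable (setT `&` X l @^-1` [set r]).
    by apply: measurableI => //; exact: measurable_preimage1.
  transitivity (\int[P]_(w in setT `&` X l @^-1` [set r]) (g (alpha w) * r%:R * (X (j + l)%N
    w)%:R)%:E)%E.
    by apply: eq_integral => w; rewrite inE => -[_ /= ->].
  rewrite (mean_INAR1_past j mB pB wgr).
  by apply: eq_integral => w; rewrite inE => -[_ /= ->].
transitivity (\int[P]_w (g (alpha w) * alpha w ^+ j * (X l w)%:R ^+ 2 +
    g (alpha w) * rest j (alpha w) * (X l w)%:R)%:E)%E.
  by apply: eq_integral => w _; congr EFin; ring.
have w1 := weightM wg (weightX inputsP j); have w2 := weightM wg (wrest j).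
rewrite (integral_addr P measurableT (nonneg_measurableM (nweight w1) (nX2 l))
  (nonneg_measurableM (nweight w2) (nX l))).
rewrite (mean_INAR1_sqr l w1) (mean_INAR1 l w2).
rewrite -(integral_addr P measurableT (nweight (weightM w1 (weightD wmean wmean2))) (nweight
  (weightM w2 wmean))).
by apply: eq_integral => w _; congr EFin; rewrite /rest; ring.
Qed.

Definition centered_INAR1 k w : R := (X k w)%:R - mean (alpha w).
Local Notation D := centered_INAR1.

Lemma measurable_centered_INAR1 k : measurable_fun setT (D k).
Proof. by apply: measurable_funB; [exact: (nX k).1|exact: (nweight wmean).1]. Qed.

Let mD := measurable_centered_INAR1.

Let wpow j : weight (fun a => 2 * mean a * (1 + a ^+ j)).
Proof.
apply: weightM; first by apply: weightM => //; exact: weight_cst.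
by apply: weightD; [exact: weight_cst|exact: (weightX inputsP j)].
Qed.

Let nD2 l k : nonneg_measurable (fun w => (D l w + D k w) ^+ 2).
Proof.
by split=> [|w]; [apply: measurable_funX; exact: measurable_funD|exact: sqr_ge0].
Qed.

(** In (X_l + X_k)^2 + 4 m^2 = (D_l + D_k)^2 + 4 m (X_l + X_k), where m is the
    conditional mean, all terms are nonnegative; when g m^2 is integrable the
    known integrals can be subtracted. *)
Let centered_sqr_weighted l j g : weight g ->
  (\int[P]_w (g (alpha w) * mean (alpha w) ^+ 2)%:E < +oo)%E ->
  (\int[P]_w (g (alpha w) * (D l w + D (j + l)%N w) ^+ 2)%:E =
   \int[P]_w (g (alpha w) * (2 * mean (alpha w) * (1 + alpha w ^+ j)))%:E)%E.
Proof.
move=> wg gfin; have ng := nweight wg; have nm := nweight wmean.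
pose k := (j + l)%N.
have w4 : weight (fun a => 4 * (g a * mean a)).
  by apply: weightM; [exact: weight_cst|exact: weightM].
have w8 : weight (fun a => 8 * (g a * mean a ^+ 2)).
  by apply: weightM; [exact: weight_cst|exact: weightM].
have w2g : weight (fun a => 2 * g a) by apply: weightM => //; exact: weight_cst.
have w4m2 : weight (fun a => 4 * (g a * mean a ^+ 2)).
  by apply: weightM; [exact: weight_cst|exact: weightM].
have fin8 : (\int[P]_w (8 * (g (alpha w) * mean (alpha w) ^+ 2))%:E)%E \is a fin_num.
  rewrite ge0_fin_numE; last first.
    by apply: integral_ge0 => w _; rewrite lee_fin; exact: (nweight w8).2.
  under eq_integral do rewrite EFinM.
  rewrite ge0_integralZl_EFin//.
  - by rewrite lte_mul_pinfty.
  - by move=> w _; rewrite lee_fin; exact: (nweight (weightM wg wmean2)).2.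
  - by apply/measurable_EFinP; exact: (nweight (weightM wg wmean2)).1.
suff : (\int[P]_w (g (alpha w) * (D l w + D k w) ^+ 2)%:E + \int[P]_w (8 * (g (alpha w) * mean
  (alpha w) ^+ 2))%:E =
    \int[P]_w (g (alpha w) * (2 * mean (alpha w) * (1 + alpha w ^+ j)))%:E +
    \int[P]_w (8 * (g (alpha w) * mean (alpha w) ^+ 2))%:E)%E.
  by move=> /(congr1 (fun z => z - \int[P]_w (8 * (g (alpha w) * mean (alpha w) ^+ 2))%:E)%E);
    rewrite !addeK.
have e1 : (\int[P]_w (8 * (g (alpha w) * mean (alpha w) ^+ 2))%:E =
    \int[P]_w (4 * (g (alpha w) * mean (alpha w)) * (X l w)%:R + 4 * (g (alpha w) * mean (alpha
      w)) * (X k w)%:R)%:E)%E.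
  rewrite (integral_addr P measurableT (nonneg_measurableM (nweight w4) (nX l))
    (nonneg_measurableM (nweight w4) (nX k))).
  rewrite (mean_INAR1 l w4) (mean_INAR1 k w4).
  rewrite -(integral_addr P measurableT (nweight (weightM w4 wmean)) (nweight (weightM w4
    wmean))).
  by apply: eq_integral => w _; congr EFin; ring.
rewrite {1}e1.
have nXX : nonneg_measurable (fun w => 2 * g (alpha w) * (X l w)%:R * (X k w)%:R).
  exact: (nonneg_measurableM (nonneg_measurableM (nweight w2g) (nX l)) (nX k)).
have n4X := nonneg_measurableD (nonneg_measurableM (nweight w4) (nX l)) (nonneg_measurableM
  (nweight w4) (nX k)).
rewrite -(integral_addr P measurableT (nonneg_measurableM ng (nD2 l k)) n4X).
transitivity (\int[P]_w ((g (alpha w) * (X l w)%:R ^+ 2 + g (alpha w) * (X k w)%:R ^+ 2) +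
   (2 * g (alpha w) * (X l w)%:R * (X k w)%:R + 4 * (g (alpha w) * mean (alpha w) ^+ 2)))%:E)%E.
  by apply: eq_integral => w _; congr EFin; rewrite /centered_INAR1; ring.
have n1 := nonneg_measurableM ng (nX2 l); have n2 := nonneg_measurableM ng (nX2 k).
rewrite (integral_addr P measurableT (nonneg_measurableD n1 n2) (nonneg_measurableD nXX
  (nweight w4m2))).
rewrite (integral_addr P measurableT n1 n2) (integral_addr P measurableT nXX (nweight w4m2)).
rewrite (mean_INAR1_sqr l wg) (mean_INAR1_sqr k wg) (mean_INAR1_mul l j w2g).
have wA := weightM wg (weightD wmean wmean2).
have wB := weightM w2g (weightD (weightM (weightX inputsP j) wmean) wmean2).
rewrite -(integral_addr P measurableT (nweight wA) (nweight wA)).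
rewrite -(integral_addr P measurableT (nweight wB) (nweight w4m2)).
rewrite -(integral_addr P measurableT (nonneg_measurableD (nweight wA) (nweight wA))
  (nonneg_measurableD (nweight wB) (nweight w4m2))).
rewrite -(integral_addr P measurableT (nweight (weightM wg (wpow j))) (nweight w8)).
by apply: eq_integral => w _; congr EFin; ring.
Qed.

(** Indicators of the events on which the conditional mean is in [n, n + 1[:
    they partition the space, and on each of them the conditional mean is
    bounded. *)
Let slab (n : nat) (a : R) : R := \1_[set a | n%:R <= mean a < n.+1%:R] a.

Let wslab n : weight (slab n).
Proof.
split=> [|w]; last by [].
apply: measurable_indic.
rewrite (_ : [set a | _] = setT `&` mean @^-1` `[n%:R, n.+1%:R[%classic).
  exact: (measurable_cond_mean lambda).
by rewrite setTI; apply/seteqP; split => a /=; rewrite in_itv.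
Qed.

Let integral_slabs (f : T -> R) : nonneg_measurable f ->
  (\int[P]_w (f w)%:E = \sum_(n <oo) \int[P]_w (slab n (alpha w) * f w)%:E)%E.
Proof.
move=> nf; have nn n := nonneg_measurableM (nweight (wslab n)) nf.
rewrite -integral_nneseries//; last 2 first.
- by move=> n; apply/measurable_EFinP; exact: (nn n).1.
- by move=> n w _; rewrite lee_fin; exact: (nn n).2.
apply: eq_integral => w _.
have m0 : 0 <= mean (alpha w) by exact: wmean.2.
have slabE n : slab n (alpha w) = (Num.truncn (mean (alpha w)) == n)%:R.
  rewrite /slab indicE (_ : (_ \in _) = (Num.truncn (mean (alpha w)) == n))//.
  apply/idP/eqP => [/set_mem/= h|<-].
    exact/truncn_def.
  by apply/mem_set => /=; exact: truncn_itv.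
rewrite (@nneseriesD1 _ _ (Num.truncn (mean (alpha w))))//; last first.
  by move=> n _; rewrite lee_fin; exact: (nn n).2.
rewrite slabE eqxx mul1r eseries0 ?adde0// => n _ nt.
by rewrite slabE eq_sym (negbTE nt) mul0r.
Qed.

(** The square of the conditional mean need not be integrable, although the
    second moments of the centred process are finite; hence the detour through
    slabs. *)
Lemma centered_INAR1_sqr l j :
  (\int[P]_w ((D l w + D (j + l)%N w) ^+ 2)%:E =
   \int[P]_w (2 * mean (alpha w) * (1 + alpha w ^+ j))%:E)%E.
Proof.
rewrite (integral_slabs (nD2 l (j + l))) (integral_slabs (nweight (wpow j))).
apply: eq_eseriesr => n _; apply: centered_sqr_weighted => //.
apply: (@le_lt_trans _ _ (\int[P]_w (n.+1%:R ^+ 2)%:E)%E).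
  apply: ge0_le_integral => //.
  - by move=> w _; rewrite lee_fin; exact: (nweight (weightM (wslab n) wmean2)).2.
  - by apply/measurable_EFinP; exact: (nweight (weightM (wslab n) wmean2)).1.
  - move=> w _; rewrite lee_fin /slab indicE; have m0 : 0 <= mean (alpha w) by exact: wmean.2.
    case: (boolP (_ \in _)) => [/set_mem/= /andP[_ h]|_]; last by rewrite mul0r sqr_ge0.
    by rewrite mul1r lerXn2r ?nnegrE// ltW.
rewrite EFin_Rintegral ?ltry//; exact: finite_measure_integrable_cst.
Qed.

Section finite_mean.
Hypothesis mean_lty : (\int[P]_w ((1 - alpha w)^-1)%:E < +oo)%E.

Lemma integrable_cond_mean : P.-integrable setT (fun w => (mean (alpha w))%:E).
Proof.
apply/integrableP; split; first by apply/measurable_EFinP; exact: (nweight wmean).1.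
under eq_integral do rewrite gee0_abs ?lee_fin ?wmean.2// EFinM.
rewrite ge0_integralZl_EFin//; last first.
- exact: ltW.
- by apply/measurable_EFinP;
  exact: (measurableT_comp measurable_invr (nweight (weight_compl inputsP 1)).1).
- by move=> w _; rewrite lee_fin invr_ge0 ltW.
by rewrite lte_mul_pinfty// lee_fin ltW.
Qed.

Lemma integrable_cond_meanX j : P.-integrable setT (fun w => (mean (alpha w) * alpha w ^+ j)%:E).
Proof.
apply: (le_integrable measurableT _ _ integrable_cond_mean).
  by apply/measurable_EFinP; exact: (nweight (weightM wmean (weightX inputsP j))).1.
move=> w _ /=; rewrite lee_fin normrM ler_piMr// ger0_norm ?exprn_ge0//.
by rewrite exprn_ile1// ltW// -subr_gt0.
Qed.

Definition autocovariance (k l : nat) : R :=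
  \int[P]_w (mean (alpha w) * alpha w ^+ (maxn k l - minn k l)).

Let integrable_sum_sqr l j : P.-integrable setT (fun w => ((D l w + D (j + l)%N w) ^+ 2)%:E) /\
  \int[P]_w (D l w + D (j + l)%N w) ^+ 2 =
    2 * \int[P]_w mean (alpha w) + 2 * \int[P]_w (mean (alpha w) * alpha w ^+ j).
Proof.
have im := integrable_cond_mean; have imj := integrable_cond_meanX j.
have E : (\int[P]_w ((D l w + D (j + l)%N w) ^+ 2)%:E =
    (2 * \int[P]_w mean (alpha w) + 2 * \int[P]_w (mean (alpha w) * alpha w ^+ j))%:E)%E.
  rewrite centered_INAR1_sqr -mulrDr.
  transitivity (\int[P]_w (2%:E * ((mean (alpha w))%:E + (mean (alpha w) * alpha w ^+ j)%:E)))%E.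
    by apply: eq_integral => w _; rewrite -EFinD -EFinM; congr EFin; ring.
  rewrite integralZl//; last exact: integrableD.
  by rewrite integralD// !EFin_Rintegral// EFinM EFinD.
split; last by rewrite /Rintegral E.
apply/integrableP; split; first by apply/measurable_EFinP; exact: (nD2 _ _).1.
under eq_integral do rewrite gee0_abs ?lee_fin ?sqr_ge0//.
by rewrite E ltry.
Qed.

Lemma integrable_centered_sqr l : P.-integrable setT (fun w => (D l w ^+ 2)%:E).
Proof.
have [i _] := integrable_sum_sqr l 0.
have := integrableZl measurableT (4^-1) i; apply: eq_integrable => // w _.
by rewrite -EFinM add0n; congr EFin; field.
Qed.

Lemma integrable_centeredM k l : P.-integrable setT (fun w => (D k w * D l w)%:E).
Proof.
apply: (le_integrable measurableT _ _ (integrableD measurableT (integrable_centered_sqr k)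
  (integrable_centered_sqr l))).
  by apply/measurable_EFinP; exact: measurable_funM.
move=> w _; rewrite -EFinD /= lee_fin [leRHS]ger0_norm ?addr_ge0 ?sqr_ge0//.
rewrite normrM -(real_normK (num_real (D k w))) -(real_normK (num_real (D l w))).
by have := sqr_ge0 (`|D k w| - `|D l w|); have := normr_ge0 (D k w); have := normr_ge0 (D l w);
  nra.
Qed.

Lemma mean_centeredM k l : \int[P]_w (D k w * D l w) = autocovariance k l.
Proof.
wlog kl : k l / (k <= l)%N.
  move=> h; have [kl|/ltnW lk] := leqP k l; first exact: h.
  under eq_Rintegral do rewrite mulrC.
  by rewrite h// /autocovariance maxnC minnC.
rewrite /autocovariance (maxn_idPr kl) (minn_idPl kl).
pose j := (l - k)%N; have -> : l = (j + k)%N by rewrite subnK.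
rewrite addnK.
have [i1 E1] := integrable_sum_sqr k j.
have sq m : \int[P]_w D m w ^+ 2 = \int[P]_w mean (alpha w).
  have [im Em] := integrable_sum_sqr m 0.
  transitivity (\int[P]_w (4^-1 * (D m w + D (0 + m)%N w) ^+ 2)).
    by apply: eq_Rintegral => w _; rewrite add0n; field.
  rewrite RintegralZl// Em; under [X in _ + 2 * X]eq_Rintegral do rewrite expr0 mulr1.
  by field.
(* Polarization. *)
transitivity (\int[P]_w (2^-1 * ((D k w + D (j + k)%N w) ^+ 2 - (D k w ^+ 2 + D (j + k)%N w ^+
  2)))).
  by apply: eq_Rintegral => w _; field.
have ik := integrable_centered_sqr k; have ijk := integrable_centered_sqr (j + k)%N.
have is2 : P.-integrable setT (EFin \o (fun w => D k w ^+ 2 + D (j + k)%N w ^+ 2)).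
  exact: (integrableD measurableT ik ijk).
rewrite RintegralZl//; last exact: (integrableB measurableT i1 is2).
rewrite RintegralB// RintegralD// E1 !sq; by field.
Qed.

Lemma integrable_centered k : P.-integrable setT (fun w => (D k w)%:E).
Proof. exact: (integrable_of_sqr (mD k) (integrable_centered_sqr k)). Qed.

Lemma mean_centered k : \int[P]_w D k w = 0.
Proof.
have w1 : weight (fun=> 1) by exact: weight_cst.
have e : (\int[P]_w (X k w)%:R%:E = \int[P]_w (mean (alpha w))%:E)%E.
  have := mean_INAR1 k w1.
  by under eq_integral do rewrite mul1r; under [X in _ = X -> _]eq_integral do rewrite mul1r.
have iX : P.-integrable setT (EFin \o (fun w => (X k w)%:R)).
  apply/integrableP; split; first by apply/measurable_EFinP; exact: (nX k).1.
  under eq_integral do rewrite gee0_abs ?lee_fin//.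
  by rewrite e EFin_Rintegral ?ltry//; exact: integrable_cond_mean.
rewrite RintegralB//; last exact: integrable_cond_mean.
by rewrite /Rintegral e subrr.
Qed.

End finite_mean.
End moments.

(** * Linear combinations *)

Section linear_combinations.
Context d (T : measurableType d) (R : realType) (P : probability T R).

Lemma Rintegral_sum n (f : 'I_n -> T -> R) :
  (forall i, P.-integrable setT (EFin \o f i)) ->
  P.-integrable setT (fun w => (\sum_i f i w)%:E) /\
  \int[P]_w (\sum_i f i w) = \sum_i \int[P]_w f i w.
Proof.
move=> fi.
have sumE (s : seq 'I_n) : P.-integrable setT (EFin \o (fun w => \sum_(i <- s) f i w)) /\
    \int[P]_w (\sum_(i <- s) f i w) = \sum_(i <- s) \int[P]_w f i w.
  elim: s => [|i s [IHi IHe]].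
    split; last by rewrite big_nil; under eq_Rintegral do rewrite big_nil;
      rewrite Rintegral_probability_cst.
    by under eq_fun do rewrite big_nil; exact: (finite_measure_integrable_cst P 0 measurableT).
  split.
    by under eq_fun do rewrite big_cons; exact: (integrableD measurableT (fi i) IHi).
  by under eq_Rintegral do rewrite big_cons; rewrite RintegralD// IHe big_cons.
exact: sumE.
Qed.

Lemma mean_combination n (c : 'I_n -> R) (f : 'I_n -> T -> R) :
  (forall i, P.-integrable setT (EFin \o f i)) ->
  P.-integrable setT (EFin \o (fun w => \sum_i c i * f i w)) /\
  \int[P]_w (\sum_i c i * f i w) = \sum_i c i * \int[P]_w f i w.
Proof.
move=> fi; have cfi i : P.-integrable setT (EFin \o (fun w => c i * f i w)).
  exact: (integrableZl measurableT (c i) (fi i)).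
have [i1 E1] := Rintegral_sum cfi; split => //.
by rewrite E1; apply: eq_bigr => i _; rewrite RintegralZl.
Qed.

Lemma second_moment_combination n (c : 'I_n -> R) (f : 'I_n -> T -> R) :
  (forall i j, P.-integrable setT (EFin \o (fun w => f i w * f j w))) ->
  P.-integrable setT (EFin \o (fun w => (\sum_i c i * f i w) ^+ 2)) /\
  \int[P]_w (\sum_i c i * f i w) ^+ 2 =
    \sum_i \sum_j c i * c j * \int[P]_w (f i w * f j w).
Proof.
move=> fi.
have E w : (\sum_i c i * f i w) ^+ 2 = \sum_i 1 * (\sum_j (c i * c j) * (f i w * f j w)).
  rewrite expr2 mulr_suml; apply: eq_bigr => i _; rewrite mul1r mulr_sumr.
  by apply: eq_bigr => j _; rewrite mulrACA.
have h i := mean_combination (fun j => c i * c j) (fi i).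
have [i1 E1] := mean_combination (fun=> 1) (fun i => (h i).1).
split; first by under eq_fun do rewrite E.
under eq_Rintegral do rewrite E.
by rewrite E1; apply: eq_bigr => i _; rewrite mul1r (h i).2.
Qed.

End linear_combinations.

Section autocovariance_kernel.
Context d (T : measurableType d) (R : realType) (P : probability T R) (lambda : R).
Variables (alpha : {RV P >-> R}) (X0 : {RV P >-> nat})
  (xi : nat -> nat -> {RV P >-> nat}) (eps : nat -> {RV P >-> nat}).
Hypothesis lambda_gt0 : 0 < lambda.
Hypothesis inputsP : randomized_INAR1_inputs lambda alpha X0 xi eps.
Hypothesis mean_lty : (\int[P]_w ((1 - alpha w)^-1)%:E < +oo)%E.
Local Notation D := (centered_INAR1 lambda alpha X0 xi eps).
Local Notation K := (autocovariance lambda alpha).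

Lemma mean_combination_INAR1 n (ks : 'I_n -> nat) (c : 'I_n -> R) :
  P.-integrable setT (EFin \o (fun w => \sum_i c i * D (ks i) w)) /\
  \int[P]_w (\sum_i c i * D (ks i) w) = 0.
Proof.
have [i1 ->] := mean_combination c (fun i => integrable_centered lambda_gt0 inputsP mean_lty
  (ks i)).
by split => //; rewrite big1// => i _; rewrite (mean_centered lambda_gt0 inputsP mean_lty) mulr0.
Qed.

Lemma second_moment_combination_INAR1 n (ks : 'I_n -> nat) (c : 'I_n -> R) :
  P.-integrable setT (EFin \o (fun w => (\sum_i c i * D (ks i) w) ^+ 2)) /\
  \int[P]_w (\sum_i c i * D (ks i) w) ^+ 2 = covform K ks c.
Proof.
have [i1 ->] := second_moment_combination (f := fun i => D (ks i)) c
  (fun i j => integrable_centeredM lambda_gt0 inputsP mean_lty (ks i) (ks j)).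
split => //; apply: eq_bigr => i _; apply: eq_bigr => j _.
by rewrite (mean_centeredM lambda_gt0 inputsP mean_lty).
Qed.

(** The quadratic form is the second moment of a combination of the process. *)
Lemma autocovariance_psd : psd K.
Proof.
split=> [k l|n c]; first by rewrite /autocovariance maxnC minnC.
suff -> : \sum_(i < n) \sum_(j < n) c i * c j * K i j =
    \int[P]_w (\sum_(i < n) c i * D i w) ^+ 2.
  by apply: Rintegral_ge0 => w _; exact: sqr_ge0.
by have [_ ->] := second_moment_combination_INAR1 (fun i : 'I_n => i) (fun i => c i).
Qed.

Lemma autocovariance_stationary k l h : K (k + h)%N (l + h)%N = K k l.
Proof. by rewrite /autocovariance -addn_maxl -addn_minl subnDr. Qed.

End autocovariance_kernel.

(** * Independence of a weight and a random element *)

Section simple_approximation.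
Context d (S : measurableType d) (R : realType).

(** Rounding a bounded function down to multiples of a small step. *)
Lemma simple_approximation (h : S -> R) (e : R) : bounded_measurable h -> 0 < e ->
  exists (L : nat) (c : 'I_L -> R) (E : 'I_L -> set S),
    (forall i, measurable (E i)) /\ forall x, `|h x - \sum_i c i * \1_(E i) x| <= e.
Proof.
move=> [mh [K hK]] e0.
pose E (i : nat) := [set x | i%:R <= (h x + K) / e < i.+1%:R].
pose L := (Num.truncn (2 * K / e)).+1.
exists L, (fun i => i%:R * e - K), (fun i => E i); split.
  move=> i; rewrite (_ : E i = setT `&` (fun x => (h x + K) / e) @^-1` `[i%:R, i.+1%:R[%classic).
    by apply: measurable_funM => //; exact: measurable_funD.
  by rewrite setTI; apply/seteqP; split => x /=; rewrite in_itv.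
move=> x; pose y := (h x + K) / e.
have hx0 : 0 <= h x + K by have := hK x; rewrite ler_norml => /andP[]; lra.
have y0 : 0 <= y by rewrite divr_ge0// ltW.
have yL : (Num.truncn y < L)%N.
  rewrite ltnS; apply: le_truncn; rewrite ler_pM2r ?invr_gt0//.
  by have := hK x; rewrite ler_norml => /andP[_]; lra.
rewrite (bigD1 (Ordinal yL))//= big1 ?addr0; last first.
  move=> i ni; rewrite indicE memNset ?mulr0// => /= /truncn_def yi.
  by move/eqP: ni; apply; apply: val_inj => /=; rewrite -yi.
have /andP[y1 y2] := truncn_itv y0.
have yE : E (Num.truncn y) x by exact: truncn_itv.
rewrite indicE (mem_set yE) mulr1.
have hE : h x = y * e - K by rewrite /y divfK ?gt_eqF// addrK.
rewrite hE (_ : _ - _ = (y - (Num.truncn y)%:R) * e); last by ring.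
rewrite normrM (gtr0_norm e0) ger_pMl// ger0_norm ?subr_ge0//.
by rewrite lerBlDr -natr1 addrC in y2 *; exact: ltW.
Qed.

End simple_approximation.

Section independence.
Context d (T : measurableType d) (R : realType) (P : probability T R).
Context d' (S : measurableType d').

(** Both sides depend continuously on h for the uniform norm, so that simple
    functions, hence events, suffice. *)
Lemma independent_mean (phi : T -> R) (Z : T -> S) (h : S -> R) :
  bounded_measurable phi -> measurable_fun setT Z -> bounded_measurable h ->
  (forall E, measurable E -> \int[P]_w (phi w * \1_E (Z w)) =
     \int[P]_w phi w * \int[P]_w \1_E (Z w)) ->
  \int[P]_w (phi w * h (Z w)) = \int[P]_w phi w * \int[P]_w h (Z w).
Proof.
move=> bphi mZ bh indep.
have [_ [M phiM]] := bphi.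
have hZ (g : S -> R) : bounded_measurable g -> bounded_measurable (fun w => g (Z w)).
  by move=> [mg [K gK]]; split; [exact: measurableT_comp|exists K => w; exact: gK].
apply/eqP; rewrite -subr_eq0 -normr_le0; apply/ler_addgt0Pr => e e0; rewrite add0r.
have M0 : 0 <= `|M| by []; pose e' := e / (2 * (`|M| + 1)).
have e'0 : 0 < e' by rewrite divr_gt0// mulr_gt0// ltr_wpDl.
have [L [c [E [mE hE]]]] := simple_approximation bh e'0.
pose s x := \sum_i c i * \1_(E i) x.
have ind i : bounded_measurable (\1_(E i) : S -> R).
  split; first exact: measurable_indic.
  by exists 1 => x; rewrite indicE; case: (_ \in _); rewrite ?normr0 ?normr1.
have bs : bounded_measurable s.
  split; first by apply: measurable_sum => i; apply: measurable_funM => //; exact: (ind i).1.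
  have [_ [B hB]] := bh; exists (B + e') => x.
  by rewrite -[s x](subKr (h x)) (le_trans (ler_normB _ _))// lerD.
have sE : \int[P]_w (phi w * s (Z w)) = \int[P]_w phi w * \int[P]_w s (Z w).
  have [_ E2] := mean_combination c (fun i => bounded_measurable_integrable P (hZ _ (ind i))).
  rewrite E2.
  have bi i := bounded_measurable_integrable P (bounded_measurableM bphi (hZ _ (ind i))).
  have [_ E1] := mean_combination c bi.
  transitivity (\int[P]_w (\sum_i c i * (phi w * \1_(E i) (Z w)))).
    apply: eq_Rintegral => w _; rewrite mulr_sumr.
    by apply: eq_bigr => i _; rewrite mulrCA.
  rewrite E1 mulr_sumr; apply: eq_bigr => i _.
  by rewrite indep// mulrCA.
have bhZ := hZ _ bh; have bsZ := hZ _ bs.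
have d1 : `|\int[P]_w (phi w * h (Z w)) - \int[P]_w (phi w * s (Z w))| <= `|M| * e'.
  rewrite -RintegralB//; last 2 first.
  - exact: (bounded_measurable_integrable P (bounded_measurableM bphi bhZ)).
  - exact: (bounded_measurable_integrable P (bounded_measurableM bphi bsZ)).
  apply: norm_Rintegral_bound.
    exact: (bounded_measurableB (bounded_measurableM bphi bhZ) (bounded_measurableM bphi bsZ)).1.
  move=> w; rewrite -mulrBr normrM ler_pM//; exact: le_trans (phiM w) (ler_norm _).
have d2 : `|\int[P]_w h (Z w) - \int[P]_w s (Z w)| <= e'.
  rewrite -RintegralB//;
    [|exact: (bounded_measurable_integrable P bhZ)|exact: (bounded_measurable_integrable P bsZ)].
  apply: norm_Rintegral_bound; first exact: (bounded_measurableB bhZ bsZ).1.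
  by move=> w; exact: hE.
have d3 : `|\int[P]_w phi w| <= `|M|.
  apply: norm_Rintegral_bound => [|w]; first exact: bphi.1.
  exact: le_trans (phiM w) (ler_norm _).
rewrite (_ : _ - _ = (\int[P]_w (phi w * h (Z w)) - \int[P]_w (phi w * s (Z w))) -
   \int[P]_w phi w * (\int[P]_w h (Z w) - \int[P]_w s (Z w))); last by rewrite sE; ring.
apply: (le_trans (ler_normB _ _)); rewrite normrM.
apply: (@le_trans _ _ (`|M| * e' + `|M| * e')); first by rewrite lerD// ler_pM.
rewrite /e'; rewrite -mulrDl mulrCA mulrA -[leRHS]mulr1 -mulrA ler_pM2l//.
by rewrite ler_pdivrMr ?mul1r; lra.
Qed.

End independence.

(** * Central limit theorem for independent copies *)

Section independent_copies.
Context d (T : measurableType d) (R : realType) (P : probability T R).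
Context d' (S : measurableType d') (Z : nat -> T -> S).
Hypothesis mZ : forall j, measurable_fun setT (Z j).

Definition joint_event (s : seq nat) (E : nat -> set S) : set T :=
  \big[setI/setT]_(j <- s) (Z j @^-1` E j).

Hypothesis indep : forall s E, uniq s -> (forall j, measurable (E j)) ->
  P (joint_event s E) = (\prod_(j <- s) P (Z j @^-1` E j))%E.
Hypothesis same_law : forall j E, measurable E -> P (Z j @^-1` E) = P (Z 0%N @^-1` E).

Let measurable_preimageZ j (E : set S) : measurable E -> measurable (Z j @^-1` E).
Proof. by move=> mE; rewrite -[X in measurable X]setTI; exact: mZ. Qed.

Lemma measurable_joint_event s E : (forall j, measurable (E j)) ->
  measurable (joint_event s E).
Proof. by move=> mE; apply: bigsetI_measurable => j _; exact: measurable_preimageZ. Qed.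

Let mean_indic (A : set T) : measurable A -> \int[P]_w \1_A w = fine (P A).
Proof. by move=> mA; rewrite /Rintegral integral_indic// setIT. Qed.

Let bounded_indic (A : set T) : measurable A -> bounded_measurable (\1_A : T -> R).
Proof.
move=> mA; split; first exact: measurable_indic.
by exists 1 => w; rewrite indicE; case: (_ \in _); rewrite ?normr0 ?normr1.
Qed.

(** A weak form of independence from the Z j with j >= N.  The sines and cosines
    of the partial sums of length N have it, which is proved by induction on N. *)
Definition independent_from (N : nat) (phi : T -> R) : Prop :=
  bounded_measurable phi /\ forall s E, uniq s -> (forall j, j \in s -> (N <= j)%N) ->
    (forall j, measurable (E j)) ->
    \int[P]_w (phi w * \1_(joint_event s E) w) =
    \int[P]_w phi w * fine (P (joint_event s E)).

Lemma independent_from_cst N c : independent_from N (fun=> c).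
Proof.
split=> [|s E _ _ mE]; first exact: bounded_measurable_cst.
have mG := measurable_joint_event s mE.
rewrite RintegralZl//; last exact: (bounded_measurable_integrable P (bounded_indic mG)).
by rewrite mean_indic// Rintegral_probability_cst.
Qed.

Lemma independent_fromB N f g : independent_from N f -> independent_from N g ->
  independent_from N (fun w => f w - g w).
Proof.
move=> [bf hf] [bg hg]; split=> [|s E us sN mE]; first exact: bounded_measurableB.
have bG := bounded_indic (measurable_joint_event s mE).
rewrite RintegralB//;
  [|exact: (bounded_measurable_integrable P bf)|exact: (bounded_measurable_integrable P bg)].
rewrite mulrBl -hf// -hg// -RintegralB//.
- by apply: eq_Rintegral => w _; rewrite mulrBl.
- exact: (bounded_measurable_integrable P (bounded_measurableM bf bG)).
- exact: (bounded_measurable_integrable P (bounded_measurableM bg bG)).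
Qed.

Lemma independent_fromN N f : independent_from N f -> independent_from N (fun w => - f w).
Proof.
move=> hf; have := independent_fromB (independent_from_cst N 0) hf.
by under eq_fun do rewrite sub0r.
Qed.

Lemma independent_fromD N f g : independent_from N f -> independent_from N g ->
  independent_from N (fun w => f w + g w).
Proof.
move=> hf /independent_fromN hg; have := independent_fromB hf hg.
by under eq_fun do rewrite opprK.
Qed.

Let update (N : nat) (A : set S) (E : nat -> set S) j := if j == N then A else E j.

Let joint_event_cons N s E (A : set S) : N \notin s ->
  (forall j, measurable (E j)) -> measurable A ->
  joint_event (N :: s) (update N A E) = Z N @^-1` A `&` joint_event s E /\
  (uniq s -> P (joint_event (N :: s) (update N A E)) =
    (P (Z N @^-1` A) * P (joint_event s E))%E).
Proof.
move=> Ns mE mA.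
have tl j : j \in s -> update N A E j = E j.
  by rewrite /update; case: eqP => // -> js; move: Ns; rewrite js.
have mE' j : measurable (update N A E j) by rewrite /update; case: eqP.
split=> [|us].
  rewrite /joint_event big_cons {1}/update eqxx; congr (_ `&` _).
  by rewrite big_seq [RHS]big_seq; apply: eq_bigr => j /tl ->.
rewrite (indep (s := N :: s))//=; last by rewrite Ns.
rewrite big_cons {1}/update eqxx (indep us mE); congr (_ * _)%E.
by rewrite big_seq [RHS]big_seq; apply: eq_bigr => j /tl ->.
Qed.

(** Condition on the events of the later Z j, then use independent_mean. *)
Lemma independent_from_mul N phi (h : S -> R) : independent_from N phi ->
  bounded_measurable h ->
  \int[P]_w (phi w * h (Z N w)) = \int[P]_w phi w * \int[P]_w h (Z N w) /\
  independent_from N.+1 (fun w => phi w * h (Z N w)).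
Proof.
move=> [bphi hphi] bh.
have bhZ : bounded_measurable (fun w => h (Z N w)).
  have [mh [K hK]] := bh; split; first exact: measurableT_comp.
  by exists K => w; exact: hK.
have factor s E : uniq s -> (forall j, j \in s -> (N < j)%N) -> (forall j, measurable (E j)) ->
    \int[P]_w (phi w * \1_(joint_event s E) w * h (Z N w)) =
    \int[P]_w phi w * fine (P (joint_event s E)) * \int[P]_w h (Z N w).
  move=> us sN mE; have bG := bounded_indic (measurable_joint_event s mE).
  have Ns : N \notin s by apply/negP => /sN; rewrite ltnn.
  have sN' j : j \in s -> (N <= j)%N by move=> /sN /ltnW.
  rewrite (independent_mean (bounded_measurableM bphi bG) (mZ N) bh); first by rewrite hphi.
  move=> A mA; have [eG PG] := joint_event_cons Ns mE mA.
  have mZA := measurable_preimageZ N mA.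
  have -> : \int[P]_w \1_A (Z N w) = fine (P (Z N @^-1` A)) by rewrite -mean_indic.
  transitivity (\int[P]_w (phi w * \1_(joint_event (N :: s) (update N A E)) w)).
    apply: eq_Rintegral => w _; rewrite eG indicI -mulrA [X in phi w * X]mulrC.
    by [].
  rewrite hphi; last 3 first.
  - by rewrite /= Ns.
  - by move=> j; rewrite in_cons => /predU1P[->//|/sN'].
  - by move=> j; rewrite /update; case: eqP.
  rewrite hphi// -mulrA PG// fineM; last 2 first.
  - exact: fin_num_measure.
  - by apply: fin_num_measure; exact: measurable_joint_event.
  by rewrite [X in _ * X]mulrC.
have nil (E : nat -> set S) : joint_event [::] E = setT by rewrite /joint_event big_nil.
have e : \int[P]_w (phi w * h (Z N w)) = \int[P]_w phi w * \int[P]_w h (Z N w).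
  have := factor [::] (fun=> setT) isT (fun j => ltac:(by [])) (fun=> measurableT).
  rewrite nil probability_setT mulr1 => <-.
  by apply: eq_Rintegral => w _; rewrite indicT mulr1.
split=> //; split=> [|s E us sN mE]; first exact: bounded_measurableM.
rewrite e mulrAC -factor//; apply: eq_Rintegral => w _; exact: mulrAC.
Qed.

Section sums.
Variable F : S -> R.
Hypothesis mF : measurable_fun setT F.

Let mean_same_law (h : S -> R) j : bounded_measurable h ->
  \int[P]_w h (Z j w) = \int[P]_w h (Z 0%N w).
Proof. by move=> [mh _]; apply: eq_law_mean => // B mB; exact: same_law. Qed.

Definition partial_sum N w := \sum_(j < N) F (Z j w).

Lemma measurable_partial_sum N : measurable_fun setT (partial_sum N).
Proof. by apply: measurable_sum => j; exact: measurableT_comp. Qed.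

Let sumS N w th : partial_sum N.+1 w + th = (partial_sum N w + th) + F (Z N w).
Proof. by rewrite /partial_sum big_ord_recr/= addrAC. Qed.

Lemma independent_from_trig N th :
  independent_from N (fun w => cos (partial_sum N w + th)) /\
  independent_from N (fun w => sin (partial_sum N w + th)).
Proof.
have bc := bounded_measurable_cos mF; have bs := bounded_measurable_sin mF.
elim: N => [|N [IHc IHs]].
  have e w : partial_sum 0 w + th = th by rewrite /partial_sum big_ord0 add0r.
  by split; under eq_fun do rewrite e; exact: independent_from_cst.
split; under eq_fun do rewrite sumS.
  under eq_fun do rewrite cosD; apply: independent_fromB.
    exact: (independent_from_mul IHc bc).2.
  exact: (independent_from_mul IHs bs).2.
under eq_fun do rewrite sinD; apply: independent_fromD.
  exact: (independent_from_mul IHs bc).2.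
exact: (independent_from_mul IHc bs).2.
Qed.

(** Addition formula and independence: this recursion replaces the product
    formula for complex characteristic functions. *)
Lemma mean_cos_partial_sumS N th :
  \int[P]_w cos (partial_sum N.+1 w + th) =
  \int[P]_w cos (partial_sum N w + th) * \int[P]_w cos (F (Z 0%N w)) -
  \int[P]_w sin (partial_sum N w + th) * \int[P]_w sin (F (Z 0%N w)).
Proof.
have bc := bounded_measurable_cos mF; have bs := bounded_measurable_sin mF.
have [ic isn] := independent_from_trig N th.
have [ec [bec _]] := independent_from_mul ic bc.
have [es [bes _]] := independent_from_mul isn bs.
under eq_Rintegral do rewrite sumS cosD.
rewrite RintegralB//; last 2 first.
- exact: (bounded_measurable_integrable P bec).
- exact: (bounded_measurable_integrable P bes).
by rewrite ec es (mean_same_law N bc) (mean_same_law N bs).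
Qed.

Lemma mean_cos_partial_sum_approx N th r : 0 <= r <= 1 ->
  `|\int[P]_w cos (partial_sum N w + th) - r ^+ N * cos th| <=
  N%:R * (`|\int[P]_w cos (F (Z 0%N w)) - r| + `|\int[P]_w sin (F (Z 0%N w))|).
Proof.
move=> r01.
have mt k : measurable_fun setT (fun w => partial_sum k w + th).
  by apply: measurable_funD => //; exact: measurable_partial_sum.
have C0 : \int[P]_w cos (partial_sum 0 w + th) = cos th.
  under eq_Rintegral do rewrite /partial_sum big_ord0 add0r.
  exact: Rintegral_probability_cst.
rewrite -[in X in X <= _]C0.
apply: (trig_product_approx (C := fun k => \int[P]_w cos (partial_sum k w + th))
  (D := fun k => \int[P]_w sin (partial_sum k w + th))) => // k.
- apply: norm_Rintegral_bound => [|w]; last exact: sin_max.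
  exact: (bounded_measurable_sin (mt k)).1.
- apply: norm_Rintegral_bound => [|w]; last exact: cos_max.
  exact: (bounded_measurable_cos (mt k)).1.
- exact: mean_cos_partial_sumS.
Qed.

End sums.

Section central_limit.
Variables (W : S -> R) (s2 : R).
Hypothesis mW : measurable_fun setT W.
Hypothesis iW : P.-integrable setT (EFin \o (fun w => W (Z 0%N w))).
Hypothesis iW2 : P.-integrable setT (EFin \o (fun w => W (Z 0%N w) ^+ 2)).
Hypothesis EW : \int[P]_w W (Z 0%N w) = 0.
Hypothesis EW2 : \int[P]_w W (Z 0%N w) ^+ 2 = s2.

Let mWZ : measurable_fun setT (fun w => W (Z 0%N w)).
Proof. exact: measurableT_comp. Qed.

Let muW (u : R) : measurable_fun setT (fun x => u * W x).
Proof. exact: measurable_funM. Qed.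

Let s20 : 0 <= s2.
Proof. by rewrite -EW2; apply: Rintegral_ge0 => w _; exact: sqr_ge0. Qed.

Let muWZ (u : R) : measurable_fun setT (fun w => u * W (Z 0%N w)).
Proof. exact: measurable_funM. Qed.

Let iu2 (u : R) : P.-integrable setT (EFin \o (fun w => u ^+ 2 * W (Z 0%N w) ^+ 2)).
Proof. exact: (integrableZl measurableT (u ^+ 2) iW2). Qed.

Let mean_cos_small (u : R) : `|\int[P]_w cos (u * W (Z 0%N w)) - 1| <= u ^+ 2 * s2.
Proof.
have b1 := bounded_measurable_integrable P (bounded_measurable_cst _ 1).
have bc := bounded_measurable_integrable P (bounded_measurable_cos (muWZ u)).
have -> : \int[P]_w cos (u * W (Z 0%N w)) - 1 = \int[P]_w (cos (u * W (Z 0%N w)) - 1).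
  by rewrite RintegralB// Rintegral_probability_cst.
apply: (le_trans (norm_Rintegral_le (g := fun w => u ^+ 2 * W (Z 0%N w) ^+ 2) _ (iu2 u) _)).
- by apply: measurable_funB => //; exact: (bounded_measurable_cos (muWZ u)).1.
- move=> w; rewrite distrC ger0_norm ?cosB1_ge0// -exprMn.
  by have := cosB1_le_sqr (u * W (Z 0%N w)); have := sqr_ge0 (u * W (Z 0%N w)); lra.
- by rewrite RintegralZl// EW2.
Qed.

Let mean_sin_small (u : R) : `|\int[P]_w sin (u * W (Z 0%N w))| <= u ^+ 2 * s2.
Proof.
have bs := bounded_measurable_integrable P (bounded_measurable_sin (muWZ u)).
have iu : P.-integrable setT (EFin \o (fun w => u * W (Z 0%N w))).
  exact: (integrableZl measurableT u iW).
have -> : \int[P]_w sin (u * W (Z 0%N w)) = - \int[P]_w (u * W (Z 0%N w) - sin (u * W (Z 0%N w))).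
  by rewrite RintegralB// RintegralZl// EW mulr0 sub0r opprK.
rewrite normrN.
apply: (le_trans (norm_Rintegral_le (g := fun w => u ^+ 2 * W (Z 0%N w) ^+ 2) _ (iu2 u) _)).
- by apply: measurable_funB => //; exact: (bounded_measurable_sin (muWZ u)).1.
- by move=> w; rewrite -exprMn; apply: le_trans (sinB_sub_le _) _; rewrite ge_min lexx.
- by rewrite RintegralZl// EW2.
Qed.

Definition normalized_sum N w : R := (Num.sqrt N%:R)^-1 * \sum_(j < N) W (Z j w).

Let normalizedE N u w : u * normalized_sum N w =
  partial_sum (fun x => (u * (Num.sqrt N%:R)^-1) * W x) N w.
Proof. by rewrite /normalized_sum /partial_sum -mulr_sumr mulrA. Qed.

(** The case r = 1 of mean_cos_partial_sum_approx. *)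
Lemma normalized_sum_tight N h : 1 - \int[P]_w cos (h * normalized_sum N w) <= 2 * s2 * h ^+ 2.
Proof.
pose u := h * (Num.sqrt N%:R : R)^-1.
have := mean_cos_partial_sum_approx (muW u) N 0 (_ : 0 <= 1 <= 1).
rewrite ler01 lexx => /(_ isT); rewrite expr1n mul1r cos0.
have -> : \int[P]_w cos (partial_sum (fun x => u * W x) N w + 0) =
    \int[P]_w cos (h * normalized_sum N w).
  by apply: eq_Rintegral => w _; rewrite addr0 normalizedE.
move=> a; apply: (@le_trans _ _ `|\int[P]_w cos (h * normalized_sum N w) - 1|).
  by rewrite distrC ler_norm.
apply: (le_trans a); apply: (@le_trans _ _ (N%:R * (u ^+ 2 * s2 + u ^+ 2 * s2))).
  by apply: ler_wpM2l => //; rewrite lerD.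
rewrite (_ : _ * _ = 2 * s2 * (N%:R * u ^+ 2)); last by ring.
apply: ler_wpM2l; first by rewrite mulr_ge0.
rewrite /u exprMn mulrCA ler_piMr ?sqr_ge0// exprVn sqr_sqrtr//.
by case: N {u a} => [|N]; rewrite ?mul0r// mulfV.
Qed.

(** Take for r the value at the frequency N^(-1/2) of the characteristic
    function of the limit: its N-th power does not depend on N, and the error of
    mean_cos_partial_sum_approx is o(1) by characteristic_expansion. *)
Theorem central_limit_trig th :
  \int[P]_w cos (normalized_sum N w + th) @[N --> \oo] --> expR (- (s2 / 2)) * cos th.
Proof.
rewrite -(cvg_shiftS (fun N => \int[P]_w cos (normalized_sum N w + th))).
pose h k : R := (Num.sqrt k.+1%:R)^-1.
have hgt0 k : 0 < h k by rewrite invr_gt0 sqrtr_gt0.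
have h0 k : h k != 0 by rewrite gt_eqF.
have h2 k : h k ^+ 2 = k.+1%:R^-1 by rewrite exprVn sqr_sqrtr.
have hc : h k @[k --> \oo] --> (0 : R).
  have : h k ^+ 2 @[k --> \oo] --> (0 : R).
    by under eq_cvg do rewrite h2; exact: cvg_harmonic.
  have sc : {for 0, continuous (@Num.sqrt R)} by exact: sqrt_continuous.
  move=> /(continuous_cvg _ sc).
  rewrite sqrtr0; apply: cvg_trans; apply: near_eq_cvg.
  by apply: nearW => k; rewrite /= sqrtr_sqr gtr0_norm.
have /cvgrPdist_lt ce := characteristic_expansion mWZ iW iW2 EW EW2 h0 hc.
apply/cvgrPdist_lt => e e0; have := ce e e0; apply: filterS => k.
rewrite sub0r normrN => lt_e.
pose r := expR (- (s2 * h k ^+ 2 / 2)).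
have r01 : 0 <= r <= 1.
  rewrite expR_ge0 -[leRHS]expR0 ler_expR oppr_le0 divr_ge0// mulr_ge0// sqr_ge0//.
have := mean_cos_partial_sum_approx (muW (h k)) k.+1 th r01.
have -> : \int[P]_w cos (partial_sum (fun x => h k * W x) k.+1 w + th) =
    \int[P]_w cos (normalized_sum k.+1 w + th).
  by apply: eq_Rintegral => w _; rewrite -[normalized_sum _ _]mul1r normalizedE mul1r.
have -> : r ^+ k.+1 = expR (- (s2 / 2)).
  rewrite -expRM_natl h2; congr expR; have k0 : k.+1%:R != 0 :> R by [].
  rewrite mulrN; congr (- _); transitivity (s2 / 2 * (k.+1%:R^-1 * k.+1%:R)); first by ring.
  by rewrite mulVf ?mulr1.
rewrite distrC => a; apply: (le_lt_trans a); apply: le_lt_trans lt_e.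
by apply: (le_trans _ (ler_norm _)); rewrite -/r h2 invrK mulrC.
Qed.

End central_limit.
End independent_copies.

(** * Uniqueness of conditional expectations *)

Section conditional_expectation.
Context d (T : measurableType d) (R : realType) (P : probability T R).

Lemma integral_preimage (a f : T -> R) (B : set R) : measurable_fun setT a ->
  measurable B -> measurable_fun setT f ->
  (\int[P]_(w in a @^-1` B) (f w)%:E = \int[P]_w (\1_B (a w) * f w)%:E)%E.
Proof.
move=> ma mB mf; rewrite integral_mkcond; apply: eq_integral => w _.
rewrite patchE indicE /= (_ : (w \in a @^-1` B) = (a w \in B)); last first.
  by apply/idP/idP => /set_mem h; apply/mem_set.
by case: (_ \in _); rewrite ?mul1r ?mul0r.
Qed.

(** In the extended reals +oo - oo is infinite, so a finite integral has a
    finite positive and a finite negative part. *)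
Lemma integrable_of_fin_num (f : T -> R) : measurable_fun setT f ->
  (\int[P]_w (f w)%:E)%E \is a fin_num -> P.-integrable setT (EFin \o f).
Proof.
move=> mf ff; have mE : measurable_fun setT (EFin \o f) by exact/measurable_EFinP.
apply/integrableP; split => //.
move: ff; rewrite integralE.
have p0 : (0 <= \int[P]_w ((EFin \o f)^\+ w))%E by apply: integral_ge0 => w _; exact: funepos_ge0.
have n0 : (0 <= \int[P]_w ((EFin \o f)^\- w))%E by apply: integral_ge0 => w _; exact: funeneg_ge0.
rewrite fin_numB => /andP[fp fn].
rewrite (_ : (fun w => _) = (fun w => (EFin \o f)^\+ w + (EFin \o f)^\- w)%E); last first.
  by apply/funext => w; rewrite -[RHS]/(((EFin \o f)^\+ \+ (EFin \o f)^\-)%E w) -fune_abse.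
rewrite ge0_integralD//; last 2 first.
- exact: measurable_funepos.
- exact: measurable_funeneg.
by rewrite lte_add_pinfty// -ge0_fin_numE.
Qed.

(** On the event where one version exceeds the other their difference has
    integral zero. *)
Lemma cond_exp_unique (alpha Z Y1 Y2 : T -> R) : measurable_fun setT alpha ->
  is_cond_exp P alpha Z Y1 -> is_cond_exp P alpha Z Y2 ->
  P.-integrable setT (EFin \o Y2) -> {ae P, forall w, Y1 w = Y2 w}.
Proof.
move=> ma [mY1 c1] [mY2 c2] i2.
have sub A : g_sigma_algebra_preimage alpha A -> measurable A.
  by move=> [B mB <-]; exact: ma.
have mT (Y : T -> R) : measurable_fun [set: g_sigma_algebra_preimageType alpha]
    (Y : g_sigma_algebra_preimageType alpha -> R) -> measurable_fun setT Y.
  by move=> mY _ B mB; apply: sub; exact: mY.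
have e A : g_sigma_algebra_preimage alpha A ->
    (\int[P]_(w in A) (Y1 w)%:E = \int[P]_(w in A) (Y2 w)%:E)%E.
  by move=> sA; rewrite -c1// c2.
have sT : g_sigma_algebra_preimage alpha setT.
  by exists setT => //; rewrite preimage_setT setIT.
have i1 : P.-integrable setT (EFin \o Y1).
  apply: integrable_of_fin_num; first exact: mT.
  by rewrite e//; exact: integrable_fin_num.
pose g w := Y1 w - Y2 w.
have mg' : measurable_fun [set: g_sigma_algebra_preimageType alpha]
    (g : g_sigma_algebra_preimageType alpha -> R) by exact: measurable_funB.
have mg : measurable_fun setT g := mT _ mg'.
have zero A : g_sigma_algebra_preimage alpha A ->
    (\int[P]_(w in A) (g w)%:E = 0 /\ \int[P]_(w in A) (- g w)%:E = 0)%E.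
  move=> sA; have mA := sub A sA.
  have j1 : P.-integrable A (EFin \o Y1) by exact: (integrableS measurableT mA (@subsetT _ _) i1).
  have j2 : P.-integrable A (EFin \o Y2) by exact: (integrableS measurableT mA (@subsetT _ _) i2).
  have f1 := integrable_fin_num mA j1; have f2 := integrable_fin_num mA j2.
  split; first by under eq_integral do rewrite EFinB; rewrite integralB// e// subee.
  by under eq_integral do rewrite opprB EFinB; rewrite integralB// e// subee.
pose A := g @^-1` `]0, +oo[%classic : set T.
have sA : g_sigma_algebra_preimage alpha A.
  have := mg' measurableT `]0, +oo[%classic (measurable_itv _).
  by rewrite setTI.
have sA' : g_sigma_algebra_preimage alpha (~` A).
  exact: (@measurableC _ (g_sigma_algebra_preimageType alpha)).
have mA := sub _ sA; have mA' := sub _ sA'.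
have abs0 : (\int[P]_w `|(g w)%:E| = 0)%E.
  rewrite -(setUv A) ge0_integral_setU//; last first.
  - by apply/disj_setPCl.
  - by rewrite setUv; apply: measurableT_comp => //; exact/measurable_EFinP.
  rewrite (_ : (\int[P]_(w in A) `|(g w)%:E| = 0)%E) ?add0e; last first.
    rewrite -[RHS](zero A sA).1; apply: eq_integral => w; rewrite inE /A/= in_itv/= andbT => g0.
    by rewrite /= gtr0_norm.
  rewrite -[RHS](zero _ sA').2; apply: eq_integral => w;
    rewrite inE /A/= in_itv/= andbT => /negP; rewrite -leNgt => g0.
  by rewrite /= ler0_norm.
have := (ae_eq_integral_abs P measurableT (f := EFin \o g) _).1 abs0.
move=> /(_ (proj2 (measurable_EFinP _ _) mg)); apply: filterS => w /= h.
by have := h I => -[] /eqP; rewrite subr_eq0 => /eqP.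
Qed.

End conditional_expectation.

(** * The space of paths *)

Section path_space.
Context {R : realType}.

Definition path_generators : set (set (R * (nat -> nat))) :=
  [set E | exists2 B : set R, measurable B & E = [set p | B p.1]] `|`
  [set E | exists k, exists B : set nat, E = [set p | B (p.2 k)]].

(** The copies are independent and identically distributed as random elements
    of this space; all that is known of them is transported through it. *)
Definition path_space := g_sigma_algebraType path_generators.

Lemma measurable_path_parameter : measurable_fun [set: path_space] (fun p : path_space => p.1 :
  R).
Proof.
move=> _ B mB; rewrite setTI; apply: sub_sigma_algebra.
by left; exists B.
Qed.

Lemma measurable_path_coordinate k : measurable_fun [set: path_space] (fun p : path_space =>
  p.2 k).
Proof.
move=> _ B mB; rewrite setTI; apply: sub_sigma_algebra.
by right; exists k, B.
Qed.

Lemma measurable_random_path d (T : measurableType d) (alpha : T -> R) (X : nat -> T -> nat) :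
  measurable_fun setT alpha -> (forall k, measurable_fun setT (X k)) ->
  measurable_fun setT (random_path alpha X : T -> path_space).
Proof.
move=> ma mX.
apply: (@measurability _ _ T path_space setT (random_path alpha X) path_generators) => //.
move=> _ [E [[B mB ->]|[k [B ->]]] <-]; rewrite setTI.
  by rewrite -[X in measurable X]setTI; exact: ma.
by rewrite -[X in measurable X]setTI; exact: mX.
Qed.

End path_space.

(** * The aggregated process *)

Section aggregation.
Context (R : realType) (lambda : R) d (T : measurableType d) (P : probability T R).
Variables (alpha : {RV P >-> R}) (X0 : {RV P >-> nat})
  (xi : nat -> nat -> {RV P >-> nat}) (eps : nat -> {RV P >-> nat}).
Context d' (T' : measurableType d') (P' : probability T' R).
Variables (alpha' : nat -> {RV P' >-> R}) (X' : nat -> nat -> {RV P' >-> nat}).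
Local Notation X := (INAR1 X0 (fun k j => xi k j) (fun k => eps k)).
Hypothesis lambda_gt0 : 0 < lambda.
Hypothesis inputsP : randomized_INAR1_inputs lambda alpha X0 xi eps.
Hypothesis copiesP : independent_copies P P' (random_path alpha X)
  (fun j => random_path (alpha' j) (fun k => X' j k)).
Hypothesis mean_lty : (\int[P]_w ((1 - alpha w)^-1)%:E < +oo)%E.
Local Notation D := (centered_INAR1 lambda alpha X0 xi eps).
Local Notation K := (autocovariance lambda alpha).
Local Notation mean := (cond_mean lambda).
Local Notation path := (@path_space R).

Let Z : T -> path := random_path alpha X.
Let Z' (j : nat) : T' -> path := random_path (alpha' j) (fun k => X' j k).

Let mZ : measurable_fun setT Z.
Proof. by apply: measurable_random_path => // k; exact: (measurable_INAR1 inputsP). Qed.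

Let mZ' j : measurable_fun setT (Z' j).
Proof. exact: measurable_random_path. Qed.

Let transfer j (F : path -> \bar R) : measurable_fun setT F ->
  (\int[P']_w F (Z' j w) = \int[P]_w F (Z w))%E.
Proof. by move=> mF; apply: eq_law_integral => // B mB; exact: copiesP.1. Qed.

Definition path_deviation (k : nat) (p : path) : R := (p.2 k)%:R - mean p.1.

Let measurable_path_mean : measurable_fun setT (fun p : path => mean p.1).
Proof. exact: (measurableT_comp (measurable_cond_mean lambda) measurable_path_parameter). Qed.

Let measurable_path_value k : measurable_fun setT (fun p : path => (p.2 k)%:R : R).
Proof. exact: (measurableT_comp _ (measurable_path_coordinate k)). Qed.

Lemma measurable_path_deviation k : measurable_fun setT (path_deviation k).
Proof. exact: measurable_funB. Qed.

(** Both integrals are integrals over the law of a path, where mean_INAR1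
    applies with an indicator as weight. *)
Lemma cond_exp_copy j k : is_cond_exp P' (alpha' j) (fun w => (X' j k w)%:R)
  (fun w => mean (alpha' j w)).
Proof.
split.
  apply: (measurableT_comp (measurable_cond_mean lambda)).
  by move=> _ B mB; rewrite setTI; exists B => //; rewrite setTI.
move=> _ [B mB <-]; rewrite setTI.
have mB' : measurable_fun setT (fun p : path => \1_B (p.1 : R) : R).
  by apply: (measurableT_comp _ measurable_path_parameter); exact: measurable_indic.
have mX : measurable_fun setT (fun w => (X' j k w)%:R : R).
  by apply: (measurableT_comp (f := fun n : nat => n%:R : R)).
have mm : measurable_fun setT (fun w => mean (alpha' j w)).
  exact: (measurableT_comp (measurable_cond_mean lambda)).
rewrite (integral_preimage P' _ mB mX)// (integral_preimage P' _ mB mm)//.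
have w1 : weight alpha (\1_B : R -> R) by split => //; exact: measurable_indic.
have := transfer j (F := fun p => (\1_B (p.1 : R) * (p.2 k)%:R)%:E).
rewrite /= => ->; last by apply/measurable_EFinP; exact: measurable_funM.
rewrite (mean_INAR1 lambda_gt0 inputsP k w1).
have := transfer j (F := fun p => (\1_B (p.1 : R) * mean p.1)%:E).
by rewrite /= => ->//; apply/measurable_EFinP; exact: measurable_funM.
Qed.

Let integrable_transfer j (F : path -> R) : measurable_fun setT F ->
  P.-integrable setT (EFin \o (fun w => F (Z w))) ->
  P'.-integrable setT (EFin \o (fun w => F (Z' j w))).
Proof.
move=> mF /integrableP[_ iF]; apply/integrableP; split.
  by apply/measurable_EFinP; exact: measurableT_comp.
have := transfer j (F := fun p => `|(F p)%:E|%E).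
rewrite /= => ->//; apply/measurable_EFinP; exact: measurableT_comp.
Qed.

Let Rintegral_transfer j (F : path -> R) : measurable_fun setT F ->
  \int[P']_w F (Z' j w) = \int[P]_w F (Z w).
Proof. by move=> mF; apply: eq_law_mean => // B mB; exact: copiesP.1. Qed.

Lemma cond_exp_version j k (M : T' -> R) :
  is_cond_exp P' (alpha' j) (fun w => (X' j k w)%:R) M ->
  {ae P', forall w, M w = mean (alpha' j w)}.
Proof.
move=> cM; apply: (cond_exp_unique _ cM (cond_exp_copy j k)) => //.
apply: (integrable_transfer j measurable_path_mean).
exact: (integrable_cond_mean lambda_gt0 inputsP mean_lty).
Qed.

Section finite_dimensional.
Variables (n : nat) (ks : 'I_n -> nat) (c : 'I_n -> R).
Let W (p : path) : R := \sum_i c i * path_deviation (ks i) p.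

Lemma measurable_path_combination : measurable_fun setT W.
Proof.
by apply: measurable_sum => i; apply: measurable_funM => //; exact: measurable_path_deviation.
Qed.

Lemma path_combination_moments :
  [/\ P'.-integrable setT (EFin \o (fun w => W (Z' 0%N w))),
      P'.-integrable setT (EFin \o (fun w => W (Z' 0%N w) ^+ 2)),
      \int[P']_w W (Z' 0%N w) = 0 &
      \int[P']_w W (Z' 0%N w) ^+ 2 = covform K ks c].
Proof.
have mW := measurable_path_combination.
have mW2 : measurable_fun setT (fun p => W p ^+ 2) by exact: measurable_funX.
have [i1 e1] := mean_combination_INAR1 lambda_gt0 inputsP mean_lty ks c.
have [i2 e2] := second_moment_combination_INAR1 lambda_gt0 inputsP mean_lty ks c.
split.
- exact: integrable_transfer.
- exact: (integrable_transfer 0 mW2 i2).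
- by rewrite (Rintegral_transfer 0 mW).
- by rewrite (Rintegral_transfer 0 mW2).
Qed.

End finite_dimensional.

Let copies_indep (s : seq nat) (E : nat -> set path) : uniq s ->
  (forall j, measurable (E j)) ->
  P' (joint_event Z' s E) = (\prod_(j <- s) P' (Z' j @^-1` E j))%E.
Proof. by move=> us mE; apply: copiesP.2 => // j _; exact: mE. Qed.

Let copies_law j (E : set path) : measurable E ->
  P' (Z' j @^-1` E) = P' (Z' 0%N @^-1` E).
Proof. by move=> mE; transitivity (P (Z @^-1` E)); [|symmetry]; exact: copiesP.1. Qed.

Local Notation Q := (@unif R).
Local Notation Y := (gaussian_rv K).

Let Kpsd := autocovariance_psd lambda_gt0 inputsP mean_lty.
Let Kstat := autocovariance_stationary lambda alpha.

Let aggregate (k N : nat) (w : T') : R := normalized_sum Z' (path_deviation k) N w.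

Let measurable_aggregate k N : measurable_fun setT (aggregate k N).
Proof.
apply: measurable_funM => //; apply: measurable_sum => j.
exact: (measurableT_comp (measurable_path_deviation k) (mZ' j)).
Qed.

(** A combination of values of the aggregated process is the normalized sum of
    a single function of the independent paths. *)
Lemma cvg_mean_aggregate n (ks : 'I_n -> nat) (f : 'rV[R]_n -> R) (B : R) :
  continuous f -> (forall x, `|f x| <= B) ->
  \int[P']_w f (\row_i aggregate (ks i) N w) @[N --> \oo] -->
  \int[Q]_w f (\row_i Y (ks i) w).
Proof.
apply: (cvg_mean_of_cos (C := 2 * K 0%N 0%N)).
- by move=> N i; exact: measurable_aggregate.
- by move=> i; exact: measurable_gaussian_coord.
- move=> t th; rewrite (mean_cos_gaussian Kpsd ks t th).
  have [i1 i2 e1 e2] := path_combination_moments ks t.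
  have := central_limit_trig (th := th) mZ' copies_indep copies_law
    (measurable_path_combination ks t) i1 i2 e1 e2.
  apply: cvg_trans; apply: near_eq_cvg; apply: nearW => N.
  apply: eq_Rintegral => w _; congr (cos (_ + _)).
  rewrite /normalized_sum [in LHS]exchange_big/= mulr_sumr; apply: eq_bigr => i _.
  by rewrite -mulr_sumr mulrCA.
- move=> N i h.
  have [i1 i2 e1 e2] := path_combination_moments (fun _ : 'I_1 => ks i) (fun=> 1).
  have := normalized_sum_tight mZ' copies_indep copies_law
    (measurable_path_combination (fun _ : 'I_1 => ks i) (fun=> 1)) i1 i2 e1 e2 N h.
  rewrite /covform !big_ord1 !mul1r -[X in K X X]add0n Kstat.
  apply: le_trans; rewrite lerB//.
  set a := Rintegral _ _ _; set b := Rintegral _ _ _; suff -> : a = b by [].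
  apply: eq_Rintegral => w _.
  congr (cos (h * (_ * _))); apply: eq_bigr => j _.
  by rewrite big_ord1 mul1r.
Qed.

(** Almost surely all the versions M j k are equal to lambda / (1 - alpha' j). *)
Lemma fdd_converges_aggregate (M : nat -> nat -> T' -> R) :
  (forall j k, is_cond_exp P' (alpha' j) (fun w => (X' j k w)%:R) (M j k)) ->
  fdd_converges P' Q (fun N k w => (Num.sqrt N%:R)^-1 *
    centered_aggregate (fun j k => X' j k) M N k w) (fun k => Y k).
Proof.
move=> cM n ks f cf [B0 [_ hB]].
have [B fB] : exists B, forall x, `|f x| <= B.
  by exists (B0 + 1) => x; apply: hB => //; rewrite ltrDl.
have mM j k : measurable_fun setT (M j k).
  move=> _ A mA; have [B' mB' eB'] := (cM j k).1 measurableT A mA.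
  by rewrite -eB'; exact: measurable_funPT.
pose V N k w := (Num.sqrt N%:R)^-1 * centered_aggregate (fun j k => X' j k) M N k w.
have mV N k : measurable_fun setT (V N k).
  apply: measurable_funM => //; apply: measurable_sum => j.
  by apply: measurable_funB => //;
    exact: (measurableT_comp _ (@measurable_funPT _ _ _ _ (X' j k))).
have ae_V N : {ae P', forall w, f (\row_i V N (ks i) w) = f (\row_i aggregate (ks i) N w)}.
  have : \forall w \ae P', forall j k, M j k w = mean (alpha' j w).
    apply/ae_foralln => j; apply/ae_foralln => k; exact: (cond_exp_version (cM j k)).
  apply: filterS => w h; congr f; apply/rowP => i; rewrite !mxE /V /aggregate.
  congr (_ * _); apply: eq_bigr => j _.
  by rewrite h.
have bV N := continuous_bounded_measurable_row (fun i => mV N (ks i)) cf fB.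
have bA N := continuous_bounded_measurable_row (fun i => measurable_aggregate (ks i) N) cf fB.
have bY := continuous_bounded_measurable_row (fun i => measurable_gaussian_coord K (ks i)) cf fB.
rewrite unlock EFin_Rintegral; last exact: (bounded_measurable_integrable Q bY).
rewrite (_ : (fun N => _) = (fun N => (\int[P']_w f (\row_i aggregate (ks i) N w))%:E));
  last first.
  apply/funext => N; rewrite -EFin_Rintegral;
    last exact: (bounded_measurable_integrable P' (bA N)).
  apply: ae_eq_integral => //.
  - by apply/measurable_EFinP; exact: (bV N).1.
  - by apply/measurable_EFinP; exact: (bA N).1.
  - by have := ae_V N; apply: filterS => w /= -> _.
apply: cvg_EFin; first exact: nearW.
exact: (cvg_mean_aggregate cf fB).
Qed.

Let cov0 (k : nat) : K 0%N k = \int[P]_w (mean (alpha w) * alpha w ^+ k).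
Proof. by rewrite /autocovariance max0n min0n subn0. Qed.

Lemma covariance_centered k : covariance P (D 0%N) (D k) = (K 0%N k)%:E.
Proof.
have iD k' := integrable_centered lambda_gt0 inputsP mean_lty k'.
have ED k' : ('E_P[D k'] = 0)%E.
  rewrite unlock EFin_Rintegral; last exact: iD.
  by rewrite (mean_centered lambda_gt0 inputsP mean_lty).
rewrite unlock !ED /=.
rewrite -(mean_centeredM lambda_gt0 inputsP mean_lty) unlock.
rewrite -EFin_Rintegral; last exact: (integrable_centeredM lambda_gt0 inputsP mean_lty).
apply: eq_integral => w _ /=.
by rewrite -[in RHS](subr0 (D 0 w)) -[in RHS](subr0 (D k w)).
Qed.

Lemma autocovariance_expectation k :
  (K 0%N k)%:E = (lambda%:E * 'E_P[fun w => (alpha w ^+ k / (1 - alpha w))%R])%E.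
Proof.
have a01 w := alpha_in01 inputsP w.
have a1 w : 0 < 1 - alpha w by rewrite subr_gt0; have /andP[] := a01 w.
rewrite cov0 -EFin_Rintegral; last exact: (integrable_cond_meanX lambda_gt0 inputsP mean_lty).
rewrite unlock -ge0_integralZl_EFin//.
- by apply: eq_integral => w _; rewrite -EFinM /cond_mean; congr EFin; rewrite mulrAC mulrA.
- by move=> w _; rewrite lee_fin divr_ge0 ?(ltW (a1 w))// exprn_ge0//; have /andP[/ltW] := a01 w.
- apply/measurable_EFinP; apply: measurable_funM; first exact: measurable_funX.
  by apply: (measurableT_comp measurable_invr); exact: measurable_funB.
- exact: ltW.
Qed.

End aggregation.

Unset Implicit Arguments.
Set Printing Implicit Defensive.
Local Open Scope ereal_scope.

Theorem proposition4p1 (R : realType) (lambda : R)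
    (d : measure_display) (T : measurableType d) (P : probability T R)
    (alpha : {RV P >-> R}) (X0 : {RV P >-> nat})
    (xi : nat -> nat -> {RV P >-> nat}) (eps : nat -> {RV P >-> nat})
    (d' : measure_display) (T' : measurableType d') (P' : probability T' R)
    (alpha' : nat -> {RV P' >-> R}) (X' : nat -> nat -> {RV P' >-> nat}) :
  let X : nat -> T -> nat := INAR1 X0 (fun k j => xi k j) (fun k => eps k) in
  let centered (k : nat) (w : T) : R :=
    ((X k w)%:R - lambda / (1 - alpha w))%R in
  (0 < lambda)%R ->
  randomized_INAR1_inputs lambda alpha X0 xi eps ->
  independent_copies P P' (random_path alpha X)
    (fun j => random_path (alpha' j) (fun k => X' j k)) ->
  'E_P[fun w => (1 - alpha w)^-1]%R < +oo ->
  (forall j k, is_cond_exp P' (alpha' j) (fun w => (X' j k w)%:R%R)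
     (fun w => lambda / (1 - alpha' j w))%R) /\
  exists (d'' : measure_display) (T'' : measurableType d'')
      (P'' : probability T'' R) (Y : nat -> {RV P'' >-> R}),
    [/\ stationary_process Y,
        gaussian_process Y,
        forall k, 'E_P''[Y k] = 0,
        forall k,
          'E_P''[fun w => Y 0%N w * Y k w]%R
            = covariance P (centered 0%N) (centered k) /\
          covariance P (centered 0%N) (centered k)
            = lambda%:E * 'E_P[fun w => alpha w ^+ k / (1 - alpha w)]%R &
        forall M : nat -> nat -> T' -> R,
          (forall j k,
             is_cond_exp P' (alpha' j) (fun w => (X' j k w)%:R%R) (M j k)) ->
          fdd_converges P' P''
            (fun N k w => ((Num.sqrt N%:R)^-1 *
               centered_aggregate (fun j k => X' j k) M N k w)%R)
            (fun k => Y k)].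
Proof.
move=> X centered lambda_gt0 inputsP copiesP EV.
have mean_lty : \int[P]_w ((1 - alpha w)^-1)%:E < +oo by move: EV; rewrite unlock.
have Kpsd := autocovariance_psd lambda_gt0 inputsP mean_lty.
have Kstat := autocovariance_stationary lambda alpha.
split; first by move=> j k; exact: (cond_exp_copy lambda_gt0 inputsP copiesP).
exists _, (measurableTypeR R), unif, (gaussian_rv (autocovariance lambda alpha)).
split.
- exact: stationary_process_rv.
- exact: gaussian_process_rv.
- exact: (expectation_gaussian_rv Kpsd).
- move=> k; have covE : covariance P (centered 0%N) (centered k) =
      (autocovariance lambda alpha 0 k)%:E.
    exact: (covariance_centered lambda_gt0 inputsP mean_lty).
  by rewrite expectation_gaussian_rvM// covE (autocovariance_expectation lambda_gt0 inputsP
    mean_lty).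
- by move=> M cM; exact: (fdd_converges_aggregate lambda_gt0 inputsP copiesP mean_lty cM).
Qed.
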